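(* Let $a>0$ and let $G(x)=\frac{1}{2\sqrt{\pi a}}e^{-x^2/(4a)}$ be a Gaussian covariance function. Then there exists an objective function $f\in C^\infty([-1,1])$ such that the Expected Improvement optimization of $f$ on $[-1,1]$ with the kernel $G$, starting with $x_1=0$, is not consistent; that is, $f_K^*=\min_{k=1,\dots,K}f(x_k)$ does not converge to $\min_{x\in[-1,1]}f(x)$ as $K\to\infty$, where $\{x_k\}_{k=1}^\infty$ is the optimization trajectory.
   Context: Expected Improvement (EI) optimization of $f:[-1,1]\to\mathbb{R}$ with kernel $G(x,y)=G(x-y)$, the covariance of a centered stationary real Gaussian process $(\xi_x)_{x\in[-1,1]}$: given distinct points $x_1,\dots,x_K\in[-1,1]$, put $f_K^*=\min_{k\le K}f(x_k)$ and $$m_K(x)=\mathbf g_{K,x}^t\mathbf G_K^{-1}\mathbf f_K,\qquad \sigma^2_{x;\{x_k\}_{k=1}^K}=G(0)-\mathbf g_{K,x}^t\mathbf G_K^{-1}\mathbf g_{K,x},$$ where $\mathbf f_K=(f(x_1),\dots,f(x_K))^t$, $\mathbf g_{K,x}=(G(x-x_1),\dots,G(x-x_K))^t$, $\mathbf G_K=(G(x_k-x_l))_{k,l=1}^K$ (the matrix is invertible since the kernel is strictly positive definite). These are the mean and variance of $\xi_x$ conditioned on $\xi_{x_k}=f(x_k)$, $k=1,\dots,K$. The expected improvement is $$I_K(x)=\mathsf{E}\big(f_K^*-\min(f_K^*,Z)\big),\quad Z\sim\mathcal N\big(m_K(x),\sigma^2_{x;\{x_k\}_{k=1}^K}\big).$$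 The algorithm is given by mappings $\mathcal A_K:([-1,1]\times\mathbb{R})^K\to[-1,1]$, with $x_{K+1}=\mathcal A_K(\{x_k,f(x_k)\}_{k=1}^K)$ a maximizer of $I_K$ over $[-1,1]$. If there are several maximizers, any of them can be taken, the choice being a function of the history $\{x_k,f(x_k)\}_{k=1}^K$ only; the mappings $\mathcal A_K$ (i.e. the tie-breaking rule) are regarded as fixed as part of the algorithm before $f$ is chosen. *)

(* Defs.v *)
From HB Require Import structures.
From mathcomp Require Import all_boot all_order all_algebra.
From mathcomp Require Import all_classical all_reals all_analysis.

Set Implicit Arguments.
Unset Strict Implicit.
Unset Printing Implicit Defensive.

Import Order.TTheory GRing.Theory Num.Theory.
Import numFieldNormedType.Exports.

Local Open Scope classical_set_scope.
Local Open Scope ring_scope.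

(* N(m, v), parametrized by the variance. The case v = 0 has to be singled out:
   [normal_prob m 0] is the uniform law on [0, 1], not the Dirac mass at m. *)
Definition gaussian_law (R : realType) (m v : R) :
    probability (measurableTypeR R) R :=
  if v == 0 then (@dirac _ (measurableTypeR R) m R : probability _ _)
  else (normal_prob m (Num.sqrt v) : probability _ _).

Definition gaussian_kernel (R : realType) (a x : R) : R :=
  (2 * Num.sqrt (pi * a))^-1 * expR (- (x ^+ 2 / (4 * a))).

(* The data after K evaluations, ((x_1, f x_1), ..., (x_K, f x_K)), form a
   K-tuple of pairs. *)
Section Posterior.
Context {R : realType} {K : nat}.
Variables (G : R -> R) (h : K.-tuple (R * R)).

Definition pt (k : 'I_K) : R := (tnth h k).1.
Definition obs (k : 'I_K) : R := (tnth h k).2.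

Definition cov_mx : 'M[R]_K := \matrix_(k, l) G (pt k - pt l).
Definition cov_col (x : R) : 'cV[R]_K := \col_k G (x - pt k).
Definition obs_col : 'cV[R]_K := \col_k obs k.

Definition post_mean (x : R) : R :=
  ((cov_col x)^T *m invmx cov_mx *m obs_col) 0 0.

Definition post_var (x : R) : R :=
  G 0 - ((cov_col x)^T *m invmx cov_mx *m cov_col x) 0 0.

End Posterior.

(* f_K^*; tuples of length K.+1, since the minimum is over a nonempty set. *)
Definition best (R : realType) (K : nat) (h : K.+1.-tuple (R * R)) : R :=
  \big[Num.min / obs h ord0]_(k < K.+1) obs h k.

Definition expected_improvement (R : realType) (G : R -> R) (K : nat)
    (h : K.+1.-tuple (R * R)) (x : R) : \bar R :=
  'E_(gaussian_law (post_mean G h x) (post_var G h x))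
    [fun z : R => best h - Num.min (best h) z].

(* A K is the map, denoted by A_{K+1} with the usual numbering from 1, sending
   a history of length K+1 to the next evaluation point. It takes values in
   [-1, 1] on histories located in [-1, 1]; the maximality requirement is
   restricted to pairwise distinct points because otherwise the covariance
   matrix is singular and [invmx] meaningless. *)
Definition EI_rule (R : realType) (G : R -> R)
    (A : forall K : nat, K.+1.-tuple (R * R) -> R) : Prop :=
  forall (K : nat) (h : K.+1.-tuple (R * R)),
    (forall k, pt h k \in `[-1, 1]) ->
    A K h \in `[-1, 1] /\
    (injective (pt h) ->
     forall y : R, y \in `[-1, 1] ->
       (expected_improvement G h y <= expected_improvement G h (A K h))%E).

(* The history of length K+1 of the optimization of f started at x1. *)
Fixpoint trajectory (R : realType)
    (A : forall K : nat, K.+1.-tuple (R * R) -> R) (f : R -> R) (x1 : R)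
    (K : nat) : K.+1.-tuple (R * R) :=
  match K with
  | 0 => [tuple (x1, f x1)]
  | K'.+1 =>
      let h := trajectory A f x1 K' in
      rcons_tuple h (A K' h, f (A K' h))
  end.

(* f is of class C^oo on the compact interval [a, b] (a < b): f is continuous
   on [a, b], infinitely differentiable on ]a, b[, and all its derivatives
   extend continuously to [a, b]. The values of f outside [a, b] are
   irrelevant. *)
Definition smooth_on (R : realType) (a b : R) (f : R -> R) : Prop :=
  {within `[a, b], continuous f} /\
  forall n : nat,
    [/\ {in `]a, b[, forall x, derivable (f^`(n))%classic x 1},
        cvg ((f^`(n))%classic x @[x --> a^'+]) &
        cvg ((f^`(n))%classic x @[x --> b^'-])].

(* Main.v *)
Require Import Defs.
From mathcomp Require Import all_boot all_order all_algebra.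
From mathcomp Require Import all_classical all_reals all_analysis.
From mathcomp Require Import measurable_realfun.
From mathcomp Require Import ring lra.

Set Implicit Arguments.
Unset Strict Implicit.
Unset Printing Implicit Defensive.

Import Order.TTheory GRing.Theory Num.Theory.
Import numFieldNormedType.Exports.

Local Open Scope classical_set_scope.
Local Open Scope ring_scope.

(** The kernel is analytic.  After K evaluations the posterior standard
    deviation is therefore super-exponentially small on all of [-1, 1], and a
    change of the last observed value that is almost invisible in the objective
    moves the posterior mean by an enormous number of standard deviations.  An
    adversary that answers the queries of the algorithm one at a time uses this
    to keep a whole side of 0 empty of evaluation points.

    Let s be the nodes evaluated so far, m the posterior mean and C(x, z) the
    posterior covariance.  Answering the query z by m(z) + t C(z, z) replaces m
    by m + t C(., z) ([post_mean_update]).  The function C(., z) vanishes at the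
    nodes only ([post_cov_ge]), so that it has a constant sign on the empty side
    ([post_cov_sign]), and t is given this sign.  The mean thus stays above the
    best observed value on the empty side, by r standard deviations with r^2 of
    order T^2 p^K K! ([margin], [margin_ge]), where T is a large parameter, and
    the expected improvement there is at most of order exp (- r^2 / 2)
    ([EI_side]).

    On the other hand the maximal expected improvement cannot be that small.
    If D is the minimum over the nodes y of the product of the distances from y
    to the other nodes, it is at least of order D^2 p^K / K!
    ([EI_max_lower]): the mean is C^2, hence at most quadratically above its
    lowest observed value near the node where this value is attained.  The next
    point must then keep a distance of the same order from all the nodes
    ([EI_gap]), so that D is at worst replaced by D^3 p^K / K!
    ([separated_cons]).  Therefore D >= exp (- 4^K T), and since 4^K is
    negligible with respect to K!, the maximizer is never on the empty side if T
    is large enough ([exists_scale], [controlled_step]).  The first value f(0)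
    is taken very low, which keeps the best node inside [-1/2, 1/2].

    The amplitude t is only limited by the requirement that the n-th derivative
    of t C(., z), up to a Gaussian factor, be at most T n! 2^-n 2^-K.  The means
    then converge to a function which is analytic for |x| < 2 up to that factor
    and which takes all the prescribed values ([limit_function]).  Subtracting a
    large multiple of a smooth bump supported by the empty side changes none of
    the observed values and lowers the minimum below all of them
    ([adversarial_function]).

    All the estimates of C come from one comparison principle ([jet_compare]).
    Up to a Gaussian factor C(., z) is an exponential sum, with exponents
    proportional to the nodes and to z, which vanishes at the K nodes.
    Comparing it with the nodal polynomial through the product of the operators
    D - lam x_k, which kills all the exponentials except that of z, bounds it
    from below; comparing them through D^K bounds it from above. *)

(** * Expected improvement for a normal law *)

Section ExpectedImprovement.
Context {R : realType}.
Local Notation mu := (@lebesgue_measure R).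

(** The density is a Radon-Nikodym derivative of the law, and such a derivative
    is unique almost everywhere. *)
Lemma integral_normal_prob (m s : R) (f : measurableTypeR R -> \bar R) :
  measurable_fun [set: measurableTypeR R] f -> (forall x, 0 <= f x)%E ->
  (\int[normal_prob m s]_x f x = \int[mu]_x (f x * (normal_pdf m s x)%:E))%E.
Proof.
move=> mf f0.
pose P := (normal_prob m s : probability (measurableTypeR R) R).
have dom : P `<< mu by exact: normal_prob_dominates.
rewrite -(Radon_Nikodym_SigmaFinite.change_of_variables dom)//.
have mg : measurable_fun setT (Radon_Nikodym_SigmaFinite.f P mu).
  exact: measurable_int (Radon_Nikodym_SigmaFinite.f_integrable dom).
apply: ae_eq_integral => //.
- exact: emeasurable_funM.
- apply: emeasurable_funM => //; apply/measurable_EFinP.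
  exact: measurable_normal_pdf.
- apply: ae_eqe_mul2l; apply: integral_ae_eq => //.
  + exact: Radon_Nikodym_SigmaFinite.f_integrable.
  + by apply/measurable_EFinP; exact: measurable_normal_pdf.
  + by move=> E _ mE; rewrite -Radon_Nikodym_SigmaFinite.f_integral.
Qed.

Definition EI (b m v : R) : \bar R :=
  'E_(gaussian_law m v) [fun z : R => b - Num.min b z].

Lemma impr_ge0 (b z : R) : 0 <= b - Num.min b z.
Proof. by rewrite subr_ge0 ge_min lexx. Qed.

Lemma measurable_impr (b : R) : measurable_fun setT (fun z : R => (b - Num.min b z)%:E).
Proof.
apply/measurable_EFinP; apply: measurable_funB => //.
exact: measurable_minr.
Qed.

Lemma EI_var0 (b m : R) : EI b m 0 = (b - Num.min b m)%:E.
Proof.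
rewrite /EI /gaussian_law eqxx unlock integral_dirac//=.
  by rewrite diracT mul1e.
exact: measurable_impr.
Qed.

Lemma EI_pdf (b m v : R) : 0 < v ->
  EI b m v =
  (\int[mu]_x ((b - Num.min b x) * normal_pdf m (Num.sqrt v) x)%:E)%E.
Proof.
move=> v0; rewrite /EI /gaussian_law gt_eqF// unlock integral_normal_prob//=.
- exact: measurable_impr.
- by move=> x; rewrite lee_fin impr_ge0.
Qed.

Lemma normal_peak_sqrt2 (s : R) : 0 <= s ->
  normal_peak s = Num.sqrt 2 * normal_peak (Num.sqrt 2 * s).
Proof.
move=> s0; rewrite /normal_peak exprMn sqr_sqrtr//.
rewrite (_ : 2 * s ^+ 2 * pi *+ 2 = 2 * (s ^+ 2 * pi *+ 2)); last by ring.
rewrite sqrtrM// invfM mulrA divff ?mul1r// gt_eqF// sqrtr_gt0//.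
Qed.

(** For x < b the square (x - m)^2 is at least (x - b)^2 + (r s)^2, which
    extracts the factor exp (- r^2 / 2).  Half of the remaining exponent absorbs
    the linear factor b - x, and the other half is a normal density with standard
    deviation sqrt 2 * s, whose integral is 1. *)
Lemma impr_pdf_le (b m s r x : R) : 0 < s -> 0 <= r -> r * s <= m - b ->
  (b - Num.min b x) * normal_pdf m s x <=
  Num.sqrt 2 * s * expR (- (r ^+ 2 / 2)) * normal_pdf b (Num.sqrt 2 * s) x.
Proof.
move=> s0 r0 rs.
have q0 : 0 < Num.sqrt 2 * s :> R by rewrite mulr_gt0// sqrtr_gt0.
have [bx|xb] := leP b x.
  by rewrite subrr mul0r !mulr_ge0 ?expR_ge0 ?normal_pdf_ge0// ltW.
rewrite !normal_pdfE ?gt_eqF// (normal_peak_sqrt2 (ltW s0)).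
set d := b - x; have d0 : 0 < d by rewrite subr_gt0.
set P := normal_peak _; have P0 : 0 <= P by exact: normal_peak_ge0.
suff H : d * normal_fun m s x <=
    s * expR (- (r ^+ 2 / 2)) * normal_fun b (Num.sqrt 2 * s) x.
  rewrite (_ : d * _ = Num.sqrt 2 * P * (d * normal_fun m s x)); last by ring.
  rewrite (_ : _ * s * _ * _ = Num.sqrt 2 * P *
    (s * expR (- (r ^+ 2 / 2)) * normal_fun b (Num.sqrt 2 * s) x)); last by ring.
  by rewrite ler_wpM2l// mulr_ge0.
rewrite /normal_fun exprMn sqr_sqrtr//.
have dE : (x - b) ^+ 2 = d ^+ 2 by rewrite /d; ring.
have xm : d ^+ 2 + (r * s) ^+ 2 <= (x - m) ^+ 2.
  have -> : x - m = - (d + (m - b)) by rewrite /d; ring.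
  rewrite sqrrN; move: rs; set e := m - b => rs.
  have rs0 : 0 <= r * s by rewrite mulr_ge0// ltW.
  nra.
rewrite dE.
have dv : d * expR (- ((d / s) ^+ 2 / 4)) <= s.
  rewrite expRN ler_pdivrMr ?expR_gt0//.
  have : d / s <= expR ((d / s) ^+ 2 / 4).
    apply: le_trans (expR_ge1Dx _); rewrite -subr_ge0.
    by rewrite (_ : _ - _ = (1 - d / s / 2) ^+ 2) ?sqr_ge0//; field; rewrite gt_eqF.
  by rewrite ler_pdivrMr// mulrC.
have step : expR (- (x - m) ^+ 2 / (s ^+ 2 *+ 2)) <=
   expR (- ((d / s) ^+ 2 / 4)) * (expR (- (r ^+ 2 / 2)) *
   expR (- d ^+ 2 / (2 * s ^+ 2 *+ 2))).
  rewrite -!expRD ler_expR.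
  have -> : - (x - m) ^+ 2 / (s ^+ 2 *+ 2) = - ((x - m) ^+ 2 / s ^+ 2) / 2.
    by field; rewrite gt_eqF.
  have -> : - ((d / s) ^+ 2 / 4) + (- (r ^+ 2 / 2) + - d ^+ 2 / (2 * s ^+ 2 *+ 2)) =
     - ((d ^+ 2 + (r * s) ^+ 2) / s ^+ 2) / 2.
    by field; rewrite gt_eqF.
  by rewrite ler_pM2r// lerN2 ler_pM2r// invr_gt0 exprn_gt0.
apply: le_trans (ler_wpM2l (ltW d0) step) _.
set C := expR (- (r ^+ 2 / 2)) * _; have C0 : 0 <= C by rewrite mulr_ge0 ?expR_ge0.
by rewrite mulrA; apply: le_trans (ler_wpM2r C0 dv) _; rewrite /C mulrA.
Qed.

Lemma integral_scaled_pdf (c m s : R) : 0 <= c ->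
  (\int[mu]_x (c * normal_pdf m s x)%:E = c%:E)%E.
Proof.
move=> c0; under eq_integral do rewrite EFinM.
rewrite ge0_integralZl//.
- by rewrite integral_normal_pdf mule1.
- by apply/measurable_EFinP; exact: measurable_normal_pdf.
- by move=> x _; rewrite lee_fin normal_pdf_ge0.
Qed.

Lemma measurable_impr_pdf (b m s : R) :
  measurable_fun [set: measurableTypeR R]
    (fun x : R => ((b - Num.min b x) * normal_pdf m s x)%:E).
Proof.
apply/measurable_EFinP; apply: measurable_funM.
  by apply: measurable_funB => //; exact: measurable_minr.
exact: measurable_normal_pdf.
Qed.

Lemma EI_le_tail (b m v r : R) : 0 < v -> 0 <= r ->
  r * Num.sqrt v <= m - b ->
  (EI b m v <= (Num.sqrt 2 * Num.sqrt v * expR (- (r ^+ 2 / 2)))%:E)%E.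
Proof.
move=> v0 r0 rv; have s0 : 0 < Num.sqrt v by rewrite sqrtr_gt0.
rewrite EI_pdf// -(@integral_scaled_pdf _ b (Num.sqrt 2 * Num.sqrt v)); last first.
  by rewrite !mulr_ge0 ?expR_ge0.
apply: ge0_le_integral => //.
- by move=> x _; rewrite lee_fin mulr_ge0 ?impr_ge0 ?normal_pdf_ge0.
- exact: measurable_impr_pdf.
- apply/measurable_EFinP; apply: measurable_funM => //.
  exact: measurable_normal_pdf.
- by move=> x _; rewrite lee_fin impr_pdf_le.
Qed.

(** The improvement over b is at most d plus the improvement over m, for which
    the tail bound with r = 0 applies. *)
Lemma EI_le (b m v d : R) : 0 <= v -> 0 <= d -> b - m <= d ->
  (EI b m v <= (d + Num.sqrt 2 * Num.sqrt v)%:E)%E.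
Proof.
move=> v0 d0 bd; have [<-|v1] := eqVneq 0 v.
  rewrite EI_var0 sqrtr0 mulr0 addr0 lee_fin; case: (leP b m); lra.
have {v1}v0 : 0 < v by rewrite lt_neqAle v1.
have s0 : 0 < Num.sqrt v by rewrite sqrtr_gt0.
apply: (@le_trans _ _ (\int[mu]_x ((d * normal_pdf m (Num.sqrt v) x)%:E +
   (Num.sqrt 2 * Num.sqrt v *
     normal_pdf (m + Num.max 0 (b - m)- Num.max 0 (b - m)) (Num.sqrt 2 * Num.sqrt v) x)%:E))%E).
  rewrite EI_pdf//; apply: ge0_le_integral => //.
  - by move=> x _; rewrite lee_fin mulr_ge0 ?impr_ge0 ?normal_pdf_ge0.
  - exact: measurable_impr_pdf.
  - apply: emeasurable_funD; apply/measurable_EFinP; apply: measurable_funM => //;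
    exact: measurable_normal_pdf.
  - move=> x _; rewrite -EFinD lee_fin addrK.
    have := @impr_pdf_le m m (Num.sqrt v) 0 x s0 (lexx _).
    rewrite mul0r subrr => /(_ (lexx _)).
    rewrite expr0n/= mul0r oppr0 expR0 mulr1 => H.
    apply: le_trans (_ : d * normal_pdf m (Num.sqrt v) x +
      (m - Num.min m x) * normal_pdf m (Num.sqrt v) x <= _).
      rewrite -mulrDl ler_wpM2r ?normal_pdf_ge0//.
      by case: (leP b x); case: (leP m x); lra.
    by rewrite lerD2l.
rewrite ge0_integralD//.
- by rewrite !integral_scaled_pdf// mulr_ge0.
- by move=> x _; rewrite lee_fin mulr_ge0// normal_pdf_ge0.
- by apply/measurable_EFinP; apply: measurable_funM => //; exact: measurable_normal_pdf.
- by move=> x _; rewrite lee_fin !mulr_ge0// normal_pdf_ge0.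
- by apply/measurable_EFinP; apply: measurable_funM => //; exact: measurable_normal_pdf.
Qed.

(** exp (- 9 / 2) / sqrt (2 pi) is s times the density of N(m, s^2) at m - 3 s. *)
Definition EI_const : R := expR (- (9 / 2)) / Num.sqrt (2 * pi).

Lemma EI_const_gt0 : 0 < EI_const.
Proof. by rewrite divr_gt0 ?expR_gt0// sqrtr_gt0 mulr_gt0// pi_gt0. Qed.

(** On the interval [m - 3 s, m - 2 s] the improvement is at least s and the
    density at least EI_const / s. *)
Lemma EI_ge (b m v : R) : 0 < v -> m - b <= Num.sqrt v ->
  ((EI_const * Num.sqrt v)%:E <= EI b m v)%E.
Proof.
move=> v0 mb; have s0 : 0 < Num.sqrt v by rewrite sqrtr_gt0.
set s := Num.sqrt v in mb s0 *.
pose I := `[m - 3 * s, m - 2 * s]%classic : set R.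
apply: (@le_trans _ _ (\int[mu]_(x in I) (EI_const%:E))%E).
  rewrite integral_cst//=; last exact: measurable_itv.
  rewrite lebesgue_measure_itv/= lte_fin ltrD2l ltrN2 ltr_pM2r// ltr_nat/=.
  by rewrite -EFinB -EFinM lee_fin ler_pM2l ?EI_const_gt0//; lra.
rewrite EI_pdf//; apply: (@le_trans _ _
   (\int[mu]_(x in I) ((b - Num.min b x) * normal_pdf m s x)%:E)%E); last first.
  apply: ge0_subset_integral => //.
  - exact: measurable_itv.
  - exact: measurable_impr_pdf.
  - by move=> x _; rewrite lee_fin mulr_ge0 ?impr_ge0 ?normal_pdf_ge0.
apply: ge0_le_integral => //.
- exact: measurable_itv.
- by move=> x _; rewrite lee_fin ltW// EI_const_gt0.
- exact: measurable_funS (measurable_impr_pdf b m s).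
- move=> x; rewrite /I/= in_itv/= => /andP[x1 x2]; rewrite lee_fin.
  have pk : normal_pdf m s x >= expR (- (9 / 2)) / (s * Num.sqrt (2 * pi)).
    rewrite normal_pdfE ?gt_eqF// [X in _ <= X]mulrC ler_pM ?expR_ge0//.
    + by rewrite invr_ge0 mulr_ge0// ltW.
    + rewrite /normal_fun ler_expR mulNr lerN2 ler_pdivrMr; last first.
        by rewrite pmulrn_lgt0// exprn_gt0.
      by nra.
    + rewrite /normal_peak (_ : s ^+ 2 * pi *+ 2 = s ^+ 2 * (2 * pi)); last by ring.
      by rewrite (sqrtrM _ (sqr_ge0 s)) sqrtr_sqr gtr0_norm.
  apply: le_trans (_ : s * (expR (- (9 / 2)) / (s * Num.sqrt (2 * pi))) <= _).
    rewrite /EI_const le_eqVlt; apply/orP; left; apply/eqP; field.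
    by rewrite !gt_eqF// sqrtr_gt0 mulr_gt0// pi_gt0.
  apply: ler_pM => //; first exact: ltW.
    by rewrite divr_ge0 ?expR_ge0// mulr_ge0// ltW.
  by case: (leP b x); lra.
Qed.

End ExpectedImprovement.

(** * Rolle theory for first-order factors D - l *)

Section Jets.
Context {R : realType}.
Implicit Types (u v : nat -> R -> R) (l x : R) (L s : seq R).

(** A function together with all its derivatives.  Carrying the derivatives as a
    sequence makes first-order operators with constant coefficients act on plain
    functions, without any differentiability side condition. *)
Definition jet u := forall n x, is_derive x 1 (u n) (u n.+1 x).

Lemma jet_lin c d u v : jet u -> jet v -> jet (fun n x => c * u n x + d * v n x).
Proof.
move=> ju jv n x; have Hu := ju n x; have Hv := jv n x.
by apply: is_derive_eq; rewrite /= /GRing.scale/=; ring.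
Qed.

Definition opD l u n x := u n.+1 x - l * u n x.

Lemma jet_opD l u : jet u -> jet (opD l u).
Proof.
move=> ju; have : jet (fun n x => 1 * u n.+1 x + (- l) * u n x).
  by apply: jet_lin => // n x; exact: ju.
rewrite (_ : (fun n x => _) = opD l u)//.
by apply/funext => n; apply/funext => x; rewrite /opD mul1r mulNr.
Qed.

Definition opL L u := foldl (fun v l => opD l v) u L.

Lemma opL_lin L c d u v n x :
  opL L (fun n x => c * u n x + d * v n x) n x =
  c * opL L u n x + d * opL L v n x.
Proof.
elim: L u v => //= l L IH u v; rewrite -IH; congr (opL _ _ _ _).
by apply/funext => m; apply/funext => y; rewrite /opD; ring.
Qed.

Lemma jet_continuous u n : jet u -> continuous (u n).
Proof.
move=> ju x; apply: differentiable_continuous; apply/derivable1_diffP.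
by have [] := ju n x.
Qed.

(** Rolle's theorem for exp (- l t) u(t), whose derivative is
    exp (- l t) times (D - l) u. *)
Lemma rolle_opD l u x y : jet u -> x < y -> u 0%N x = 0 -> u 0%N y = 0 ->
  exists2 c, x < c < y & opD l u 0%N c = 0.
Proof.
move=> ju xy ux uy.
pose f (t : R) := expR (- l * t) * u 0%N t.
have df (t : R) : is_derive t 1 f (expR (- l * t) * opD l u 0%N t).
  have Hu := ju 0%N t; rewrite /f.
  have He : is_derive t 1 (fun t : R => expR (- l * t)) (- l * expR (- l * t)).
    have H1 : is_derive t 1 (fun t : R => - l * t) (- l).
      by apply: is_derive_eq; rewrite /GRing.scale/= mulr1.
    have := is_derive1_comp (is_derive_expR (- l * t)) H1; by rewrite mulrC.
  by apply: is_derive_eq; rewrite /opD /GRing.scale/=; ring.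
have [||| c] := @Rolle _ f x y xy.
- by move=> t _; have [] := df t.
- apply: continuous_subspaceT => t.
  apply: differentiable_continuous; apply/derivable1_diffP.
  by have [] := df t.
- by rewrite /f ux uy !mulr0.
rewrite in_itv/= => cxy dfc; exists c => //.
have D1 := @derive_val _ _ _ _ _ _ _ (df c).
have D0 := @derive_val _ _ _ _ _ _ _ dfc.
have /eqP : expR (- l * c) * opD l u 0%N c = 0 by rewrite -D1 D0.
by rewrite mulf_eq0 expR_eq0/= => /eqP.
Qed.

Lemma rolle_path l u x s : jet u -> path <%R x s ->
  (forall y, y \in x :: s -> u 0%N y = 0) ->
  exists s', [/\ size s' = size s, path <%R x s',
    (forall y, y \in s' -> y <= last x s) & forall y, y \in s' -> opD l u 0%N y = 0].
Proof.
move=> ju; elim: s x => [|y s IH] x /=; first by exists [::].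
move=> /andP[xy ps] z.
have [|s' [ss ps' ls zs]] := IH y ps.
  by move=> t ht; apply: z; rewrite in_cons ht orbT.
have [||c /andP[xc cy] zc] := rolle_opD l ju xy.
- by apply: z; rewrite mem_head.
- by apply: z; rewrite in_cons mem_head orbT.
exists (c :: s'); split => /=.
- by rewrite ss.
- rewrite xc/=; case: s' ps' {ss ls zs} => //= t s' /andP[yt ->].
  by rewrite (lt_trans cy yt).
- move=> t; rewrite inE => /orP[/eqP ->|/ls//].
  apply: le_trans (ltW cy) _.
  have : all (fun t => y <= t) s.
    by apply/allP => r rs; have /allP/(_ _ rs)/ltW := order_path_min lt_trans ps.
  by case/lastP: (s) => //= s1 r; rewrite last_rcons all_rcons => /andP[].
- by move=> t; rewrite inE => /orP[/eqP ->|/zs].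
Qed.

Lemma opL_zero_path L u x s : jet u -> path <%R x s -> size L = size s ->
  (forall y, y \in x :: s -> u 0%N y = 0) ->
  exists2 xi, x <= xi <= last x s & opL L u 0%N xi = 0.
Proof.
elim: L u x s => [|l L IH] u x s ju ps.
  move=> /esym/size0nil -> z; exists x; first by rewrite /= !lexx.
  by apply: z; rewrite mem_head.
move=> sL z; have [s' [ss ps' ls zs]] := rolle_path l ju ps z.
case: s' ss ps' ls zs => [|y s'] /=; first by rewrite -sL.
move=> ss /andP[xy ps'] ls zs.
have [||||xi /andP[x1 x2] zx] := IH (opD l u) y s'; rewrite ?inE//.
- exact: jet_opD.
- by move: ss; rewrite -sL => -[].
exists xi => //; rewrite (le_trans (ltW xy) x1)/=.
by apply: le_trans x2 (ls _ _); rewrite mem_last.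
Qed.

Lemma opL_zero L u s lo hi : jet u -> uniq s -> size s = (size L).+1 ->
  (forall y, y \in s -> lo <= y <= hi) -> (forall y, y \in s -> u 0%N y = 0) ->
  exists2 xi, lo <= xi <= hi & opL L u 0%N xi = 0.
Proof.
move=> ju us ss bs zs.
have := sort_lt_sorted s; rewrite us => sr.
have mem y : (y \in sort <=%R s) = (y \in s) by rewrite mem_sort.
have sz : size (sort <=%R s) = size s by rewrite size_sort.
case: (sort _ s) sr mem sz => [|x s1]/= sr mem sz; first by rewrite -sz in ss.
have [||xi /andP[x1 x2] z] := @opL_zero_path L u x s1 ju sr.
- by move: sz; rewrite ss => -[].
- by move=> y; rewrite mem => /zs.
exists xi => //.
have /bs/andP[lx _] : x \in s by rewrite -mem mem_head.
have /bs/andP[_ hx] : last x s1 \in s by rewrite -mem mem_last.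
by rewrite (le_trans lx x1) (le_trans x2 hx).
Qed.

(** A generalized Lagrange remainder: the combination u(x) p - p(x) u vanishes
    at the nodes and at x, so that Rolle's theorem, applied once for each factor of
    the operator, gives a zero of its image. *)
Lemma jet_compare L u p s lo hi x : jet u -> jet p ->
  uniq s -> size s = size L -> x \notin s ->
  (forall y, y \in x :: s -> lo <= y <= hi) ->
  (forall y, y \in s -> u 0%N y = 0) -> (forall y, y \in s -> p 0%N y = 0) ->
  exists2 xi, lo <= xi <= hi &
    u 0%N x * opL L p 0%N xi = p 0%N x * opL L u 0%N xi.
Proof.
move=> ju jp us ss xs bs zu zp.
have [|||||xi bx] := @opL_zero L (fun n t => u 0%N x * p n t + (- p 0%N x) * u n t)
   (x :: s) lo hi => //.
- exact: jet_lin.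
- by rewrite /= xs.
- by rewrite /= ss.
- move=> y; rewrite inE => /orP[/eqP ->|ys]; first by ring.
  by rewrite (zu _ ys) (zp _ ys) !mulr0 addr0.
rewrite opL_lin => /eqP; rewrite mulNr subr_eq0 => /eqP H.
by exists xi.
Qed.

End Jets.

(** * Exponential sums and nodal polynomials *)

Section Nodes.
Context {R : realType}.
Implicit Types (u v : nat -> R -> R) (lam l x : R) (L s : seq R).

Definition nodal s x : R := \prod_(y <- s) (x - y).

Lemma nodal_eq0 s x : (nodal s x == 0) = (x \in s).
Proof.
rewrite /nodal prodf_seq_eq0; apply/hasP/idP => [[y ys]|xs].
  by rewrite subr_eq0 => /eqP ->.
by exists x => //=; rewrite subrr eqxx.
Qed.

Lemma nodal_gt0 s x : x \notin s -> 0 < `|nodal s x|.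
Proof. by rewrite normr_gt0 nodal_eq0. Qed.

Lemma normr_nodal s x : `|nodal s x| = \prod_(y <- s) `|x - y|.
Proof. by rewrite /nodal normr_prod. Qed.

(** The n-th derivative of the sum of the b y * exp (lam y x). *)
Definition expsum lam (b : R -> R) (ys : seq R) (n : nat) (x : R) : R :=
  \sum_(y <- ys) b y * (lam * y) ^+ n * expR (lam * y * x).

Lemma is_derive_expR_lin c x : is_derive x 1 (fun t : R => expR (c * t)) (c * expR (c * x)).
Proof.
have H1 : is_derive x 1 (fun t : R => c * t) c.
  by apply: is_derive_eq; rewrite /GRing.scale/= mulr1.
have := is_derive1_comp (is_derive_expR (c * x)) H1; by rewrite mulrC.
Qed.

Lemma jet_sum (I : Type) (r : seq I) (F : I -> nat -> R -> R) :
  (forall i, jet (F i)) -> jet (fun n x => \sum_(i <- r) F i n x).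
Proof.
move=> jF; elim: r => [|i r IH] n x.
  rewrite big_nil (_ : (fun x => _) = cst 0); first exact: is_derive_cst.
  by apply/funext => t; rewrite big_nil.
rewrite big_cons (_ : (fun x => _) =
   (F i n : R -> R) + (fun x : R => \sum_(i <- r) F i n x)); last first.
  by apply/funext => t; rewrite big_cons.
have H1 := jF i n x; have H2 := IH n x.
exact: is_deriveD.
Qed.

Lemma jet_expsum lam b ys : jet (expsum lam b ys).
Proof.
apply: jet_sum => y n x.
have H := is_derive_expR_lin (lam * y) x.
have -> : (fun t : R => b y * (lam * y) ^+ n * expR (lam * y * t)) =
  (b y * (lam * y) ^+ n) *: (fun t : R => expR (lam * y * t)) by [].
by apply: is_derive_eq; rewrite /GRing.scale/= exprSr !mulrA.
Qed.

Lemma opL_expsum lam b ys L n x :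
  opL (map (fun l => lam * l) L) (expsum lam b ys) n x =
  expsum lam (fun y => b y * (lam ^+ size L * nodal L y)) ys n x.
Proof.
elim: L b => [|l L IH] b /=.
  by apply: eq_bigr => y _; rewrite /nodal big_nil expr0 !mulr1.
rewrite (_ : opD _ _ = expsum lam (fun y => b y * (lam * (y - l))) ys); last first.
  apply/funext => m; apply/funext => t; rewrite /opD /expsum mulr_sumr -sumrB.
  by apply: eq_bigr => y _; rewrite exprS; ring.
rewrite IH; apply: eq_bigr => y _; rewrite /nodal big_cons exprS; congr (_ * _ * _).
by ring.
Qed.

(** The operator is a multiple of nodal s evaluated at the exponent, hence it
    annihilates the exponentials attached to s. *)
Lemma expsum_killed lam b z s n x :
  opL (map (fun l => lam * l) s) (expsum lam b (z :: s)) n x =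
  b z * (lam ^+ size s * nodal s z) * (lam * z) ^+ n * expR (lam * z * x).
Proof.
rewrite opL_expsum /expsum big_cons big_seq big1 ?addr0// => y ys.
have /eqP -> : nodal s y == 0 by rewrite nodal_eq0.
by rewrite !(mulr0, mul0r).
Qed.

Definition polyJ (p : {poly R}) (n : nat) (x : R) : R := (p^`(n)).[x].

Lemma jet_polyJ p : jet (polyJ p).
Proof. by move=> n x; rewrite /polyJ derivnS; exact: is_derive_poly. Qed.

Definition opP L (p : {poly R}) := foldl (fun q l => q^`() - l *: q) p L.

Lemma opL_polyJ L p n x : opL L (polyJ p) n x = polyJ (opP L p) n x.
Proof.
elim: L p => //= l L IH p; rewrite -IH; congr (opL _ _ _ _).
apply/funext => m; apply/funext => y.
by rewrite /opD /polyJ derivnB derivnZ -derivSn hornerD hornerN hornerZ.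
Qed.

(** The l^1 norm of the coefficients, which bounds p on [-1, 1]. *)
Definition norm1 (n : nat) (p : {poly R}) : R := \sum_(i < n) `|p`_i|.

Lemma horner_norm1 n (p : {poly R}) x : (size p <= n)%N -> `|x| <= 1 -> `|p.[x]| <= norm1 n p.
Proof.
move=> sp x1; rewrite (horner_coef_wide _ sp).
apply: le_trans (ler_norm_sum _ _ _) _; apply: ler_sum => i _.
by rewrite normrM ler_piMr// normrX exprn_ile1.
Qed.

(** On polynomials of degree less than n, the operator D - l has l^1 norm at
    most n + |l|. *)
Lemma norm1_opP n lam L (p : {poly R}) : (size p <= n)%N -> 0 <= lam ->
  (forall l, l \in L -> `|l| <= lam) ->
  (size (opP L p) <= n)%N /\ norm1 n (opP L p) <= (n%:R + lam) ^+ size L * norm1 n p.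
Proof.
move=> + lam0; elim: L p => [|l L IH] p sp lL /=; first by rewrite mul1r.
have sq : (size (p^`() - l *: p)%R <= n)%N.
  apply: leq_trans (size_polyD _ _) _; rewrite geq_max size_polyN.
  rewrite (leq_trans (size_scale_leq _ _))// andbT.
  by apply: leq_trans (size_poly _ _) _; case: (size p) sp => //= k /ltnW.
have [|sz le] := IH _ sq; first by move=> t tL; apply: lL; rewrite inE tL orbT.
split => //; apply: le_trans le _; rewrite exprSr -mulrA.
rewrite ler_wpM2l ?exprn_ge0 ?addr_ge0// mulrDl.
apply: le_trans (_ : \sum_(i < n) (n%:R * `|p`_i.+1| + lam * `|p`_i|) <= _).
  apply: ler_sum => i _; rewrite coefB coefZ coef_deriv.
  apply: le_trans (ler_normB _ _) _; apply: lerD.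
    by rewrite normrMn -[leLHS]mulr_natl; apply: ler_wpM2r => //; rewrite ler_nat.
  by rewrite normrM ler_wpM2r// lL ?mem_head.
rewrite big_split/= -!mulr_sumr lerD2r ler_wpM2l// /norm1.
case: n sp {sq sz IH} => [|n] sp; first by rewrite !big_ord0.
rewrite big_ord_recr [leRHS]big_ord_recl/= (nth_default 0 sp) normr0 addr0.
by rewrite lerDr.
Qed.

Definition nodal_poly s : {poly R} := \prod_(y <- s) ('X - y%:P).

Lemma horner_nodal s x : (nodal_poly s).[x] = nodal s x.
Proof.
by rewrite horner_prod; apply: eq_bigr => y _; rewrite hornerXsubC.
Qed.

Lemma size_nodal s : size (nodal_poly s) = (size s).+1.
Proof. exact: size_prod_XsubC. Qed.

Lemma norm1_nodal s : (forall y, y \in s -> `|y| <= 1) ->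
  norm1 (size s).+1 (nodal_poly s) <= 2 ^+ size s.
Proof.
elim: s => [|y s IH] bs.
  by rewrite /norm1 big_ord_recl big_ord0 /nodal_poly big_nil coef1/= normr1 addr0.
rewrite /nodal_poly big_cons -/(nodal_poly s) /= exprS.
set p := nodal_poly s; set n := (size s).+1.
have pn : p`_n = 0 by apply: nth_default; rewrite size_nodal.
have {}IH : norm1 n p <= 2 ^+ size s.
  by apply: IH => t ts; apply: bs; rewrite inE ts orbT.
apply: le_trans (_ : 2 * norm1 n p <= _); last by rewrite ler_wpM2l.
have y1 : `|y| <= 1 by apply: bs; rewrite mem_head.
apply: le_trans (_ : \sum_(i < n.+1) (`|('X * p)`_i| + `|p`_i|) <= _).
  apply: ler_sum => i _; rewrite mulrBl coefB mul_polyC coefZ.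
  apply: le_trans (ler_normB _ _) _; rewrite lerD2l normrM.
  by rewrite ler_piMl.
rewrite big_split/= mulr2n mulrDl mul1r; apply: lerD.
  rewrite big_ord_recl/= coefXM/= normr0 add0r.
  by apply: ler_sum => i _; rewrite coefXM.
by rewrite big_ord_recr/= pn normr0 addr0.
Qed.

(** [jet_compare] with the operators D - lam y, for y in s: the sum u is mapped to
    a single exponential, and the nodal polynomial to a polynomial controlled by
    [norm1_opP]. *)
Lemma expsum_lower lam b z s x : 0 <= lam -> uniq s -> x \notin s ->
  (forall y, y \in [:: x, z & s] -> `|y| <= 1) ->
  (forall y, y \in s -> expsum lam b (z :: s) 0 y = 0) ->
  `|b z| * lam ^+ size s * expR (- lam) * `|nodal s z| * `|nodal s x| <=
  `|expsum lam b (z :: s) 0 x| * (2 ^+ size s * ((size s).+1%:R + lam) ^+ size s).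
Proof.
move=> lam0 us xs bs zs.
have [||||xi bx] := @jet_compare _ (map (fun l => lam * l) s) _
    (polyJ (nodal_poly s)) s (-1) 1 x (jet_expsum lam b (z :: s))
    (jet_polyJ (nodal_poly s)) us _ xs.
- by rewrite size_map.
- move=> y; rewrite inE => /orP[/eqP ->|ys]; rewrite -ler_norml; apply: bs.
    by rewrite mem_head.
  by rewrite !inE ys !orbT.
- exact: zs.
- by move=> y ys; rewrite /polyJ derivn0 horner_nodal; apply/eqP; rewrite nodal_eq0.
rewrite opL_polyJ /polyJ !derivn0 horner_nodal expsum_killed expr0 mulr1 => E.
have xi1 : `|xi| <= 1 by rewrite ler_norml.
have H : `|(opP (map (fun l => lam * l) s) (nodal_poly s)).[xi]| <=
    2 ^+ size s * ((size s).+1%:R + lam) ^+ size s.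
  have [||sz le] := @norm1_opP (size s).+1 lam (map (fun l => lam * l) s)
     (nodal_poly s) _ lam0.
  - by rewrite size_nodal.
  - move=> _ /mapP[l ls ->]; rewrite normrM (ger0_norm lam0) ler_piMr//.
    by apply: bs; rewrite !inE ls !orbT.
  apply: le_trans (horner_norm1 sz xi1) _; apply: le_trans le _.
  rewrite size_map mulrC ler_wpM2r ?exprn_ge0 ?addr_ge0// norm1_nodal// => y ys.
  by apply: bs; rewrite !inE ys !orbT.
apply: le_trans (ler_wpM2l (normr_ge0 _) H); rewrite -normrM E !normrM.
rewrite [`|expR _|]ger0_norm ?expR_ge0// [`|lam ^+ _|]ger0_norm ?exprn_ge0//.
have e1 : expR (- lam) <= expR (lam * z * xi).
  rewrite ler_expR; have : `|lam * z * xi| <= lam.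
    rewrite !normrM (ger0_norm lam0) -mulrA ler_piMr// mulr_ile1//.
    by apply: bs; rewrite !inE eqxx orbT.
  by rewrite ler_norml => /andP[].
set C := `|nodal s x| * `|b z| * lam ^+ size s * `|nodal s z|.
rewrite [leLHS](_ : _ = C * expR (- lam)); last by rewrite /C; ring.
rewrite [leRHS](_ : _ = C * expR (lam * z * xi)); last by rewrite /C; ring.
by apply: ler_wpM2l => //; rewrite !mulr_ge0// exprn_ge0.
Qed.

Lemma opL_nseq0 k u n x : opL (nseq k 0) u n x = u (n + k)%N x.
Proof.
elim: k u => [|k IH] u /=; first by rewrite addn0.
by rewrite IH /opD mul0r subr0 addnS.
Qed.

Lemma derivn_nodal s x : (nodal_poly s)^`(size s).[x] = (size s)`!%:R.
Proof.
have -> : (nodal_poly s)^`(size s) = ((size s)`!%:R)%:P; last by rewrite hornerC.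
apply/polyP => i; rewrite coef_derivn coefC.
have [->|i0] := eqVneq i 0%N.
  have := monic_prod_XsubC s xpredT id; rewrite monicE lead_coefE => /eqP.
  rewrite -/(nodal_poly s) size_nodal/= addn0 => ->.
  by rewrite ffactnn.
by rewrite nth_default ?mul0rn// size_nodal; case: i i0 => // i _; rewrite addnS ltnS leq_addr.
Qed.

(** [jet_compare] with the operator D^K, for which the nodal polynomial has the
    constant image K!. *)
Lemma nodal_mvt u s x : jet u -> uniq s ->
  (forall y, y \in x :: s -> `|y| <= 1) -> (forall y, y \in s -> u 0%N y = 0) ->
  exists2 xi, `|xi| <= 1 & u 0%N x * (size s)`!%:R = nodal s x * u (size s) xi.
Proof.
move=> ju us bs zs; have [xs|xs] := boolP (x \in s).
  exists 0; first by rewrite normr0.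
  have /eqP -> : nodal s x == 0 by rewrite nodal_eq0.
  by rewrite zs// !mul0r.
have [||||xi bx] := @jet_compare _ (nseq (size s) 0) u
    (polyJ (nodal_poly s)) s (-1) 1 x ju (jet_polyJ (nodal_poly s)) us _ xs.
- by rewrite size_nseq.
- by move=> y ys; rewrite -ler_norml; apply: bs.
- exact: zs.
- by move=> y ys; rewrite /polyJ derivn0 horner_nodal; apply/eqP; rewrite nodal_eq0.
rewrite !opL_nseq0 !add0n /polyJ derivn_nodal derivn0 horner_nodal => E.
by exists xi => //; rewrite ler_norml.
Qed.

Lemma zeros_deriv n k u s : jet u -> uniq s -> size s = (n + k)%N ->
  (forall y, y \in s -> `|y| <= 1) -> (forall y, y \in s -> u 0%N y = 0) ->
  exists s', [/\ uniq s', size s' = k, (forall y, y \in s' -> `|y| <= 1) &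
    forall y, y \in s' -> u n y = 0].
Proof.
elim: n u s => [|n IH] u s ju us ss bs zs.
  by exists s.
have := sort_lt_sorted s; rewrite us => sr.
have mem y : (y \in sort <=%R s) = (y \in s) by rewrite mem_sort.
have sz : size (sort <=%R s) = size s by rewrite size_sort.
case: (sort _ s) sr mem sz => [|x s1]/= sr mem sz; first by rewrite ss in sz.
have [|s' [ss' ps' ls zs']] := @rolle_path _ 0 u x s1 ju sr.
  by move=> y; rewrite mem => /zs.
have [|||||s2 [u2 sz2 b2 z2]] := IH (fun m => u m.+1) s'.
- by move=> m t; exact: ju.
- have := path_sorted ps'; rewrite lt_sorted_uniq_le => /andP[]//.
- by rewrite ss'; move: sz; rewrite ss addSn => -[].
- move=> y ys; rewrite ler_norml; apply/andP; split.
    have /allP/(_ _ ys) := order_path_min lt_trans ps'.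
    have : `|x| <= 1 by apply: bs; rewrite -mem mem_head.
    by rewrite ler_norml => /andP[xl _] xy; rewrite (le_trans xl)// ltW.
  apply: le_trans (ls _ ys) _.
  have : `|last x s1| <= 1 by apply: bs; rewrite -mem mem_last.
  by rewrite ler_norml => /andP[].
- by move=> y /zs'; rewrite /opD mul0r subr0.
by exists s2.
Qed.

Lemma nodal_le2 s x : (forall y, y \in x :: s -> `|y| <= 1) ->
  `|nodal s x| <= 2 ^+ size s.
Proof.
move=> bs; rewrite normr_nodal; elim: s bs => [|y s IH] bs.
  by rewrite big_nil.
rewrite big_cons exprS ler_pM//.
- by rewrite prodr_ge0.
- apply: le_trans (ler_normB _ _) _; rewrite (_ : 2 = 1 + 1) ?lerD//; apply: bs.
    by rewrite mem_head.
  by rewrite !inE eqxx orbT.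
- apply: IH => t; rewrite inE => /orP[/eqP ->|ts]; apply: bs.
    by rewrite mem_head.
  by rewrite !inE ts !orbT.
Qed.

(** The n-th derivative still has K - n zeros, so that [nodal_mvt] applies to it.
    The factorial is what makes the derivatives of low order as small as u. *)
Lemma jet_zeros_bound u s n x B : jet u -> uniq s -> (n <= size s)%N ->
  (forall y, y \in x :: s -> `|y| <= 1) -> (forall y, y \in s -> u 0%N y = 0) ->
  (forall y, `|y| <= 1 -> `|u (size s) y| <= B) ->
  `|u n x| * (size s - n)`!%:R <= 2 ^+ (size s - n) * B.
Proof.
move=> ju us ns bs zs uB.
have [|||s' [us' ss' bs' zs']] := @zeros_deriv n (size s - n) u s ju us.
- by rewrite subnKC.
- by move=> y ys; apply: bs; rewrite inE ys orbT.
- exact: zs.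
have bs2 y : y \in x :: s' -> `|y| <= 1.
  by rewrite inE => /orP[/eqP ->|/bs'//]; apply: bs; rewrite mem_head.
have [||xi xi1 E] := @nodal_mvt (fun m => u (n + m)%N) s' x _ us' bs2.
- by move=> m t; rewrite addnS; exact: ju.
- by move=> y /zs'; rewrite addn0.
rewrite addn0 ss' subnKC// in E.
have -> : `|u n x| * (size s - n)`!%:R = `|u n x * (size s - n)`!%:R|.
  by rewrite normrM [`|_%:R|]ger0_norm.
rewrite E normrM ler_pM//; last exact: uB.
by rewrite -ss'; exact: nodal_le2.
Qed.

End Nodes.

(** * Moments and energy of an exponential sum *)

Section Moments.
Context {R : realType}.
Implicit Types (lam x y z : R) (b : R -> R) (s ys : seq R).

Lemma exp_coeff_le x n : 0 <= x -> x ^+ n / n`!%:R <= expR x.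
Proof.
move=> x0; case: n => [|n]; first by rewrite expr0 fact0 divr1 -expR0 ler_expR.
by apply: le_trans (expR_ge1Dxn n x0); rewrite lerDr.
Qed.

Lemma bin_le_exp2 n m : ('C(n, m) <= 2 ^ n)%N.
Proof.
elim: n m => [|n IH] [|m]; rewrite ?bin0 ?expn_gt0// ?bin0n//.
by rewrite binS expnS mul2n -addnn leq_add.
Qed.

Lemma factD_le n m : ((n + m)`! <= 2 ^ (n + m) * (n`! * m`!))%N.
Proof.
have /bin_fact <- : (m <= n + m)%N by rewrite leq_addl.
by rewrite addnK (mulnC m`!) leq_mul2r bin_le_exp2 orbT.
Qed.

Lemma factD_ge n m : (n`! * m`! <= (n + m)`!)%N.
Proof.
have /bin_fact <- : (m <= n + m)%N by rewrite leq_addl.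
by rewrite addnK (mulnC m`!) leq_pmull// bin_gt0 leq_addl.
Qed.

Lemma norm_lim_le (u : nat -> R) l c :
  u @ \oo --> l -> (forall n, `|u n| <= c) -> `|l| <= c.
Proof.
move=> ul uc; rewrite leNgt; apply/negP => cl.
have [n _ /(_ n (leqnn n))] := cvgr_norm_gt _ ul _ cl.
by rewrite ltNge uc.
Qed.

Definition moment b ys n : R := \sum_(y <- ys) b y * y ^+ n.

(** The squared norm of the sum of the b y * exp (lam y x) in the reproducing
    kernel Hilbert space of the kernel exp (lam x y). *)
Definition energy lam b ys : R :=
  \sum_(y <- ys) b y * expsum lam b ys 0 y.

Lemma cvg_wsum (ys : seq R) (c : R -> R) (f : R -> nat -> R) (l : R -> R) :
  (forall y, f y @ \oo --> l y) ->
  (fun M => \sum_(y <- ys) c y * f y M) @ \oo --> \sum_(y <- ys) c y * l y.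
Proof.
move=> H; elim: ys => [|y ys IH].
  rewrite big_nil (_ : (fun _ => _) = cst 0); first exact: cvg_cst.
  by apply/funext => M; rewrite big_nil.
rewrite big_cons (_ : (fun _ => _) =
    (fun M => c y * f y M) \+ (fun M => \sum_(y <- ys) c y * f y M)); last first.
  by apply/funext => M; rewrite big_cons.
by apply: cvgD => //; apply: cvgMr.
Qed.

Lemma cvg_expsum lam b ys m x :
  series (fun k => (lam * x) ^+ k / k`!%:R * (lam ^+ m * moment b ys (m + k))) @ \oo
    --> expsum lam b ys m x.
Proof.
rewrite (_ : series _ = fun M => \sum_(y <- ys) b y * (lam * y) ^+ m *
    series (exp_coeff (lam * y * x)) M); last first.
  apply/funext => M; rewrite /series/=; under [RHS]eq_bigr do rewrite mulr_sumr.
  rewrite exchange_big/=; apply: eq_bigr => k _.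
  rewrite /moment !mulr_sumr; apply: eq_bigr => y _.
  by rewrite /exp_coeff/= exprD !exprMn; ring.
by apply: cvg_wsum => y; exact: is_cvg_series_exp_coeff.
Qed.

(** In the orthogonal basis of the monomials, the coordinates of an exponential
    sum are its moments. *)
Lemma cvg_energy lam b ys :
  series (fun k => lam ^+ k / k`!%:R * moment b ys k ^+ 2) @ \oo --> energy lam b ys.
Proof.
rewrite (_ : series _ = fun M => \sum_(y <- ys) b y *
    series (fun k => (lam * y) ^+ k / k`!%:R * (lam ^+ 0 * moment b ys (0 + k))) M); last first.
  apply/funext => M; rewrite /series/=; under [RHS]eq_bigr do rewrite mulr_sumr.
  rewrite exchange_big/=; apply: eq_bigr => k _.
  rewrite add0n expr0 mul1r expr2 {2}/moment !mulr_suml !mulr_sumr; apply: eq_bigr => y _.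
  by rewrite exprMn -/(moment b ys k); ring.
by apply: cvg_wsum => y; exact: cvg_expsum.
Qed.

Lemma moment_le lam b ys n : 0 <= lam ->
  lam ^+ n / n`!%:R * moment b ys n ^+ 2 <= energy lam b ys.
Proof.
move=> lam0; have cv := @cvg_energy lam b ys.
set f := fun k => _ in cv; rewrite -/(f n).
have f0 k : 0 <= f k by rewrite /f mulr_ge0 ?sqr_ge0// divr_ge0// exprn_ge0.
apply: le_trans (_ : series f n.+1 <= _).
  by rewrite /series/= big_nat_recr//= lerDr sumr_ge0.
have nd : nondecreasing_seq (series f).
  by apply/nondecreasing_seqP => k; rewrite /series/= big_nat_recr//= lerDl.
rewrite -(cvg_lim _ cv)//; apply: nondecreasing_cvgn_le => //.
by apply/cvg_ex; eexists; exact: cv.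
Qed.

Lemma energy_ge0 lam b ys : 0 <= lam -> 0 <= energy lam b ys.
Proof.
move=> lam0; apply: le_trans (moment_le b ys 0 lam0).
by rewrite mulr_ge0 ?sqr_ge0// divr_ge0.
Qed.

Lemma half_sum_le n : \sum_(0 <= k < n) 2^-1 ^+ k <= 2 :> R.
Proof.
have -> : \sum_(0 <= k < n) 2^-1 ^+ k = 2 - 2 * 2^-1 ^+ n :> R.
  elim: n => [|n IH]; first by rewrite big_geq// expr0; ring.
  by rewrite big_nat_recr//= IH exprS; field.
by rewrite lerBlDr lerDl mulr_ge0// exprn_ge0.
Qed.

(** The derivative is expanded along the moments, each of which is bounded by
    the energy ([moment_le]); the factor 8 in the exponential leaves a geometric
    series of ratio 1/2 to be summed. *)
Lemma expsum_bound lam b ys m x : 0 <= lam -> `|x| <= 1 ->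
  `|expsum lam b ys m x| <= 2 *
    Num.sqrt (energy lam b ys * ((2 * lam) ^+ m * m`!%:R) * expR (8 * lam)).
Proof.
move=> lam0 x1; set B := Num.sqrt _.
have cv := @cvg_expsum lam b ys m x; set f := fun k => _ in cv.
have V0 := @energy_ge0 lam b ys lam0.
have fB k : `|f k| <= B * 2^-1 ^+ k.
  rewrite -(@ler_pXn2r _ 2)// ?nnegrE ?mulr_ge0// ?sqrtr_ge0//.
  rewrite exprMn sqr_sqrtr; last by rewrite !mulr_ge0 ?expR_ge0// exprn_ge0// mulr_ge0.
  rewrite /f real_normK ?num_real//.
  have Hm := @moment_le lam b ys (m + k) lam0.
  have F0 n : 0 < n`!%:R :> R by rewrite ltr0n fact_gt0.
  have F1 n : n`!%:R != 0 :> R by rewrite gt_eqF.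
  set M := moment _ _ _ in Hm *.
  have E1 : ((lam * x) ^+ k / k`!%:R * (lam ^+ m * M)) ^+ 2 =
     (x ^+ k) ^+ 2 * ((lam ^+ (m + k) / (m + k)`!%:R * M ^+ 2) *
      (lam ^+ (m + k) * (m + k)`!%:R / k`!%:R ^+ 2)).
    by rewrite !exprMn !exprD; field; rewrite !F1.
  rewrite E1; apply: le_trans (_ : energy lam b ys *
     (lam ^+ (m + k) * (m + k)`!%:R / k`!%:R ^+ 2) <= _).
    have D0 : 0 <= lam ^+ (m + k) * (m + k)`!%:R / k`!%:R ^+ 2.
      by rewrite divr_ge0 ?mulr_ge0 ?exprn_ge0.
    apply: le_trans (ler_piMl _ _) (ler_wpM2r D0 Hm).
      by apply: mulr_ge0 => //; rewrite mulr_ge0 ?sqr_ge0// divr_ge0// exprn_ge0.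
    rewrite -[_ ^+ 2]ger0_norm ?sqr_ge0// !normrX.
    by rewrite !exprn_ile1// exprn_ge0.
  have F2 : (m + k)`!%:R <= 2 ^+ (m + k) * (m`!%:R * k`!%:R) :> R.
    by rewrite -natrX -!natrM ler_nat factD_le.
  have l8 : 0 <= 8 * lam by rewrite mulr_ge0.
  have Ek := exp_coeff_le k l8.
  have P0 : 2 ^+ k != 0 :> R by rewrite expf_neq0.
  have P1 : 0 <= (2 * lam) ^+ m * m`!%:R by rewrite mulr_ge0// exprn_ge0// mulr_ge0.
  set A := _ * m`!%:R in P1 *; rewrite [leRHS](_ : _ = energy lam b ys *
     (A * (expR (8 * lam) * 2^-1 ^+ k ^+ 2))); last by ring.
  apply: ler_wpM2l => //.
  apply: le_trans (_ : (lam ^+ (m + k) * (2 ^+ (m + k) * (m`!%:R * k`!%:R)) / k`!%:R ^+ 2) <= _).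
    apply: ler_wpM2r; first by rewrite invr_ge0 sqr_ge0.
    by apply: ler_wpM2l; first exact: exprn_ge0.
  rewrite (_ : _ / _ = A * (((8 * lam) ^+ k / k`!%:R) * 2^-1 ^+ k ^+ 2)).
    apply: ler_wpM2l => //; apply: ler_wpM2r => //; exact: sqr_ge0.
  have -> : 8 = 2 * 2 * 2 :> R by ring.
  rewrite /A !exprMn !exprVn !exprD; field.
  by rewrite F1 P0.
have B0 : 0 <= B by exact: sqrtr_ge0.
have pb M : `|series f M| <= 2 * B.
  apply: le_trans (ler_norm_sum _ _ _) _.
  apply: le_trans (_ : \sum_(0 <= k < M) B * 2^-1 ^+ k <= _).
    by apply: ler_sum => k _; exact: fB.
  rewrite -mulr_sumr mulrC ler_wpM2r//.
  exact: half_sum_le.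
exact: norm_lim_le cv pb.
Qed.

End Moments.

(** * Two-sided bounds for exponential sums vanishing at the nodes *)

Section StaticBounds.
Context {R : realType}.
Implicit Types (lam x y z : R) (b : R -> R) (s ys : seq R).

Lemma energy_vanish lam b z s :
  (forall y, y \in s -> expsum lam b (z :: s) 0 y = 0) ->
  energy lam b (z :: s) = b z * expsum lam b (z :: s) 0 z.
Proof.
move=> zs; rewrite {1}/energy big_cons big_seq big1 ?addr0// => y ys.
by rewrite zs// mulr0.
Qed.

Lemma expsum_lower_fact lam b z s x : 0 <= lam -> uniq s -> x \notin s ->
  (forall y, y \in [:: x, z & s] -> `|y| <= 1) ->
  (forall y, y \in s -> expsum lam b (z :: s) 0 y = 0) ->
  `|b z| * expR (- (2 * lam + 1)) * (lam / (2 * expR 1)) ^+ size s *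
    `|nodal s z| * `|nodal s x| <=
  `|expsum lam b (z :: s) 0 x| * (size s)`!%:R.
Proof.
move=> lam0 us xs bs zs; have H := expsum_lower lam0 us xs bs zs.
set K := size s in H *.
have E : (K.+1%:R + lam) ^+ K <= K`!%:R * (expR 1 ^+ K * expR (lam + 1)).
  have := @exp_coeff_le R (K.+1%:R + lam) K (addr_ge0 (ler0n _ _) lam0).
  rewrite ler_pdivrMr ?ltr0n ?fact_gt0// => /le_trans; apply.
  rewrite mulrC ler_wpM2l// -expRM_natl -expRD ler_expR mulr1 -natr1.
  by rewrite addrA addrAC.
have P2 : 0 < 2 ^+ K :> R by rewrite exprn_gt0.
have PE : 0 < expR 1 ^+ K :> R by rewrite exprn_gt0 ?expR_gt0.
have H2 := le_trans H (ler_wpM2l (normr_ge0 _) (ler_wpM2l (ltW P2) E)).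
set C := 2 ^+ K * expR 1 ^+ K * expR (lam + 1).
have C0 : 0 < C by rewrite !mulr_gt0// expR_gt0.
rewrite -(ler_pM2r C0); move: H2; congr (_ <= _); last by rewrite /C; ring.
rewrite /C expr_div_n exprMn.
have -> : expR (- lam) = expR (- (2 * lam + 1)) * expR (lam + 1).
  by rewrite -expRD; congr expR; ring.
field.
by rewrite !gt_eqF.
Qed.

(** The energy is b z u(z), and by [nodal_mvt] u(z) is bounded by a derivative of
    u, hence by the square root of the energy ([expsum_bound]).  Dividing by that
    square root gives a bound of the energy itself. *)
Lemma energy_upper lam b z s : 0 <= lam -> uniq s ->
  (forall y, y \in z :: s -> `|y| <= 1) ->
  (forall y, y \in s -> expsum lam b (z :: s) 0 y = 0) ->
  energy lam b (z :: s) <= b z ^+ 2 * nodal s z ^+ 2 *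
     (4 * expR (8 * lam) * (2 * lam) ^+ size s / (size s)`!%:R).
Proof.
move=> lam0 us bs zs; have E := energy_vanish zs.
have V0 := energy_ge0 b (z :: s) lam0.
have [xi xi1 Exi] := nodal_mvt (jet_expsum lam b (z :: s)) us bs zs.
have UB := @expsum_bound _ lam b (z :: s) (size s) xi lam0 xi1.
set V := energy lam b (z :: s) in E V0 UB *.
set K := size s in Exi UB *; set u := expsum _ _ _ in E Exi UB.
have F0 : 0 < K`!%:R :> R by rewrite ltr0n fact_gt0.
have [-> |Vn] := eqVneq V 0.
  apply: mulr_ge0; first by rewrite mulr_ge0 ?sqr_ge0.
  by rewrite divr_ge0// !mulr_ge0 ?expR_ge0// exprn_ge0// mulr_ge0.
have Vp : 0 < V by rewrite lt_neqAle eq_sym Vn.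
have X0 : 0 <= V * ((2 * lam) ^+ K * K`!%:R) * expR (8 * lam).
  by rewrite !mulr_ge0 ?expR_ge0 ?exprn_ge0// mulr_ge0.
have U2 : u K xi ^+ 2 <= 4 * (V * ((2 * lam) ^+ K * K`!%:R) * expR (8 * lam)).
  rewrite -[u K xi ^+ 2]real_normK ?num_real//.
  apply: le_trans (_ : (2 * Num.sqrt (V * ((2 * lam) ^+ K * K`!%:R) * expR (8 * lam))) ^+ 2 <= _).
    by rewrite ler_pXn2r// nnegrE mulr_ge0 ?sqrtr_ge0.
  by rewrite exprMn sqr_sqrtr// -natrX.
rewrite -(ler_pM2l Vp) -(ler_pM2r (mulr_gt0 F0 F0)).
have -> : V * V * (K`!%:R * K`!%:R) = b z ^+ 2 * nodal s z ^+ 2 * u K xi ^+ 2.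
  rewrite {1 2}E (_ : _ * (K`!%:R * _) = b z ^+ 2 * (u 0%N z * K`!%:R) ^+ 2); last by ring.
  by rewrite Exi; ring.
have BN : 0 <= b z ^+ 2 * nodal s z ^+ 2 by rewrite mulr_ge0 ?sqr_ge0.
apply: le_trans (ler_wpM2l BN U2) _.
rewrite le_eqVlt; apply/orP; left; apply/eqP; field.
by rewrite gt_eqF.
Qed.

(** Bounds the squares of the Taylor coefficients, relative to the energy, with
    radius of convergence 2. *)
Definition taylor_const lam K : R :=
  4 * expR (16 * lam) * (32 * lam) ^+ K / K`!%:R.

(** From the order K on, [expsum_bound] is enough.  Below, the K zeros bring the
    gain of [jet_zeros_bound]. *)
Lemma expsum_taylor lam b z s n x : 0 <= lam -> uniq s ->
  (forall y, y \in x :: s -> `|y| <= 1) ->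
  (forall y, y \in s -> expsum lam b (z :: s) 0 y = 0) ->
  (`|expsum lam b (z :: s) n x| * 2 ^+ n / n`!%:R) ^+ 2 <=
    energy lam b (z :: s) * taylor_const lam (size s).
Proof.
move=> lam0 us bs zs.
have V0 := energy_ge0 b (z :: s) lam0.
have UB m y := @expsum_bound _ lam b (z :: s) m y lam0.
have ju := jet_expsum lam b (z :: s).
set V := energy lam b (z :: s) in V0 UB *; set u := expsum _ _ _ in zs UB ju *.
set K := size s.
have F0 m : 0 < m`!%:R :> R by rewrite ltr0n fact_gt0.
have F1 m : m`!%:R != 0 :> R by rewrite gt_eqF.
have e816 : expR (8 * lam) <= expR (16 * lam) by rewrite ler_expR ler_wpM2r// ler_nat.
have X0 m : 0 <= V * ((2 * lam) ^+ m * m`!%:R) * expR (8 * lam).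
  by rewrite !mulr_ge0 ?expR_ge0 ?exprn_ge0// mulr_ge0.
have U2 m : (2 * Num.sqrt (V * ((2 * lam) ^+ m * m`!%:R) * expR (8 * lam))) ^+ 2 =
    4 * (V * ((2 * lam) ^+ m * m`!%:R) * expR (8 * lam)).
  by rewrite exprMn sqr_sqrtr// -natrX.
have x1 : `|x| <= 1 by apply: bs; rewrite mem_head.
have [Kn|nK] := leqP K n.
  apply: le_trans (_ : (2 * Num.sqrt (V * ((2 * lam) ^+ n * n`!%:R) * expR (8 * lam))
      * (2 ^+ n / n`!%:R)) ^+ 2 <= _).
    rewrite ler_pXn2r ?nnegrE ?mulr_ge0 ?sqrtr_ge0 ?exprn_ge0 ?invr_ge0//.
    rewrite -mulrA ler_wpM2r ?divr_ge0 ?exprn_ge0//.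
    exact: UB.
  rewrite exprMn U2.
  have -> : 4 * (V * ((2 * lam) ^+ n * n`!%:R) * expR (8 * lam)) * (2 ^+ n / n`!%:R) ^+ 2
     = V * (4 * (expR (8 * lam) * ((8 * lam) ^+ n / n`!%:R))).
    have -> : 8 * lam = 2 * 2 * (2 * lam) by ring.
    by rewrite !exprMn; field.
  apply: ler_wpM2l => //; rewrite /taylor_const -!mulrA; apply: ler_wpM2l => //.
  have l8 : 0 <= 8 * lam by rewrite mulr_ge0.
  apply: le_trans (_ : expR (8 * lam) * ((8 * lam) ^+ K / K`!%:R * expR (8 * lam)) <= _).
    apply: ler_wpM2l; first exact: expR_ge0.
    apply: le_trans (_ : (8 * lam) ^+ K / K`!%:R * ((8 * lam) ^+ (n - K) / (n - K)`!%:R) <= _).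
      rewrite mulrACA -exprD subnKC// ler_wpM2l ?exprn_ge0//.
      rewrite -invfM lef_pV2 ?posrE ?mulr_gt0//.
      by rewrite -natrM ler_nat -{2}(subnKC Kn) factD_ge.
    apply: ler_wpM2l; last exact: exp_coeff_le.
    by rewrite divr_ge0// exprn_ge0.
  rewrite mulrCA -expRD -mulrDl -natrD mulrC ler_wpM2l ?expR_ge0//.
  rewrite ler_wpM2r ?invr_ge0//; apply: lerXn2r; rewrite ?nnegrE//.
    by rewrite mulr_ge0.
  by rewrite ler_wpM2r// ler_nat.
have := jet_zeros_bound ju us (ltnW nK) bs zs (fun y => UB K y).
rewrite -/K; set B := 2 * Num.sqrt _ => H.
have B0 : 0 <= B by rewrite mulr_ge0 ?sqrtr_ge0.
have H1 : `|u n x| <= 2 ^+ (K - n) * B / (K - n)`!%:R by rewrite ler_pdivlMr.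
apply: le_trans (_ : (2 ^+ (K - n) * B / (K - n)`!%:R * (2 ^+ n / n`!%:R)) ^+ 2 <= _).
  rewrite ler_pXn2r ?nnegrE ?mulr_ge0 ?exprn_ge0 ?invr_ge0//.
  by rewrite -mulrA ler_wpM2r ?divr_ge0 ?exprn_ge0.
have -> : 2 ^+ (K - n) * B / (K - n)`!%:R * (2 ^+ n / n`!%:R) =
    2 ^+ K * B * 'C(K, n)%:R / K`!%:R.
  have -> : 'C(K, n)%:R = K`!%:R / (n`!%:R * (K - n)`!%:R) :> R.
    by rewrite -natrM -(bin_fact (ltnW nK)) natrM mulfK// natrM mulf_neq0.
  have -> : 2 ^+ K = 2 ^+ (K - n) * 2 ^+ n :> R by rewrite -exprD subnK// ltnW.
  field.
  by rewrite !F1.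
have C2 : 'C(K, n)%:R ^+ 2 <= (2 ^+ K) ^+ 2 :> R.
  by rewrite -!natrX ler_nat leq_exp2r// bin_le_exp2.
apply: le_trans (_ : (2 ^+ K) ^+ 2 * B ^+ 2 * (2 ^+ K) ^+ 2 / K`!%:R ^+ 2 <= _).
  rewrite !exprMn exprVn ler_wpM2r ?invr_ge0 ?sqr_ge0//.
  by rewrite ler_wpM2l// mulr_ge0 ?sqr_ge0.
rewrite U2 /taylor_const.
have -> : (2 ^+ K) ^+ 2 * (4 * (V * ((2 * lam) ^+ K * K`!%:R) * expR (8 * lam))) *
  (2 ^+ K) ^+ 2 / K`!%:R ^+ 2 = V * (4 * expR (8 * lam) * (32 * lam) ^+ K / K`!%:R).
  have -> : 32 * lam = 2 * 2 * 2 * 2 * (2 * lam) by ring.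
  by rewrite !exprMn; field.
apply: ler_wpM2l => //; rewrite -!mulrA; apply: ler_wpM2l => //.
by apply: ler_wpM2r => //; rewrite divr_ge0// exprn_ge0// mulr_ge0.
Qed.

End StaticBounds.

(** * Gaussian kernel interpolation *)

Section Kriging.
Context {R : realType}.
Variable a : R.
Hypothesis a_gt0 : 0 < a.
Implicit Types (x y z t : R) (b : R -> R) (s ys : seq R).

(** With lam = 1 / (2 a) the kernel factors as
    kernel0 * wt x * wt y * exp (lam x y), see [kernelE]. *)
Definition rate : R := (2 * a)^-1.
Definition kernel0 : R := (2 * Num.sqrt (pi * a))^-1.
Definition wt x : R := expR (- (rate * x ^+ 2 / 2)).
Local Notation G := (gaussian_kernel a).

Lemma rate_gt0 : 0 < rate.
Proof. by rewrite invr_gt0 mulr_gt0. Qed.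

Lemma kernel0_gt0 : 0 < kernel0.
Proof. by rewrite invr_gt0 mulr_gt0// sqrtr_gt0 mulr_gt0// pi_gt0. Qed.

Lemma wt_gt0 x : 0 < wt x. Proof. exact: expR_gt0. Qed.

Lemma wt_le1 x : wt x <= 1.
Proof.
rewrite -expR0 ler_expR oppr_le0 divr_ge0// mulr_ge0 ?sqr_ge0//.
exact: ltW rate_gt0.
Qed.

Lemma wt_ge x : `|x| <= 1 -> expR (- (rate / 2)) <= wt x.
Proof.
move=> x1; rewrite ler_expR lerN2 ler_pM2r ?invr_gt0// ler_piMr ?(ltW rate_gt0)//.
by rewrite -real_normK ?num_real// exprn_ile1.
Qed.

Lemma kernelE x y : G (x - y) = kernel0 * wt x * (wt y * expR (rate * y * x)).
Proof.
rewrite /gaussian_kernel -/kernel0 -mulrA /wt; congr (_ * _).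
rewrite -!expRD; congr expR; rewrite /rate; field.
by rewrite gt_eqF.
Qed.

Lemma kernelC x y : G (x - y) = G (y - x).
Proof. by rewrite /gaussian_kernel -opprB sqrrN. Qed.

Definition ksum b ys x : R := \sum_(y <- ys) b y * G (x - y).

Lemma ksumE b ys x :
  ksum b ys x = kernel0 * wt x * expsum rate (fun y => b y * wt y) ys 0 x.
Proof.
rewrite /ksum /expsum mulr_sumr; apply: eq_bigr => y _.
by rewrite kernelE expr0; ring.
Qed.

Lemma ksum_eq0 b ys x : (ksum b ys x == 0) =
  (expsum rate (fun y => b y * wt y) ys 0 x == 0).
Proof.
by rewrite ksumE mulf_eq0 (gt_eqF (mulr_gt0 kernel0_gt0 (wt_gt0 x))).
Qed.

(** The lower bound for exponential sums, applied with one node as z and as x and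
    the others as zeros. *)
Lemma ksum_indep b s : uniq s -> (forall y, y \in s -> `|y| <= 1) ->
  (forall x, x \in s -> ksum b s x = 0) -> forall y, y \in s -> b y = 0.
Proof.
move=> us bs zs y ys.
have ps := perm_to_rem ys; set s' := rem y s in ps.
have us' : uniq (y :: s') by rewrite -(perm_uniq ps).
have mem x : (x \in s) = (x \in y :: s') by rewrite (perm_mem ps).
have /andP[ys' us1] := us'.
have z' x : x \in y :: s' ->
    expsum rate (fun y => b y * wt y) (y :: s') 0 x = 0.
  rewrite -mem => xs; have /eqP := zs x xs; rewrite ksum_eq0 => /eqP <-.
  by rewrite /expsum (perm_big _ ps).
have := @expsum_lower_fact _ rate (fun y => b y * wt y) y s' y (ltW rate_gt0) us1 ys'.
rewrite z' ?mem_head// normr0 mul0r => H.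
have {}H : `|b y| * wt y * expR (- (2 * rate + 1)) * (rate / (2 * expR 1)) ^+ size s'
    * `|nodal s' y| * `|nodal s' y| <= 0.
  rewrite -[wt y]gtr0_norm ?wt_gt0// -normrM; apply: H => x.
    by rewrite !inE orbA orbb -in_cons -mem => /bs.
  by move=> xs; apply: z'; rewrite inE xs orbT.
apply/eqP/negPn/negP => by0.
have : 0 < `|b y| * wt y * expR (- (2 * rate + 1)) * (rate / (2 * expR 1)) ^+ size s'
    * `|nodal s' y| * `|nodal s' y|.
  have n0 : nodal s' y != 0 by rewrite nodal_eq0.
  rewrite !mulr_gt0 ?normr_gt0 ?expR_gt0 ?wt_gt0 ?exprn_gt0//.
  by rewrite divr_gt0 ?rate_gt0// mulr_gt0 ?expR_gt0.
by rewrite ltNge H.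
Qed.

Section Matrix.
Variables (K : nat) (h : K.-tuple (R * R)).

Definition pts : seq R := [seq p.1 | p <- h].

Lemma size_pts : size pts = K.
Proof. by rewrite size_map size_tuple. Qed.

Lemma pt_in k : pt h k \in pts.
Proof. by apply: map_f; exact: mem_tnth. Qed.

Lemma ptsP y : y \in pts -> exists k, y = pt h k.
Proof. by move=> /mapP[p /tnthP[k ->] ->]; exists k. Qed.

Lemma big_pts (F : R -> R) : \sum_(y <- pts) F y = \sum_(k < K) F (pt h k).
Proof. by rewrite /pts big_map big_tuple. Qed.

Lemma pt_inj : uniq pts -> injective (pt h).
Proof.
move=> us i j; rewrite /pt => E; apply/val_inj/eqP => /=.
have H k : (tnth h k).1 = nth 0 pts k.
  by rewrite (tnth_nth (0, 0)) (nth_map (0, 0)) ?size_tuple.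
move: E; rewrite !H => /eqP; rewrite nth_uniq// size_pts//.
Qed.

(** Coefficients indexed by positions become coefficients indexed by the points
    themselves, so that sums over the nodes do not depend on their order. *)
Definition lift_coef (c : 'I_K -> R) y : R := \sum_(k < K) c k * (pt h k == y)%:R.

Lemma lift_coefE c k : uniq pts -> lift_coef c (pt h k) = c k.
Proof.
move=> us; rewrite /lift_coef (bigD1 k)//= eqxx mulr1 big1 ?addr0// => i ik.
by rewrite (inj_eq (pt_inj us)) (negbTE ik) mulr0.
Qed.

Lemma ksum_lift c x : uniq pts ->
  ksum (lift_coef c) pts x = \sum_(k < K) c k * G (x - pt h k).
Proof.
by move=> us; rewrite /ksum big_pts; apply: eq_bigr => k _; rewrite lift_coefE.
Qed.

Hypothesis uh : uniq pts.
Hypothesis bh : forall y, y \in pts -> `|y| <= 1.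

Lemma cov_unit : cov_mx G h \in unitmx.
Proof.
rewrite unitmxE unitfE; apply/negP => /det0P[v v0 vM].
move/negP: v0; apply; apply/eqP/rowP => k; rewrite mxE.
rewrite -(lift_coefE (fun k => v 0 k) k uh).
apply: (ksum_indep uh bh) => [x /ptsP[l ->]|]; last exact: pt_in.
rewrite ksum_lift//; have /rowP/(_ l) := vM; rewrite !mxE => vM0.
rewrite -[RHS]vM0; apply: eq_bigr => i _; rewrite !mxE; congr (_ * _).
exact: kernelC.
Qed.

Definition krig (v : 'cV[R]_K) x : R :=
  ((cov_col G h x)^T *m invmx (cov_mx G h) *m v) 0 0.

Lemma krig_ksum v x :
  krig v x = ksum (lift_coef (fun k => (invmx (cov_mx G h) *m v) k 0)) pts x.
Proof.
rewrite ksum_lift// /krig -mulmxA mxE; apply: eq_bigr => k _.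
by rewrite !mxE mulrC.
Qed.

Lemma krig_node v l : krig v (pt h l) = v l 0.
Proof.
have -> : v l 0 = (cov_mx G h *m (invmx (cov_mx G h) *m v)) l 0.
  by rewrite mulmxA mulmxV ?cov_unit// mul1mx.
rewrite /krig -mulmxA mxE [RHS]mxE; apply: eq_bigr => k _.
by rewrite !mxE.
Qed.

Definition post_cov z x : R := G (x - z) - krig (cov_col G h z) x.

Lemma post_varE x : post_var G h x = post_cov x x.
Proof. by rewrite /post_cov subrr. Qed.

Lemma post_mean_ksum : exists b, forall x, post_mean G h x = ksum b pts x.
Proof. by eexists => x; exact: krig_ksum. Qed.

Lemma post_mean_node k : post_mean G h (pt h k) = obs h k.
Proof. by rewrite /post_mean -/(krig _ _) krig_node mxE. Qed.

Lemma post_cov_node z x : x \in pts -> post_cov z x = 0.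
Proof.
by move=> /ptsP[l ->]; rewrite /post_cov krig_node mxE kernelC subrr.
Qed.

Lemma post_cov_ksum z : z \notin pts ->
  exists2 b, b z = 1 & forall x, post_cov z x = ksum b (z :: pts) x.
Proof.
move=> zs; set c := lift_coef (fun k => (invmx (cov_mx G h) *m cov_col G h z) k 0).
exists (fun y => if y == z then 1 else - c y); first by rewrite eqxx.
move=> x; rewrite /ksum big_cons eqxx mul1r /post_cov krig_ksum -/c; congr (_ + _).
rewrite /ksum -sumrN big_seq [RHS]big_seq; apply: eq_bigr => y ys.
by rewrite ifN ?mulNr//; apply: contra zs => /eqP <-.
Qed.

End Matrix.

Lemma pts_rcons K (h : K.-tuple (R * R)) p :
  pts (rcons_tuple h p) = rcons (pts h) p.1.
Proof. by rewrite /pts map_rcons. Qed.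

Lemma ksumD b1 b2 ys x : ksum b1 ys x + ksum b2 ys x = ksum (fun y => b1 y + b2 y) ys x.
Proof. by rewrite /ksum -big_split/=; apply: eq_bigr => y _; rewrite mulrDl. Qed.

Lemma ksumZ c b ys x : c * ksum b ys x = ksum (fun y => c * b y) ys x.
Proof. by rewrite /ksum mulr_sumr; apply: eq_bigr => y _; rewrite mulrA. Qed.

Lemma ksum_ext z b ys : z \notin ys ->
  exists b', forall x, ksum b ys x = ksum b' (z :: ys) x.
Proof.
move=> zs; exists (fun y => if y == z then 0 else b y) => x.
rewrite /ksum big_cons eqxx mul0r add0r big_seq [RHS]big_seq.
by apply: eq_bigr => y ys'; rewrite ifN//; apply: contra zs => /eqP <-.
Qed.

Lemma ksum_unique b ys : uniq ys -> (forall y, y \in ys -> `|y| <= 1) ->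
  (forall x, x \in ys -> ksum b ys x = 0) -> forall x, ksum b ys x = 0.
Proof.
move=> us bs zs x; rewrite /ksum big_seq big1// => y yy.
by rewrite (ksum_indep us bs zs yy) mul0r.
Qed.

(** Both sides are combinations of the kernels centred at the old nodes and z,
    and they agree at these points; such a combination is determined by these
    values. *)
Lemma post_mean_update K (h : K.-tuple (R * R)) z t :
  uniq (z :: pts h) -> (forall y, y \in z :: pts h -> `|y| <= 1) ->
  forall x, post_mean G (rcons_tuple h (z, post_mean G h z + t * post_var G h z)) x =
    post_mean G h x + t * post_cov h z x.
Proof.
move=> uz bz; have /andP[zs us] := uz.
have bs y : y \in pts h -> `|y| <= 1 by move=> ys; apply: bz; rewrite inE ys orbT.
set h' := rcons_tuple h _.
have ptsE : pts h' = rcons (pts h) z by rewrite pts_rcons.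
have perm : perm_eq (pts h') (z :: pts h) by rewrite ptsE perm_rcons.
have us' : uniq (pts h') by rewrite (perm_uniq perm).
have bs' y : y \in pts h' -> `|y| <= 1 by rewrite (perm_mem perm) => /bz.
have [b1 E1] := post_mean_ksum us.
have [b1' E1'] := ksum_ext b1 zs.
have [b2 _ E2] := post_cov_ksum us zs.
have [b3 E3] := post_mean_ksum us'.
have E3' x : post_mean G h' x = ksum b3 (z :: pts h) x.
  by rewrite E3 /ksum (perm_big _ perm).
have key x : post_mean G h' x + -1 * (post_mean G h x + t * post_cov h z x) =
    ksum (fun y => b3 y + -1 * (b1' y + t * b2 y)) (z :: pts h) x.
  by rewrite E3' E1 E1' E2 ksumZ ksumD ksumZ ksumD.
move=> x; apply/eqP; rewrite -subr_eq0 -mulN1r key; apply/eqP.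
apply: ksum_unique => // {}x xz; rewrite -key.
have node k : post_mean G h' (pt h' k) = obs h' k by exact: post_mean_node.
move: xz; rewrite inE => /orP[/eqP ->|xs].
- have H := node ord_max.
  have Ept : tnth h' ord_max = (z, post_mean G h z + t * post_var G h z).
    by rewrite (tnth_nth (0, 0))/= nth_rcons size_tuple ltnn eqxx.
  move: H; rewrite /pt /obs Ept/= => ->; rewrite post_varE; ring.
- have [k kE] := ptsP xs; subst x.
  have Ept : tnth h' (widen_ord (leqnSn K) k) = tnth h k.
    by rewrite !(tnth_nth (0, 0))/= nth_rcons size_tuple ltn_ord.
  have := node (widen_ord (leqnSn K) k); rewrite /pt /obs Ept -/(pt h k) -/(obs h k) => ->.
  by rewrite post_mean_node// post_cov_node// mulr0 addr0 mulN1r subrr.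
Qed.

End Kriging.

(** * Bounds for the posterior covariance *)

Section Analytic.
Context {R : realType}.
Implicit Types (u v : nat -> R -> R).

Definition entire u := jet u /\
  forall x, series (fun k => u k 0 / k`!%:R * x ^+ k) @ \oo --> u 0%N x.

Lemma entire_expsum lam (b : R -> R) ys : entire (expsum lam b ys).
Proof.
split; first exact: jet_expsum.
move=> x; have := @cvg_expsum _ lam b ys 0 x.
rewrite (_ : (fun k => _) = (fun k => expsum lam b ys k 0 / k`!%:R * x ^+ k))//.
apply/funext => k.
rewrite /expsum /moment expr0 mul1r add0n.
rewrite [in RHS](eq_bigr (fun y => lam ^+ k * (b y * y ^+ k))); last first.
  by move=> y _; rewrite mulr0 expR0 mulr1 exprMn mulrCA.
by rewrite -mulr_sumr exprMn; ring.
Qed.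

Lemma entire_lin c d u v : entire u -> entire v ->
  entire (fun n x => c * u n x + d * v n x).
Proof.
move=> [ju cu] [jv cv]; split; first exact: jet_lin.
move=> x; rewrite (_ : series _ =
   (fun n => c * series (fun k => u k 0 / k`!%:R * x ^+ k) n) \+
   (fun n => d * series (fun k => v k 0 / k`!%:R * x ^+ k) n)); last first.
  apply/funext => n; rewrite /series/= !mulr_sumr -big_split/=.
  by apply: eq_bigr => k _; ring.
by apply: cvgD; apply: cvgMr.
Qed.

Lemma entire0 : entire (fun _ _ => 0 : R).
Proof.
have := entire_lin 0 0 (entire_expsum 0 (fun=> 0) [::]) (entire_expsum 0 (fun=> 0) [::]).
by congr entire; apply/funext => n; apply/funext => x; rewrite !mul0r addr0.
Qed.

End Analytic.

Section PosteriorBounds.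
Context {R : realType}.
Variable a : R.
Hypothesis a_gt0 : 0 < a.
Local Notation G := (gaussian_kernel a).
Local Notation rate := (rate a).
Local Notation kernel0 := (kernel0 a).
Local Notation wt := (wt a).

(** Together with [var_upper], this has the exact order of magnitude 1 / K! up to
    geometric factors; the whole argument depends on this match. *)
Definition cov_lower K : R :=
  kernel0 * expR (- (3 * rate + 1)) * (rate / (2 * expR 1)) ^+ K / K`!%:R.

Definition var_upper K : R :=
  kernel0 * (4 * expR (8 * rate) * (2 * rate) ^+ K / K`!%:R).

Lemma cov_lower_gt0 K : 0 < cov_lower K.
Proof.
rewrite /cov_lower divr_gt0 ?ltr0n ?fact_gt0// mulr_gt0//.
  by rewrite mulr_gt0 ?expR_gt0// kernel0_gt0.
by rewrite exprn_gt0// divr_gt0 ?rate_gt0// mulr_gt0 ?expR_gt0.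
Qed.

Section OneHistory.
Variables (K : nat) (h : K.-tuple (R * R)).
Hypothesis us : uniq (pts h).
Hypothesis bs : forall y, y \in pts h -> `|y| <= 1.

Lemma post_cov_expsum z : z \notin pts h -> `|z| <= 1 ->
  exists b : R -> R, let u := expsum rate b (z :: pts h) in
  [/\ b z = wt z,
   (forall x, post_cov a h z x = kernel0 * wt x * u 0%N x) &
   (forall y, y \in pts h -> u 0%N y = 0)].
Proof.
move=> zs z1; have [b bz E] := post_cov_ksum a us zs.
exists (fun y => b y * wt y) => u; have Ex x : post_cov a h z x = kernel0 * wt x * u 0%N x.
  by rewrite E ksumE.
split => //; first by rewrite bz mul1r.
move=> y ys; apply/eqP; rewrite -ksum_eq0//= -/(ksum _ _ _ _) -E.
by apply/eqP; exact: post_cov_node.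
Qed.

(** In particular the posterior covariance with z vanishes at the nodes only. *)
Lemma post_cov_ge z x : z \notin pts h -> x \notin pts h -> `|z| <= 1 -> `|x| <= 1 ->
  cov_lower K * `|nodal (pts h) z| * `|nodal (pts h) x| <= `|post_cov a h z x|.
Proof.
move=> zs xs z1 x1; have [b [bz E u0]] := post_cov_expsum zs z1.
have bxz y : y \in [:: x, z & pts h] -> `|y| <= 1.
  by rewrite !inE => /or3P[/eqP ->|/eqP ->|/bs].
have := expsum_lower_fact (ltW (rate_gt0 a_gt0)) us xs bxz u0.
rewrite size_pts E bz [`|wt z|]gtr0_norm ?wt_gt0// => H.
have s0 := kernel0_gt0 a_gt0.
have F0 : 0 < K`!%:R :> R by rewrite ltr0n fact_gt0.
rewrite !normrM [`|wt x|]gtr0_norm ?wt_gt0// (gtr0_norm s0).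
rewrite -(ler_pM2r F0); set U := expsum _ _ _ _ _ in H *.
set q := (_ / _) ^+ K in H *.
have q0 : 0 <= q by rewrite exprn_ge0// divr_ge0 ?(ltW (rate_gt0 a_gt0))// mulr_ge0 ?expR_ge0.
have := normr_ge0 (nodal (pts h) x); have := normr_ge0 (nodal (pts h) z).
move: H; move: `|nodal _ z| `|nodal _ x| => nz nx H nz0 nx0.
rewrite (_ : cov_lower K * nz * nx * K`!%:R = kernel0 * (expR (- (rate / 2)) *
   (expR (- (rate / 2)) * expR (- (2 * rate + 1)) * q * nz * nx))); last first.
  rewrite /cov_lower -/q (_ : - (3 * rate + 1) = - (rate / 2) + (- (rate / 2) + - (2 * rate + 1))); last by field.
  rewrite !expRD; field.
  by rewrite gt_eqF.
rewrite [leRHS](_ : _ = kernel0 * (wt x * (`|U| * K`!%:R))); last by ring.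
apply: ler_wpM2l; first exact: ltW.
apply: ler_pM; rewrite ?expR_ge0 ?wt_ge//.
  by rewrite !mulr_ge0 ?expR_ge0.
apply: le_trans H; do 4 apply: ler_wpM2r => //; rewrite ?expR_ge0//.
exact: wt_ge.
Qed.

Lemma post_var_ge0 z : `|z| <= 1 -> 0 <= post_var G h z.
Proof.
move=> z1; rewrite post_varE; have [zs|zs] := boolP (z \in pts h).
  by rewrite post_cov_node.
have [b [bz E u0]] := post_cov_expsum zs z1; rewrite E.
rewrite -mulrA mulr_ge0 ?(ltW (kernel0_gt0 a_gt0))// -bz -energy_vanish//.
exact/energy_ge0/ltW/rate_gt0.
Qed.

Lemma post_var_gt0 z : z \notin pts h -> `|z| <= 1 -> 0 < post_var G h z.
Proof.
move=> zs z1; rewrite lt_neqAle post_var_ge0// andbT eq_sym -normr_gt0 post_varE.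
apply: lt_le_trans (post_cov_ge zs zs z1 z1).
exact: (mulr_gt0 (mulr_gt0 (cov_lower_gt0 _) (nodal_gt0 zs)) (nodal_gt0 zs)).
Qed.

Lemma post_var_ge z : z \notin pts h -> `|z| <= 1 ->
  cov_lower K * nodal (pts h) z ^+ 2 <= post_var G h z.
Proof.
move=> zs z1; have := post_cov_ge zs zs z1 z1.
rewrite -post_varE (ger0_norm (post_var_ge0 z1)) -mulrA -expr2.
by rewrite real_normK ?num_real.
Qed.

Lemma post_var_node z : z \in pts h -> post_var G h z = 0.
Proof. by move=> zs; rewrite post_varE post_cov_node. Qed.

Lemma post_var_le z : `|z| <= 1 ->
  post_var G h z <= var_upper K * nodal (pts h) z ^+ 2.
Proof.
move=> z1; have [zs|zs] := boolP (z \in pts h).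
  rewrite post_var_node// mulr_ge0 ?sqr_ge0// mulr_ge0 ?(ltW (kernel0_gt0 a_gt0))//.
  have r0 := ltW (rate_gt0 a_gt0).
  by rewrite divr_ge0// !mulr_ge0 ?expR_ge0// exprn_ge0// mulr_ge0.
have [b [bz E u0]] := post_cov_expsum zs z1.
have bz' y : y \in z :: pts h -> `|y| <= 1.
  by rewrite !inE => /orP[/eqP ->|/bs].
have := energy_upper (ltW (rate_gt0 a_gt0)) us bz' u0.
rewrite post_varE E energy_vanish// bz size_pts => H.
rewrite /var_upper -!(mulrA kernel0); apply: ler_wpM2l; first exact/ltW/kernel0_gt0.
apply: le_trans H _; set C := _ / _.
have C0 : 0 <= C.
  have r0 := ltW (rate_gt0 a_gt0).
  by rewrite divr_ge0// !mulr_ge0 ?expR_ge0// exprn_ge0// mulr_ge0.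
rewrite -mulrA (mulrC C); apply: ler_piMl; first by rewrite mulr_ge0 ?sqr_ge0.
by rewrite exprn_ile1 ?(ltW (wt_gt0 _ _)) ?wt_le1.
Qed.

Lemma post_cov_jet z : z \notin pts h -> `|z| <= 1 ->
  exists2 u : nat -> R -> R, entire u &
  (forall x, post_cov a h z x = kernel0 * wt x * u 0%N x) /\
  (forall n x, `|x| <= 1 -> (`|u n x| * 2 ^+ n / n`!%:R) ^+ 2 <=
    post_var G h z / kernel0 * taylor_const rate K).
Proof.
move=> zs z1; have [b [bz E u0]] := post_cov_expsum zs z1.
exists (expsum rate b (z :: pts h)); first exact: entire_expsum.
split => // n x x1.
have bx y : y \in x :: pts h -> `|y| <= 1 by rewrite inE => /orP[/eqP ->|/bs].
have := expsum_taylor n (ltW (rate_gt0 a_gt0)) us bx u0.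
rewrite size_pts energy_vanish// bz post_varE E => /le_trans; apply.
rewrite le_eqVlt; apply/orP; left; apply/eqP; field.
by rewrite gt_eqF// kernel0_gt0.
Qed.

(** Otherwise the intermediate value theorem would give a zero of the covariance
    on the side that contains no node. *)
Lemma post_cov_sign z sg x x' : z \notin pts h -> `|z| <= 1 ->
  (forall y, y \in pts h -> 0 <= sg * y) ->
  `|x| <= 1 -> `|x'| <= 1 -> sg * x < 0 -> sg * x' < 0 ->
  0 <= post_cov a h z x * post_cov a h z x'.
Proof.
move=> zs z1 sds; wlog xx' : x x' / x <= x'.
  move=> W x1 x1' sx sx'; have [xx'|/ltW xx'] := leP x x'; first exact: W.
  by rewrite mulrC; exact: W.
move=> x1 x1' sx sx'; rewrite leNgt; apply/negP => neg.
have [u [ju _] [E _]] := post_cov_jet zs z1.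
have cc : {within `[x, x'], continuous (post_cov a h z)}.
  apply: continuous_subspaceT => t.
  rewrite (_ : post_cov a h z = fun t => kernel0 * wt t * u 0%N t); last exact/funext.
  apply: cvgM; last exact: jet_continuous.
  apply: cvgMr; apply: continuous_comp; last exact: continuous_expR.
  apply: cvgN; apply: cvgMl; apply: cvgMr; exact: exprn_continuous.
have [|c] := @IVT R (post_cov a h z) x x' 0 xx' cc.
  move: neg; set p := post_cov _ _ _ _; set q := post_cov _ _ _ _ => neg.
  by rewrite ge_min le_max; case: (leP p 0); case: (leP q 0) => //=; nra.
rewrite in_itv/= => /andP[xc cx'] c0.
have c1 : `|c| <= 1.
  move: x1 x1'; rewrite !ler_norml => /andP[l1 _] /andP[_ l2].
  by rewrite (le_trans l1 xc) (le_trans cx' l2).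
have sc : sg * c < 0.
  by have [s0|s0|s0] := ltgtP sg 0; move: sx sx'; rewrite ?s0 ?mul0r ?ltxx//; nra.
have cs : c \notin pts h by apply/negP => /sds; rewrite leNgt sc.
have := post_cov_ge zs cs z1 c1; rewrite c0 normr0.
by rewrite lt_geF//; exact: (mulr_gt0 (mulr_gt0 (cov_lower_gt0 _) (nodal_gt0 zs)) (nodal_gt0 cs)).
Qed.

End OneHistory.
End PosteriorBounds.

(** * Separation of the nodes and size of the expected improvement *)

Section Separation.
Context {R : realType}.
Implicit Types (x y z t : R) (s : seq R).

(** The nodal product without the factor of the node y. *)
Definition punctured s y x : R := \prod_(t <- s | t != y) `|x - t|.

Lemma nodal_punctured s y x : uniq s -> y \in s ->
  `|nodal s x| = `|x - y| * punctured s y x.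
Proof. by move=> us ys; rewrite normr_nodal (bigD1_seq y). Qed.

Lemma punctured_le s y x : (forall t, t \in x :: s -> `|t| <= 1) ->
  punctured s y x <= 2 ^+ size s.
Proof.
rewrite /punctured; elim: s => [|t s IH] bs; first by rewrite big_nil.
have {}IH : \prod_(t <- s | t != y) `|x - t| <= 2 ^+ size s.
  by apply: IH => r; rewrite inE => /orP[/eqP ->|rs]; apply: bs; rewrite !inE ?eqxx ?rs ?orbT.
have xt : `|x - t| <= 2.
  apply: le_trans (ler_normB _ _) _; rewrite (_ : 2 = 1 + 1) ?lerD//; apply: bs.
    by rewrite mem_head.
  by rewrite !inE eqxx orbT.
rewrite big_cons exprS; case: ifP => _.
  by rewrite ler_pM// prodr_ge0.
by apply: le_trans IH _; rewrite ler_peMl ?exprn_ge0// ler1n.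
Qed.

(** If each distance decreases by at most one half, the product decreases by at
    most 2 to the number of factors. *)
Lemma punctured_ge_half s y x : (forall t, t \in s -> t != y -> `|y - t| / 2 <= `|x - t|) ->
  punctured s y y / 2 ^+ size s <= punctured s y x.
Proof.
rewrite /punctured; elim: s => [|t s IH] H; first by rewrite !big_nil divr1.
have {}IH : \prod_(t <- s | t != y) `|y - t| / 2 ^+ size s <= \prod_(t <- s | t != y) `|x - t|.
  by apply: IH => r rs; apply: H; rewrite inE rs orbT.
have P0 : 0 < 2 ^+ size s :> R by rewrite exprn_gt0.
rewrite !big_cons /= exprS invfM; case: ifP => ty.
  by rewrite mulrACA ler_pM// ?divr_ge0 ?prodr_ge0 ?exprn_ge0// H ?mem_head.
apply: le_trans IH; rewrite mulrA (mulrC _ 2^-1) -mulrA ler_piMl//.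
  by rewrite divr_ge0 ?prodr_ge0// ltW.
by rewrite invf_le1// ler1n.
Qed.

Lemma punctured_dist s y t : uniq s -> t \in s -> t != y ->
  (forall r, r \in y :: s -> `|r| <= 1) ->
  punctured s y y <= `|y - t| * 2 ^+ size s.
Proof.
move=> us ts ty bs; set s' := [seq r <- s | r != y].
have sub r : r \in y :: s' -> r \in y :: s.
  by rewrite !inE mem_filter => /orP[->//|/andP[_ ->]]; rewrite orbT.
have -> : punctured s y y = `|nodal s' y| by rewrite normr_nodal big_filter.
have ts' : t \in s' by rewrite mem_filter ty.
rewrite (nodal_punctured _ (filter_uniq _ us) ts') ler_wpM2l//.
apply: le_trans (punctured_le _ _) _ => [r /sub/bs//|].
by rewrite ler_weXn2l ?ler1n// size_filter count_size.
Qed.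

Definition separated s (D : R) := forall y, y \in s -> D <= punctured s y y.

Lemma exists_nearest s z : s != [::] -> exists2 y, y \in s &
  forall t, t \in s -> `|z - y| <= `|z - t|.
Proof.
elim: s => // y [|y' s] IH _.
  by exists y; rewrite ?mem_head// => t; rewrite inE => /eqP ->.
have [|w ws wmin] := IH; first by [].
have [yw|wy] := leP `|z - y| `|z - w|.
  exists y; first exact: mem_head.
  move=> t; rewrite inE => /orP[/eqP ->//|/wmin]; exact: le_trans.
exists w; first by rewrite inE ws orbT.
by move=> t; rewrite inE => /orP[/eqP ->|/wmin//]; exact: ltW.
Qed.

(** For the new point, the distances are compared with those of its nearest node
    w: by the triangle inequality they are at least half as large.  Only the
    distance to w itself is not controlled by D, and it is at least g. *)
Lemma separated_cons s z D g : uniq (z :: s) -> s != [::] -> 0 <= g -> 0 <= D ->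
  separated s D -> (forall y, y \in s -> g <= `|z - y|) ->
  separated (z :: s) (g * D / 2 ^+ size s).
Proof.
move=> /andP[zs us] s0 g0 D0 sD sg y.
have P0 : 0 < 2 ^+ size s :> R by rewrite exprn_gt0.
have P1 : g * D / 2 ^+ size s <= g * D.
  rewrite ler_piMr ?mulr_ge0// invf_le1//.
  by rewrite exprn_ege1// ler1n.
rewrite inE => /orP[/eqP ->{y}|ys].
  have [w ws wmin] := exists_nearest z s0.
  rewrite /punctured big_cons eqxx /=.
  rewrite (_ : \prod_(t <- s | _) _ = `|nodal s z|); last first.
    rewrite normr_nodal big_seq_cond [RHS]big_seq; apply: eq_bigl => t.
    by case ts : (t \in s) => //=; apply: contraNneq zs => <-.
  rewrite (nodal_punctured _ us ws) -mulrA; apply: ler_pM => //.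
  - by rewrite divr_ge0// ltW.
  - exact: sg.
  - apply: le_trans (_ : punctured s w w / 2 ^+ size s <= _).
      by rewrite ler_pM2r ?invr_gt0// sD.
    apply: punctured_ge_half => t ts _.
    have tri : `|w - t| <= `|z - w| + `|z - t|.
      rewrite (_ : w - t = (z - t) - (z - w)); last by ring.
      by rewrite [leRHS]addrC; exact: ler_normB.
    have := wmin _ ts; lra.
apply: le_trans P1 _; rewrite /punctured big_cons.
have zy : z != y by apply: contraNneq zs => ->.
by rewrite zy distrC ler_pM ?sg// -/(punctured s y y) sD.
Qed.

End Separation.

Section Stage.
Context {R : realType}.
Variable a : R.
Hypothesis a_gt0 : 0 < a.
Local Notation G := (gaussian_kernel a).

Definition sd_max : R := Num.sqrt (kernel0 a * (4 * expR (16 * rate a))).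

Lemma sd_max_ge0 : 0 <= sd_max. Proof. exact: sqrtr_ge0. Qed.

Lemma var_upper_le K : var_upper a K * (2 ^+ K) ^+ 2 <= sd_max ^+ 2.
Proof.
have r0 := ltW (rate_gt0 a_gt0); have s0 := ltW (kernel0_gt0 a_gt0).
rewrite sqr_sqrtr; last by rewrite !mulr_ge0 ?expR_ge0.
rewrite /var_upper.
rewrite [leLHS](_ : _ = kernel0 a * (4 * (expR (8 * rate a) * ((8 * rate a) ^+ K / K`!%:R)))).
  apply: ler_wpM2l => //; apply: ler_wpM2l => //.
  rewrite (_ : 16 * rate a = 8 * rate a + 8 * rate a); last by ring.
  rewrite expRD ler_wpM2l ?expR_ge0// exp_coeff_le// mulr_ge0//.
rewrite (_ : 8 * rate a = 2 * 2 * (2 * rate a)); last by ring.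
rewrite !exprMn; field.
by rewrite gt_eqF// ltr0n fact_gt0.
Qed.

Variables (K : nat) (h : K.+1.-tuple (R * R)).
Local Notation s := (pts h).
Local Notation m := (post_mean G h).
Hypothesis us : uniq s.
Hypothesis bs : forall y, y \in s -> `|y| <= 1.

Lemma expected_improvementE x :
  expected_improvement G h x = EI (best h) (m x) (post_var G h x).
Proof. by []. Qed.

Lemma best_le y : y \in s -> best h <= m y.
Proof.
move=> /ptsP[k ->]; rewrite post_mean_node//.
by rewrite /best (bigD1 k)//= ge_min lexx.
Qed.

Lemma best_attained : exists2 y, y \in s & m y = best h.
Proof.
suff [k kE] : exists k, best h = obs h k.
  by exists (pt h k); rewrite ?pt_in// post_mean_node.
rewrite /best; elim/big_ind: _ => [|x y [i ->] [j ->]|k _].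
- by exists ord0.
- by case: (leP (obs h i) (obs h j)) => _; [exists i|exists j].
- by exists k.
Qed.

Lemma EI_node y : y \in s -> expected_improvement G h y = 0%E.
Proof.
move=> ys; rewrite expected_improvementE post_var_node// EI_var0.
by rewrite (min_idPl (best_le ys)) subrr.
Qed.

Lemma post_sd_le x : `|x| <= 1 -> Num.sqrt (post_var G h x) <= sd_max.
Proof.
move=> x1; rewrite -[leRHS]ger0_norm ?sd_max_ge0// -sqrtr_sqr ler_sqrt ?sqr_ge0//.
apply: le_trans (post_var_le a_gt0 us bs x1) (le_trans _ (var_upper_le K.+1)).
rewrite ler_wpM2l//.
  have r0 := ltW (rate_gt0 a_gt0); have s0 := ltW (kernel0_gt0 a_gt0).
  by rewrite mulr_ge0// divr_ge0// !mulr_ge0 ?expR_ge0// exprn_ge0// mulr_ge0.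
rewrite -[nodal _ _ ^+ 2]real_normK ?num_real// ler_pXn2r ?nnegrE ?exprn_ge0//.
have := @nodal_le2 _ s x; rewrite size_pts; apply => y.
by rewrite inE => /orP[/eqP ->|/bs].
Qed.

Lemma post_sd_dist x y : `|x| <= 1 -> y \in s ->
  Num.sqrt (post_var G h x) <= sd_max * `|x - y|.
Proof.
move=> x1 ys; have p0 : 0 <= sd_max * `|x - y| by rewrite mulr_ge0 ?sd_max_ge0.
rewrite -[leRHS]ger0_norm// -sqrtr_sqr ler_sqrt ?sqr_ge0//.
apply: le_trans (post_var_le a_gt0 us bs x1) _; rewrite exprMn.
apply: le_trans (ler_wpM2r (sqr_ge0 _) (var_upper_le K.+1)).
rewrite -(mulrA (var_upper _ _)); apply: ler_wpM2l.
  have r0 := ltW (rate_gt0 a_gt0); have s0 := ltW (kernel0_gt0 a_gt0).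
  by rewrite mulr_ge0// divr_ge0// !mulr_ge0 ?expR_ge0// exprn_ge0// mulr_ge0.
rewrite -[nodal _ _ ^+ 2]real_normK ?num_real// -exprMn.
rewrite ler_pXn2r ?nnegrE ?mulr_ge0 ?exprn_ge0//.
rewrite (nodal_punctured _ us ys) mulrC ler_wpM2r//.
have := @punctured_le _ s y x; rewrite size_pts; apply => t.
by rewrite inE => /orP[/eqP ->|/bs].
Qed.

(** Where the mean exceeds the best value by r standard deviations. *)
Lemma EI_side x r : `|x| <= 1 -> x \notin s -> 0 <= r ->
  r * Num.sqrt (post_var G h x) <= m x - best h ->
  (expected_improvement G h x <= (Num.sqrt 2 * sd_max * expR (- (r ^+ 2 / 2)))%:E)%E.
Proof.
move=> x1 xs r0 H; rewrite expected_improvementE.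
have v0 := post_var_gt0 a_gt0 us bs xs x1.
apply: le_trans (EI_le_tail v0 r0 H) _.
by rewrite lee_fin ler_wpM2r ?expR_ge0// ler_wpM2l ?sqrtr_ge0// post_sd_le.
Qed.

(** At a node the mean is at least the best value and the variance is 0, so that
    the expected improvement grows at most linearly with the distance to a node. *)
Lemma EI_gap (L I0 : R) z y : `|z| <= 1 -> y \in s -> 0 <= L ->
  (forall x x', `|x| <= 1 -> `|x'| <= 1 -> m x - m x' <= L * `|x - x'|) ->
  (I0%:E <= expected_improvement G h z)%E ->
  I0 <= (L + Num.sqrt 2 * sd_max) * `|z - y|.
Proof.
move=> z1 ys L0 lip; rewrite expected_improvementE => /le_trans H.
rewrite -lee_fin; apply: H.
apply: le_trans (@EI_le _ _ _ _ (L * `|z - y|) (post_var_ge0 a_gt0 us bs z1) _ _) _.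
- by rewrite mulr_ge0.
- apply: le_trans (_ : m y - m z <= _); first by rewrite lerD2r best_le.
  by rewrite distrC; apply: lip => //; exact: bs.
- by rewrite lee_fin mulrDl lerD2l -mulrA ler_wpM2l ?sqrtr_ge0// post_sd_dist.
Qed.

(** The order of magnitude of the expected improvement at a distance
    proportional to D / (2^K sqrt (K!)) from the best node. *)
Definition EI_floor (M2 D : R) : R :=
  EI_const * cov_lower a K.+1 * (D / 2 ^+ K.+2) ^+ 2 / M2.

(** Near the best node y the mean exceeds the best value by at most M2 d^2 at
    y + d or at y - d, whereas the standard deviation is at least of order d times
    the product of the distances from y to the other nodes.  For d small enough the
    former is below the latter, and [EI_ge] applies. *)
Lemma EI_max_lower (M2 D : R) : 0 < D -> D <= 1 -> 0 < M2 ->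
  Num.sqrt (cov_lower a K.+1) <= M2 -> separated s D ->
  (forall y, y \in s -> m y = best h -> `|y| <= 2^-1) ->
  (forall x d, `|x| <= 2^-1 -> 0 <= d <= 2^-1 ->
     m (x + d) + m (x - d) <= 2 * (m x + M2 * d ^+ 2)) ->
  exists2 x, `|x| <= 1 & ((EI_floor M2 D)%:E <= expected_improvement G h x)%E.
Proof.
move=> D0 D1 M0 kM sD half curv.
have [y ys yb] := best_attained.
have y2 := half y ys yb.
set k := Num.sqrt _ in kM; have c0 := cov_lower_gt0 a_gt0 K.+1.
have k0 : 0 < k by rewrite sqrtr_gt0.
pose rho := D / 2 ^+ K.+2.
have rho0 : 0 < rho by rewrite divr_gt0// exprn_gt0.
have rhoE : rho = D / 2 ^+ K.+1 / 2.
  by rewrite /rho [2 ^+ K.+2]exprSr invfM mulrA.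
have P1 : 1 <= 2 ^+ K.+1 :> R by rewrite exprn_ege1// ler1n.
have rho2 : rho <= 2^-1.
  rewrite rhoE ler_piMl ?invr_ge0// ler_pdivrMr ?(lt_le_trans ltr01)// mul1r.
  exact: le_trans D1 P1.
(* the distance at which M2 d^2 equals the lower bound k d rho of the
   standard deviation *)
pose d := rho * (k / M2).
have d0 : 0 < d by rewrite mulr_gt0// divr_gt0.
have drho : d <= rho by rewrite ler_piMr ?(ltW rho0)// ler_pdivrMr// mul1r.
have [x [x1 xd mx]] : exists x, [/\ `|x| <= 1, `|x - y| = d & m x <= m y + M2 * d ^+ 2].
  have := curv y d y2; rewrite (ltW d0) (le_trans drho rho2) => /(_ isT) c.
  have y1 : - 2^-1 <= y <= 2^-1 by rewrite -ler_norml.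
  have [le|gt] := leP (m (y + d)) (m y + M2 * d ^+ 2).
    exists (y + d); split => //; last by rewrite addrC addKr gtr0_norm.
    by rewrite ler_norml; lra.
  exists (y - d); split.
  - by rewrite ler_norml; lra.
  - by rewrite addrC addKr normrN gtr0_norm.
  - lra.
have half2 t : t \in s -> t != y -> `|y - t| / 2 <= `|x - t|.
  move=> ts ty.
  have yt : rho <= `|y - t| / 2.
    have := punctured_dist us ts ty; rewrite size_pts => H.
    have {}H : punctured s y y <= `|y - t| * 2 ^+ K.+1.
      by apply: H => r; rewrite inE => /orP[/eqP ->|]; apply: bs.
    rewrite rhoE ler_pM2r ?invr_gt0// ler_pdivrMr ?(lt_le_trans ltr01)//.
    exact: le_trans (sD y ys) H.
  have tri : `|y - t| <= `|x - t| + `|x - y|.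
    rewrite (_ : y - t = (x - t) - (x - y)); last by ring.
    exact: ler_normB.
  by rewrite xd in tri; lra.
have no : d * rho <= `|nodal s x|.
  rewrite (nodal_punctured _ us ys) xd ler_wpM2l ?(ltW d0)//.
  apply: le_trans (punctured_ge_half half2); rewrite size_pts.
  apply: le_trans (_ : D / 2 ^+ K.+1 <= _).
    by rewrite rhoE ler_piMr ?divr_ge0 ?(ltW D0)// invf_le1// ler1n.
  by rewrite ler_pM2r ?sD// invr_gt0 (lt_le_trans ltr01).
have xs : x \notin s.
  by rewrite -nodal_eq0 -normr_gt0 (lt_le_trans _ no)// mulr_gt0.
have sig : k * (d * rho) <= Num.sqrt (post_var G h x).
  rewrite -[leLHS]ger0_norm; last exact: ltW (mulr_gt0 k0 (mulr_gt0 d0 rho0)).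
  rewrite -sqrtr_sqr ler_sqrt; last exact: post_var_ge0.
  apply: le_trans (post_var_ge a_gt0 us bs xs x1).
  rewrite exprMn sqr_sqrtr ?(ltW c0)// ler_wpM2l ?(ltW c0)//.
  rewrite -[leRHS]real_normK ?num_real// ler_pXn2r ?nnegrE//.
  exact: ltW (mulr_gt0 d0 rho0).
exists x => //; rewrite expected_improvementE.
apply: le_trans (EI_ge (post_var_gt0 a_gt0 us bs xs x1) _).
  rewrite lee_fin /EI_floor -/rho.
  rewrite (_ : _ / M2 = EI_const * (k * (d * rho))).
    by rewrite ler_wpM2l ?(ltW (EI_const_gt0 R))// ltW// EI_const_gt0.
  rewrite -[cov_lower a _](sqr_sqrtr (ltW c0)) -/k /d; field.
  by rewrite gt_eqF.
apply: le_trans sig; rewrite -yb lerBlDl; apply: le_trans mx _.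
rewrite lerD2l (_ : M2 * d ^+ 2 = k * (d * rho))//.
by rewrite /d; field; rewrite gt_eqF.
Qed.

End Stage.

(** * Choice of the amplitude *)

Section Constants.
Context {R : realType}.

Lemma fact_le_exp n : n`!%:R <= expR (n%:R ^+ 2) :> R.
Proof.
elim: n => [|n IH]; first by rewrite expr0n/= expR0.
rewrite factS natrM; apply: le_trans (_ : expR n%:R * expR (n%:R ^+ 2) <= _).
  by rewrite ler_pM// -natr1 addrC expR_ge1Dx.
rewrite -expRD ler_expR -natr1.
have : 0 <= n%:R :> R by []. nra.
Qed.

Lemma sqr_le_4X n : n%:R ^+ 2 <= 4 ^+ n :> R.
Proof.
rewrite (_ : 4 = 2 ^+ 2 :> R); last by ring.
rewrite -exprM mulnC exprM ler_pXn2r ?nnegrE ?exprn_ge0//.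
by rewrite -natrX ler_nat ltnW// ltn_expl.
Qed.

(** 4^n eventually dominates n log n. *)
Lemma exp4_le (C p : R) : 0 < C -> 0 < p ->
  exists2 B, 0 <= B & forall n, expR (- (B * 4 ^+ n)) <= C * p ^+ n / n`!%:R.
Proof.
move=> C0 p0; exists (`|ln C| + `|ln p| + 1); first by rewrite !addr_ge0.
move=> n; rewrite -{2}(lnK C0) -{2}(lnK p0) -expRM_natl.
have F0 : 0 < n`!%:R :> R by rewrite ltr0n fact_gt0.
rewrite ler_pdivlMr//; apply: le_trans (ler_wpM2l (expR_ge0 _) (fact_le_exp n)) _.
rewrite -!expRD ler_expR.
have X1 : 1 <= 4 ^+ n :> R by rewrite exprn_ege1// ler1n.
have Xn : n%:R <= 4 ^+ n :> R.
  apply: le_trans (sqr_le_4X n); case: n {F0 X1} => [|n]; first by rewrite expr0n.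
  by rewrite expr2 ler_peMl// ler1n.
have X2 := sqr_le_4X n.
have h1 : - (`|ln C| * 4 ^+ n) <= ln C.
  apply: le_trans (_ : - `|ln C| <= _); last by rewrite lerNl ler_normr lexx orbT.
  by rewrite lerN2 ler_peMr.
have h2 : - (`|ln p| * 4 ^+ n) <= n%:R * ln p.
  apply: le_trans (_ : n%:R * - `|ln p| <= _).
    by rewrite mulrN lerN2 mulrC ler_wpM2l.
  by rewrite ler_wpM2l// lerNl ler_normr lexx orbT.
rewrite !mulrDl mul1r; lra.
Qed.

(** A single term of the exponential series of 4 / p. *)
Lemma fact_pow_ge (p : R) n : 0 < p -> expR (- (4 / p)) * 4 ^+ n <= p ^+ n * n`!%:R.
Proof.
move=> p0; have q0 : 0 <= 4 / p by rewrite divr_ge0// ltW.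
have := exp_coeff_le n q0; rewrite expRN ler_pdivrMr ?ltr0n ?fact_gt0//.
rewrite expr_div_n ler_pdivrMr ?exprn_gt0// => H.
by rewrite ler_pdivrMl ?expR_gt0// (le_trans H)// le_eqVlt; apply/orP; left; apply/eqP; ring.
Qed.

Variable a : R.
Hypothesis a_gt0 : 0 < a.

(** T^2 times this quantity is a lower bound for the square of the number of
    standard deviations by which the adversary lifts the mean on the empty side. *)
Definition margin n : R := 4^-1 ^+ n * (kernel0 a * cov_lower a n ^+ 2 /
  (4 * taylor_const (rate a) n * var_upper a n * var_upper a n.+1)).

Lemma margin_ge : exists2 c, 0 < c & forall n, c * 4 ^+ n <= margin n.
Proof.
have r0 := rate_gt0 a_gt0; have s0 := kernel0_gt0 a_gt0.
set r := rate a in r0; set q := r / (2 * expR 1).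
have q0 : 0 < q by rewrite divr_gt0// mulr_gt0 ?expR_gt0.
pose p := q * q / (4 * (32 * r) * (2 * r) * (2 * r)).
have p0 : 0 < p by rewrite divr_gt0 ?mulr_gt0.
pose c5 := kernel0 a * (kernel0 a * expR (- (3 * r + 1))) ^+ 2 /
  (4 * (4 * expR (16 * r)) * (kernel0 a * (4 * expR (8 * r))) * (kernel0 a * (4 * expR (8 * r) * (2 * r)))).
have c50 : 0 < c5.
  by rewrite divr_gt0 ?mulr_gt0 ?exprn_gt0 ?mulr_gt0 ?expR_gt0.
exists (c5 * expR (- (4 / p))); first by rewrite mulr_gt0 ?expR_gt0.
move=> n; rewrite -mulrA.
apply: le_trans (ler_wpM2l (ltW c50) (fact_pow_ge n p0)) _.
apply: le_trans (_ : c5 * (p ^+ n * n.+1`!%:R) <= _).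
  rewrite ler_wpM2l ?(ltW c50)// ler_wpM2l ?exprn_ge0 ?(ltW p0)//.
  by rewrite ler_nat leq_fact.
rewrite le_eqVlt; apply/orP; left; apply/eqP.
rewrite /margin /cov_lower /taylor_const /var_upper -/r -/q /c5 /p.
have F0 m : m`!%:R != 0 :> R by rewrite gt_eqF// ltr0n fact_gt0.
have E0 x : expR x != 0 :> R by rewrite gt_eqF// expR_gt0.
have rn : r != 0 by rewrite gt_eqF.
have qn : q != 0 by rewrite gt_eqF.
have sn : kernel0 a != 0 by rewrite gt_eqF.
move: {c50 p0 p c5 q0} q qn => q qn.
move: {r0} r rn {s0} (kernel0 a) sn => r rn t tn.
rewrite factS natrM !expr_div_n !exprMn !exprVn !exprS.
have n1 : n.+1%:R != 0 :> R by rewrite pnatr_eq0.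
move: (n.+1%:R) n1 => N Nn.
field.
by rewrite !E0 !F0 rn tn Nn ?expf_neq0.
Qed.

Definition sep_bound (T : R) n : R := expR (- (4 ^+ n * T)).

Lemma sep_bound_gt0 T n : 0 < sep_bound T n. Proof. exact: expR_gt0. Qed.

Lemma sep_bound_le1 T n : 0 <= T -> sep_bound T n <= 1.
Proof. by move=> T0; rewrite -expR0 ler_expR oppr_le0 mulr_ge0// exprn_ge0. Qed.

Lemma le_expR (x : R) : x <= expR x.
Proof. by apply: le_trans (expR_ge1Dx x); rewrite lerDr. Qed.

(** Up to constants the first condition is exp (4^n T) >= T^2 n! / p^n and the
    second one T^2 p^n n! >= 4^n T.  Both hold for all n at once if T is large: the
    first by [exp4_le], the second by [fact_pow_ge]. *)
Lemma exists_scale (B1 L1 : R) : 0 < B1 -> 0 < L1 -> exists2 T, 1 <= T &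
  (forall n, sep_bound T n.+2 <= EI_floor a n (T * B1) (sep_bound T n.+1) / (T * L1)
     * sep_bound T n.+1 / 2 ^+ n.+1) /\
  (forall n, Num.sqrt 2 * sd_max a * expR (- (T ^+ 2 * margin n / 2)) <
     EI_floor a n (T * B1) (sep_bound T n.+1)).
Proof.
move=> B10 L10; have r0 := rate_gt0 a_gt0; have s0 := kernel0_gt0 a_gt0.
have [c c0 cm] := margin_ge.
have [q q0 qE] : exists2 q, 0 < q & rate a / (2 * expR 1) = q.
  by exists (rate a / (2 * expR 1)); rewrite // divr_gt0// mulr_gt0 ?expR_gt0.
pose c1 := EI_const * (kernel0 a * expR (- (3 * rate a + 1))).
have c10 : 0 < c1 by rewrite mulr_gt0 ?EI_const_gt0// mulr_gt0// expR_gt0.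
have clE n : EI_const * cov_lower a n = c1 * q ^+ n / n`!%:R.
  by rewrite /cov_lower qE /c1; ring.
have [Bi Bi0 Hi] := @exp4_le (c1 / (4 * B1 * L1)) (q / 8)
  ltac:(by rewrite divr_gt0// !mulr_gt0) ltac:(by rewrite divr_gt0).
have [Bj Bj0 Hj] := @exp4_le (c1 / (4 * B1)) (q / 4)
  ltac:(by rewrite divr_gt0// !mulr_gt0) ltac:(by rewrite divr_gt0).
set S := Num.sqrt 2 * sd_max a.
have S0 : 0 <= S by rewrite mulr_ge0 ?sd_max_ge0.
pose T := 1 + 2 * Bi + Bj + S + 29 / c.
have d0 : 0 < 29 / c by rewrite divr_gt0.
have T1 : 1 <= T by rewrite /T; lra.
have TBi : 2 * Bi <= T by rewrite /T; lra.
have TBj : Bj <= T by rewrite /T; lra.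
have TS : S <= T by rewrite /T; lra.
have Tc : 29 <= T * c.
  by rewrite -ler_pdivrMr// /T; lra.
have T0 : 0 < T by lra.
have P n : 0 < 2 ^+ n :> R by rewrite exprn_gt0.
have F n : 0 < n`!%:R :> R by rewrite ltr0n fact_gt0.
exists T => //; move: {d0} T T1 TBi TBj TS Tc T0 => T T1 TBi TBj TS Tc T0.
have TeT := le_expR T.
split => n.
- rewrite /EI_floor clE; set e := sep_bound T n.+1.
  have e0 : 0 < e by exact: sep_bound_gt0.
  have -> : sep_bound T n.+2 = e ^+ 3 * e.
    rewrite /e /sep_bound -expRM_natl -expRD; congr expR.
    by rewrite (exprS 4 n.+1); ring.
  rewrite [leRHS](_ : _ = e ^+ 3 * (T ^- 2 * (c1 / (4 * B1 * L1) * (q / 8) ^+ n.+1 / n.+1`!%:R))); last first.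
    rewrite (exprS 2 n.+1) (expr_div_n q) (_ : 8 = 2 * 2 * 2); last by ring.
    rewrite !exprMn; field.
    by rewrite !gt_eqF//= ?F ?P.
  apply: ler_wpM2l; first by rewrite exprn_ge0// ltW.
  rewrite mulrC ler_pdivlMr ?exprn_gt0//; apply: le_trans (Hi n.+1).
  apply: le_trans (_ : e * expR T ^+ 2 <= _).
    by rewrite ler_wpM2l ?(ltW e0)// ler_pXn2r ?nnegrE ?expR_ge0 ?(ltW T0).
  rewrite /e /sep_bound -expRM_natl -expRD ler_expR exprS.
  have X1 : 1 <= 4 ^+ n :> R by rewrite exprn_ege1// ler1n.
  move: (4 ^+ n) X1 => X X1; nra.
- rewrite /EI_floor clE.
  set X := (X in _ < X).
  have -> : X = sep_bound T n.+1 ^+ 2 / T * (c1 / (4 * B1) * (q / 4) ^+ n.+1 / n.+1`!%:R).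
    rewrite /X (exprS 2 n.+1) (expr_div_n q) (_ : 4 = 2 * 2); last by ring.
    rewrite !exprMn; field.
    by rewrite !gt_eqF//= ?F ?P.
  have e0 : 0 < sep_bound T n.+1 ^+ 2 / T by rewrite divr_gt0 ?exprn_gt0 ?sep_bound_gt0.
  apply: lt_le_trans (ler_wpM2l (ltW e0) (Hj n.+1)).
  rewrite [X in _ < X]mulrAC ltr_pdivlMr//.
  apply: le_lt_trans (_ : expR S * expR (- (T ^+ 2 * margin n / 2)) * expR T < _).
    apply: ler_pM => //.
    - by apply: mulr_ge0 => //; exact: expR_ge0.
    - exact: ltW.
    - by apply: ler_wpM2r; [exact: expR_ge0|exact: le_expR].
  rewrite /sep_bound -expRM_natl -!expRD ltr_expR.
  have X1 : 1 <= 4 ^+ n :> R by rewrite exprn_ege1// ler1n.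
  have := cm n; rewrite (exprS 4 n); move: (margin n) (4 ^+ n) X1 => mn Y Y1 cY.
  have h1 : T ^+ 2 * (c * Y) <= T ^+ 2 * mn by rewrite ler_wpM2l// sqr_ge0.
  have h2 : 29 * (T * Y) <= T ^+ 2 * (c * Y).
    rewrite (_ : T ^+ 2 * (c * Y) = T * c * (T * Y)); last by ring.
    by rewrite ler_wpM2r// mulr_ge0; lra.
  have h3 : T <= T * Y by rewrite ler_peMr// ltW.
  have h4 : Bj * Y <= T * Y by rewrite ler_wpM2r//; lra.
  lra.
Qed.

End Constants.

(** * Regularity of the posterior mean *)

Section SecondOrder.
Context {R : realType}.
Implicit Types (f g : R -> R) (B x y d : R).

Lemma derivative_lip f g B x y : (forall t : R, is_derive t 1 f (g t)) ->
  (forall t, `|t| <= 1 -> `|g t| <= B) -> `|x| <= 1 -> `|y| <= 1 ->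
  `|f x - f y| <= B * `|x - y|.
Proof.
move=> df gB; wlog xy : x y / y <= x.
  move=> W x1 y1; have [xy|/ltW xy] := leP y x; first exact: W.
  by rewrite distrC [`|x - y|]distrC; exact: W.
have cf : continuous f.
  move=> t; apply: differentiable_continuous; apply/derivable1_diffP.
  by have [] := df t.
move=> x1 y1; have [c] := @MVT_segment _ f g y x xy (fun t _ => df t)
  (continuous_subspaceT cf).
rewrite in_itv/= => /andP[yc cx] ->; rewrite normrM ler_wpM2r// gB//.
move: x1 y1; rewrite !ler_norml => /andP[_ x1] /andP[y1 _].
by rewrite (le_trans y1 yc) (le_trans cx x1).
Qed.

(** Two applications of the mean value theorem, on both sides of x, then one to
    the derivative. *)
Lemma second_difference_le f g (g' : R -> R) B x d : (forall t : R, is_derive t 1 f (g t)) ->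
  (forall t : R, is_derive t 1 g (g' t)) -> (forall t, `|t| <= 1 -> `|g' t| <= B) ->
  `|x| <= 2^-1 -> 0 <= d <= 2^-1 ->
  f (x + d) + f (x - d) <= 2 * (f x + B * d ^+ 2).
Proof.
move=> df dg gB x2 /andP[d0 d2].
have cf : continuous f.
  move=> t; apply: differentiable_continuous; apply/derivable1_diffP.
  by have [] := df t.
have xd : x <= x + d by rewrite lerDl.
have xd' : x - d <= x by rewrite gerBl.
have [c1] := @MVT_segment _ f g x (x + d) xd (fun t _ => df t)
  (continuous_subspaceT cf).
rewrite in_itv/= => c1I E1.
have [c2] := @MVT_segment _ f g (x - d) x xd' (fun t _ => df t)
  (continuous_subspaceT cf).
rewrite in_itv/= => c2I E2.
move: x2; rewrite ler_norml => x2.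
have B0 : 0 <= B by apply: le_trans (gB 0 _); rewrite ?normr0.
have := derivative_lip dg gB (_ : `|c1| <= 1) (_ : `|c2| <= 1).
rewrite !ler_norml => H.
have {}H : g c1 - g c2 <= B * `|c1 - c2|.
  by apply: le_trans (ler_norm _) _; rewrite ler_norml; apply: H; lra.
have c12 : `|c1 - c2| <= 2 * d by rewrite ler_norml; lra.
have H2 := le_trans H (ler_wpM2l B0 c12).
have e1 : f (x + d) = f x + g c1 * d by lra.
have e2 : f (x - d) = f x - g c2 * d by lra.
rewrite e1 e2; nra.
Qed.

End SecondOrder.

Section MeanShape.
Context {R : realType}.
Variable a : R.
Hypothesis a_gt0 : 0 < a.
Local Notation r := (rate a).
Local Notation c0 := (kernel0 a).
Local Notation wt := (wt a).

Lemma is_derive_wt (x : R) : is_derive x 1 wt (- (r * x * wt x)).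
Proof.
have H : is_derive x 1 (fun x : R => - (r * x ^+ 2 / 2)) (- (r * x)).
  rewrite (_ : (fun x : R => _) = (fun x : R => (- r / 2) * x ^+ 2)); last first.
    by apply/funext => t; field.
  by apply: is_derive_eq; rewrite /GRing.scale/=; field.
have D := @is_derive1_comp _ expR (fun x : R => - (r * x ^+ 2 / 2)) x _ _
    (is_derive_expR _) H.
by apply: (is_derive_eq D); rewrite /wt; ring.
Qed.

(** The form kept by all the posterior means: the first observation contributes
    - M wt, and each later one a multiple of wt times an exponential sum. *)
Definition mean_shape (V : nat -> R -> R) (M : R) x := wt x * (c0 * V 0%N x - M).
Definition mean_shape1 (V : nat -> R -> R) (M : R) x :=
  wt x * (c0 * V 1%N x - r * x * (c0 * V 0%N x - M)).
Definition mean_shape2 (V : nat -> R -> R) (M : R) x :=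
  wt x * (c0 * V 2%N x - r * (c0 * V 0%N x - M) - r * x * (c0 * V 1%N x)) -
  r * x * mean_shape1 V M x.

Lemma is_derive_mean_shape V M (x : R) : jet V -> is_derive x 1 (mean_shape V M) (mean_shape1 V M x).
Proof.
move=> jV; have H0 := jV 0%N x; have Hw := is_derive_wt x.
rewrite /mean_shape.
have H1 : is_derive x 1 (fun x => c0 * V 0%N x - M) (c0 * V 1%N x).
  by apply: is_derive_eq; rewrite /GRing.scale/=; ring.
have H2 := is_deriveM Hw H1.
by apply: (is_derive_eq H2); rewrite /mean_shape1 /GRing.scale/=; ring.
Qed.

Lemma is_derive_mean_shape1 V M (x : R) : jet V -> is_derive x 1 (mean_shape1 V M) (mean_shape2 V M x).
Proof.
move=> jV; have H0 := jV 0%N x; have H1 := jV 1%N x; have Hw := is_derive_wt x.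
have H2 : is_derive x 1 (fun x => c0 * V 1%N x - r * x * (c0 * V 0%N x - M))
   (c0 * V 2%N x - r * (c0 * V 0%N x - M) - r * x * (c0 * V 1%N x)).
  have Ha : is_derive x 1 (fun x => c0 * V 0%N x - M) (c0 * V 1%N x).
    by apply: is_derive_eq; rewrite /GRing.scale/=; ring.
  have Hb : is_derive x 1 (fun x : R => r * x) r.
    by apply: is_derive_eq; rewrite /GRing.scale/=; ring.
  have Hc := is_deriveM Hb Ha.
  have Hd : is_derive x 1 (fun x => c0 * V 1%N x) (c0 * V 2%N x).
    by apply: is_derive_eq; rewrite /GRing.scale/=.
  have He := is_deriveB Hd Hc.
  by apply: (is_derive_eq He); rewrite /GRing.scale/=; ring.
have H3 := is_deriveM Hw H2.
by apply: (is_derive_eq H3); rewrite /mean_shape2 /mean_shape1 /GRing.scale/=; ring.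
Qed.

(** The value of wt at 1/2. *)
Definition omega : R := expR (- (r / 8)).

Lemma omega_lt1 : omega < 1.
Proof. by rewrite -expR0 ltr_expR oppr_lt0 divr_gt0 ?rate_gt0. Qed.

(** Chosen so that the mean cannot be as low as - depth * T at a distance more
    than 1/2 from 0, where the factor wt is at most omega. *)
Definition depth : R := c0 / (1 - omega).
Definition slope : R := c0 + r * (c0 + depth).
Definition curvature : R := c0 + 2 * r * c0 + (r + r ^+ 2) * (c0 + depth).

Lemma depth_gt0 : 0 < depth.
Proof. by rewrite divr_gt0 ?kernel0_gt0// subr_gt0 omega_lt1. Qed.

Variables (V : nat -> R -> R) (T : R).
Hypothesis jV : jet V.
Hypothesis T0 : 0 < T.
Hypothesis VT : forall n x, `|x| <= 1 -> `|V n x| * 2 ^+ n / n`!%:R <= T.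
Local Notation M := (depth * T).

Lemma jet_le2 n x : (n <= 2)%N -> `|x| <= 1 -> `|V n x| <= T.
Proof.
move=> n2 x1; have := VT n x1; have := normr_ge0 (V n x).
have [f0 f1 f2] : [/\ 0`! = 1%N, 1`! = 1%N & 2`! = 2%N] by [].
by case: n n2 => [|[|[|]]]// _; rewrite ?f0 ?f1 ?f2 ?expr0 ?expr1 ?expr2; lra.
Qed.

Lemma core_bound x : `|x| <= 1 -> `|c0 * V 0%N x - M| <= (c0 + depth) * T.
Proof.
move=> x1; apply: le_trans (ler_normB _ _) _; rewrite mulrDl.
have d0 := depth_gt0; have s0 := kernel0_gt0 a_gt0.
apply: lerD; last by rewrite ger0_norm// mulr_ge0 ?(ltW T0)// ltW.
by rewrite normrM (gtr0_norm s0) ler_wpM2l ?(ltW s0)// jet_le2.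
Qed.

Lemma mean_shape1_bound x : `|x| <= 1 -> `|mean_shape1 V M x| <= slope * T.
Proof.
move=> x1; have s0 := kernel0_gt0 a_gt0; have r0 := rate_gt0 a_gt0.
rewrite normrM (gtr0_norm (wt_gt0 a x)).
apply: le_trans (ler_piMl (normr_ge0 _) (wt_le1 a_gt0 x)) _.
apply: le_trans (ler_normB _ _) _; rewrite mulrDl; apply: lerD.
  by rewrite normrM (gtr0_norm s0) ler_wpM2l ?(ltW s0)// jet_le2.
rewrite !normrM (gtr0_norm r0) -(mulrA r `|x|) -(mulrA r (c0 + depth)).
rewrite ler_wpM2l ?(ltW r0)//.
apply: le_trans (ler_piMl (normr_ge0 _) x1) _; exact: core_bound.
Qed.

Lemma mean_shape2_bound x : `|x| <= 1 -> `|mean_shape2 V M x| <= curvature * T.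
Proof.
move=> x1; have s0 := kernel0_gt0 a_gt0; have r0 := rate_gt0 a_gt0.
have d0 := depth_gt0.
have V1 : `|c0 * V 1%N x| <= c0 * T by rewrite normrM (gtr0_norm s0) ler_wpM2l ?(ltW s0)// jet_le2.
have V2 : `|c0 * V 2%N x| <= c0 * T by rewrite normrM (gtr0_norm s0) ler_wpM2l ?(ltW s0)// jet_le2.
have rx : `|r * x| <= r by rewrite normrM (gtr0_norm r0) ler_piMr ?(ltW r0).
rewrite (_ : curvature * T = (c0 * T + r * ((c0 + depth) * T) + r * (c0 * T)) + r * (slope * T)); last first.
  by rewrite /curvature /slope; ring.
apply: le_trans (ler_normB _ _) _; apply: lerD.
  rewrite normrM (gtr0_norm (wt_gt0 a x)).
  apply: le_trans (ler_piMl (normr_ge0 _) (wt_le1 a_gt0 x)) _.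
  apply: le_trans (ler_normB _ _) _; apply: lerD; last by rewrite normrM ler_pM.
  apply: le_trans (ler_normB _ _) _; apply: lerD => //.
  by rewrite normrM (gtr0_norm r0) ler_wpM2l ?(ltW r0)// core_bound.
by rewrite normrM ler_pM// mean_shape1_bound.
Qed.

Lemma mean_shape_lip x y : `|x| <= 1 -> `|y| <= 1 ->
  mean_shape V M x - mean_shape V M y <= slope * T * `|x - y|.
Proof.
move=> x1 y1; apply: le_trans (ler_norm _) _.
exact: (@derivative_lip _ _ _ _ _ _ (fun t => is_derive_mean_shape M t jV) mean_shape1_bound).
Qed.

Lemma mean_shape_curv x d : `|x| <= 2^-1 -> 0 <= d <= 2^-1 ->
  mean_shape V M (x + d) + mean_shape V M (x - d) <= 2 * (mean_shape V M x + curvature * T * d ^+ 2).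
Proof.
move=> x2 d2; exact: (@second_difference_le _ _ _ _ _ _ _
  (fun t => is_derive_mean_shape M t jV) (fun t => is_derive_mean_shape1 M t jV) mean_shape2_bound).
Qed.

(** Away from 0 the Gaussian factor lifts the mean above - M, and the
    perturbations are too small to compensate. *)
Lemma mean_shape_low_half x : `|x| <= 1 -> mean_shape V M x <= - M -> `|x| <= 2^-1.
Proof.
move=> x1 low; rewrite leNgt; apply/negP => x2.
have s0 := kernel0_gt0 a_gt0; have r0 := rate_gt0 a_gt0; have d0 := depth_gt0.
have wo : wt x <= omega.
  rewrite ler_expR lerN2 -real_normK ?num_real//.
  have : 2^-1 * 2^-1 <= `|x| ^+ 2 by rewrite expr2 ler_pM// ltW.
  by nra.
have cb := core_bound x1.
have o1 := omega_lt1; have o0 : 0 < omega by exact: expR_gt0.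
have H : `|mean_shape V M x| <= omega * ((c0 + depth) * T).
  by rewrite normrM (gtr0_norm (wt_gt0 a x)) ler_pM// ltW// wt_gt0.
have : omega * (c0 + depth) < depth.
  have e : c0 = depth * (1 - omega) by rewrite /depth divfK// gt_eqF// subr_gt0.
  rewrite {1}e -subr_gt0 (_ : _ - _ = depth * (1 - omega) ^+ 2); last by ring.
  by rewrite mulr_gt0// exprn_gt0// subr_gt0.
rewrite -(ltr_pM2r T0) => H2.
have : - `|mean_shape V M x| <= mean_shape V M x by rewrite lerNl ler_normr lexx orbT.
by move: H H2 low; rewrite -mulrA; lra.
Qed.

End MeanShape.

(** * The adversary *)

Section Adversary.
Context {R : realType}.
Variable a : R.
Hypothesis a_gt0 : 0 < a.
Local Notation G := (gaussian_kernel a).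
Local Notation r := (rate a).
Local Notation c0 := (kernel0 a).
Local Notation wt := (wt a).
Variable A : forall K : nat, K.+1.-tuple (R * R) -> R.
Hypothesis A_EI : EI_rule G A.

Definition cov_lower_max : R := 1 + c0 * expR (r / (2 * expR 1)).

Lemma sqrt_cov_lower_le n : Num.sqrt (cov_lower a n) <= cov_lower_max.
Proof.
have r0 := rate_gt0 a_gt0; have s0 := kernel0_gt0 a_gt0.
have h : cov_lower a n <= c0 * expR (r / (2 * expR 1)).
  rewrite /cov_lower -!(mulrA c0) -mulrA; apply: ler_wpM2l; first exact: ltW.
  apply: le_trans (_ : 1 * ((r / (2 * expR 1)) ^+ n / n`!%:R) <= _).
    apply: ler_wpM2r.
      by rewrite divr_ge0// exprn_ge0// divr_ge0 ?(ltW r0)// mulr_ge0 ?expR_ge0.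
    by rewrite expR_le1; lra.
  by rewrite mul1r exp_coeff_le// divr_ge0 ?(ltW r0)// mulr_ge0 ?expR_ge0.
set x := cov_lower a n in h *; have x0 : 0 <= x by exact/ltW/cov_lower_gt0.
apply: le_trans (_ : 1 + x <= _); last by rewrite lerD2l.
rewrite -[leRHS]ger0_norm ?addr_ge0// -sqrtr_sqr ler_sqrt ?sqr_ge0//; nra.
Qed.

Definition curv_const : R := curvature a + cov_lower_max.
Definition lip_const : R := slope a + Num.sqrt 2 * sd_max a.

Lemma cov_lower_max_ge1 : 1 <= cov_lower_max.
Proof.
by rewrite lerDl mulr_ge0 ?expR_ge0// ltW// kernel0_gt0.
Qed.

Lemma slope_gt0 : 0 < slope a.
Proof.
have r0 := rate_gt0 a_gt0; have s0 := kernel0_gt0 a_gt0; have d0 := depth_gt0 a_gt0.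
by rewrite ltr_pwDl// mulr_ge0 ?addr_ge0 ?(ltW r0) ?(ltW s0) ?(ltW d0).
Qed.

Lemma curvature_ge0 : 0 <= curvature a.
Proof.
have r0 := rate_gt0 a_gt0; have s0 := kernel0_gt0 a_gt0; have d0 := depth_gt0 a_gt0.
by rewrite /curvature; move: (depth a) d0 => d d0; rewrite !addr_ge0 ?mulr_ge0 ?addr_ge0 ?sqr_ge0 ?(ltW r0) ?(ltW s0) ?(ltW d0).
Qed.

Lemma curv_const_gt0 : 0 < curv_const.
Proof.
by rewrite ltr_wpDl ?curvature_ge0// (lt_le_trans ltr01)// cov_lower_max_ge1.
Qed.

Lemma lip_const_gt0 : 0 < lip_const.
Proof. by rewrite ltr_pwDl ?slope_gt0// mulr_ge0 ?sd_max_ge0. Qed.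

Variables T sg : R.
Hypothesis T1 : 1 <= T.
Hypothesis sep_step : forall n, sep_bound T n.+2 <=
  EI_floor a n (T * curv_const) (sep_bound T n.+1) / (T * lip_const)
     * sep_bound T n.+1 / 2 ^+ n.+1.
Hypothesis side_step : forall n,
  Num.sqrt 2 * sd_max a * expR (- (T ^+ 2 * margin a n / 2)) <
     EI_floor a n (T * curv_const) (sep_bound T n.+1).
Hypothesis sg2 : sg * sg = 1.

Local Notation M := (depth a * T).

(** Its absolute value makes the k-th Taylor coefficient of the perturbation at
    most T 2^-k 2^-n, by [post_cov_jet].  Its sign is that of the covariance on the
    side of - sg. *)
Definition amplitude n (h : n.-tuple (R * R)) z : R :=
  (if 0 <= post_cov a h z (- sg) then 1 else -1) *
  (T * 2^-1 ^+ n * Num.sqrt (c0 / (post_var G h z * taylor_const r n))).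

Definition answer n (h : n.-tuple (R * R)) z : R :=
  post_mean G h z + amplitude h z * post_var G h z.

Fixpoint adversary K : K.+1.-tuple (R * R) :=
  match K with
  | 0 => [tuple (0, - M)]
  | K'.+1 => let h := adversary K' in
      rcons_tuple h (A h, answer h (A h))
  end.

(** The invariant of the game: sg is the sign of the side on which all the
    nodes lie, and V is the perturbation accumulated so far.  The bound of
    controlled_jet is the partial sum of the amplitudes. *)
Record controlled K (h : K.+1.-tuple (R * R)) (V : nat -> R -> R) : Prop := Controlled {
  controlled_uniq : uniq (pts h);
  controlled_bound : forall y, y \in pts h -> `|y| <= 1;
  controlled_side : forall y, y \in pts h -> 0 <= sg * y;
  controlled_sep : separated (pts h) (sep_bound T K.+1);
  controlled_entire : entire V;
  controlled_jet : forall n x, `|x| <= 1 ->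
    `|V n x| * 2 ^+ n / n`!%:R <= T * (1 - 2^-1 ^+ K);
  controlled_mean : forall x, post_mean G h x = mean_shape a V M x;
  controlled_pos : forall x, `|x| <= 1 -> sg * x < 0 -> 0 <= V 0%N x;
  controlled_margin : (0 < K)%N -> forall x, `|x| <= 1 -> sg * x < 0 ->
    T * Num.sqrt (margin a K) * Num.sqrt (post_var G h x) <= c0 * wt x * V 0%N x;
  controlled_zero : 0 \in pts h;
  controlled_zero_mean : post_mean G h 0 = - M }.

Lemma margin_ge0 n : 0 <= margin a n.
Proof.
have [c c_gt0 H] := margin_ge a_gt0; apply: le_trans (H n).
by rewrite mulr_ge0 ?(ltW c_gt0)// exprn_ge0.
Qed.

Lemma taylor_const_gt0 n : 0 < taylor_const r n.
Proof.
have r0 := rate_gt0 a_gt0.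
by rewrite divr_gt0 ?ltr0n ?fact_gt0// !mulr_gt0 ?expR_gt0// exprn_gt0// mulr_gt0.
Qed.

Lemma var_upper_gt0 n : 0 < var_upper a n.
Proof.
have r0 := rate_gt0 a_gt0; have s0 := kernel0_gt0 a_gt0.
by rewrite mulr_gt0// divr_gt0 ?ltr0n ?fact_gt0// !mulr_gt0 ?expR_gt0// exprn_gt0// mulr_gt0.
Qed.

Lemma half_pow n : 2^-1 ^+ n <= 1 :> R.
Proof. by rewrite exprn_ile1// invf_le1// ler1n. Qed.

Section Step.
Variables (K : nat) (h : K.+1.-tuple (R * R)) (V : nat -> R -> R).
Hypothesis hV : controlled h V.
Local Notation s := (pts h).
Local Notation z := (A h).

Let T0 : 0 < T. Proof. by rewrite (lt_le_trans ltr01). Qed.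

Lemma controlled_jetW n x : `|x| <= 1 -> `|V n x| * 2 ^+ n / n`!%:R <= T.
Proof.
move=> x1; apply: le_trans (controlled_jet hV n x1) _.
by rewrite ler_piMr ?(ltW T0)// gerBl exprn_ge0.
Qed.

Lemma best_le_depth : best h <= - M.
Proof.
rewrite -(controlled_zero_mean hV); apply: (best_le a_gt0 (controlled_uniq hV) (controlled_bound hV)).
exact: controlled_zero hV.
Qed.

(** The expected improvement which is reached somewhere. *)
Definition EI_target : R := EI_floor a K (T * curv_const) (sep_bound T K.+1).

Lemma EI_target_gt0 : 0 < EI_target.
Proof.
apply: le_lt_trans (side_step K).
by rewrite !mulr_ge0 ?sd_max_ge0 ?expR_ge0.
Qed.

Lemma in_itv11 (x : R) : (x \in `[-1, 1]) = (`|x| <= 1).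
Proof. by rewrite in_itv/= ler_norml. Qed.

Lemma pt_in_itv k : pt h k \in `[-1, 1].
Proof. by rewrite in_itv11 (controlled_bound hV)// pt_in. Qed.

Lemma next_bound : `|z| <= 1.
Proof. by have [] := A_EI pt_in_itv; rewrite in_itv11. Qed.

Lemma next_max y : `|y| <= 1 ->
  (expected_improvement G h y <= expected_improvement G h z)%E.
Proof.
have [_ H] := A_EI pt_in_itv; rewrite -in_itv11; apply: H.
exact: pt_inj (controlled_uniq hV).
Qed.

Lemma next_EI_target : (EI_target%:E <= expected_improvement G h z)%E.
Proof.
have us := controlled_uniq hV; have bs := controlled_bound hV.
have D0 := sep_bound_gt0 T K.+1.
have D1 : sep_bound T K.+1 <= 1 by exact/sep_bound_le1/ltW.
have M20 : 0 < T * curv_const by rewrite mulr_gt0 ?curv_const_gt0.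
have jV : jet V by have [] := controlled_entire hV.
have [||x d|x x1 Hx] := EI_max_lower a_gt0 us bs D0 D1 M20 _ (controlled_sep hV).
- apply: le_trans (sqrt_cov_lower_le _) _.
  apply: le_trans (_ : curv_const <= _); first by rewrite lerDr curvature_ge0.
  by rewrite ler_peMl// ltW// curv_const_gt0.
- move=> y ys yb; apply: (mean_shape_low_half a_gt0 T0 controlled_jetW (bs _ ys)).
  by rewrite -(controlled_mean hV) yb best_le_depth.
- move=> x2 d2; rewrite !(controlled_mean hV).
  apply: le_trans (mean_shape_curv a_gt0 jV T0 controlled_jetW x2 d2) _.
  rewrite ler_wpM2l// lerD2l ler_wpM2r ?sqr_ge0// mulrC ler_wpM2l ?(ltW T0)//.
  by rewrite lerDl (le_trans ler01)// cov_lower_max_ge1.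
exact: le_trans Hx (next_max x1).
Qed.

Lemma next_new : z \notin s.
Proof.
apply/negP => zs; have := next_EI_target.
rewrite (EI_node a_gt0 (controlled_uniq hV) (controlled_bound hV) zs) lee_fin leNgt.
by rewrite EI_target_gt0.
Qed.

(** For a query on the empty side, the expected improvement would be smaller than
    the value that is reached near the best node. *)
Lemma next_side : (0 < K)%N \/ 0 <= sg * z -> 0 <= sg * z.
Proof.
move=> [K0|//]; rewrite leNgt; apply/negP => sz.
have := next_EI_target; apply/negP; rewrite -ltNge.
have r0 : 0 <= T * Num.sqrt (margin a K) by rewrite mulr_ge0 ?sqrtr_ge0// ltW.
apply: (@le_lt_trans _ _ (Num.sqrt 2 * sd_max a * expR (- (T ^+ 2 * margin a K / 2)))%:E).
  have -> : T ^+ 2 * margin a K = (T * Num.sqrt (margin a K)) ^+ 2.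
    by rewrite exprMn sqr_sqrtr// margin_ge0.
  apply: (EI_side a_gt0 (controlled_uniq hV) (controlled_bound hV) next_bound next_new r0).
  apply: le_trans (controlled_margin hV K0 next_bound sz) _.
  rewrite (controlled_mean hV) /mean_shape.
  have h1 := best_le_depth; have h2 : wt z * M <= M.
    by rewrite ler_piMl ?wt_le1// mulr_ge0 ?(ltW T0)// ltW// depth_gt0.
  rewrite mulrBr; lra.
by rewrite lte_fin side_step.
Qed.

Lemma next_gap y : y \in s -> EI_target / (T * lip_const) <= `|z - y|.
Proof.
move=> ys; rewrite ler_pdivrMr ?mulr_gt0 ?lip_const_gt0// mulrC.
have jV : jet V by have [] := controlled_entire hV.
have L0 : 0 <= slope a * T by rewrite mulr_ge0 ?(ltW T0)// ltW// slope_gt0.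
apply: le_trans (EI_gap a_gt0 (controlled_uniq hV) (controlled_bound hV) next_bound ys L0 _ next_EI_target) _.
  by move=> x x' x1 x1'; rewrite !(controlled_mean hV); exact: (mean_shape_lip a_gt0 jV T0 controlled_jetW).
rewrite ler_wpM2r// /lip_const mulrDr (mulrC T (slope a)) lerD2l.
by rewrite ler_peMl// mulr_ge0 ?sd_max_ge0.
Qed.

Definition next_history := rcons_tuple h (z, answer h z).

Lemma pts_next_history : perm_eq (pts next_history) (z :: s).
Proof. by rewrite pts_rcons perm_rcons. Qed.

Lemma amplitude_sqr : amplitude h z ^+ 2 =
  T ^+ 2 * (2^-1 ^+ K.+1) ^+ 2 * (c0 / (post_var G h z * taylor_const r K.+1)).
Proof.
have v0 := post_var_gt0 a_gt0 (controlled_uniq hV) (controlled_bound hV) next_new next_bound.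
rewrite /amplitude !exprMn sqr_sqrtr.
  by case: ifP => _; rewrite ?sqrrN expr1n mul1r.
rewrite divr_ge0 ?(ltW (kernel0_gt0 a_gt0))// mulr_ge0 ?(ltW v0)//.
exact/ltW/taylor_const_gt0.
Qed.

(** The only field that requires a computation is controlled_margin.  The
    contribution of the last query alone gives the lift, and the quotient of the
    lower bound of the covariance by the upper bounds of the two standard
    deviations does not depend on x, since the product of the distances from x to
    the nodes cancels. *)
Lemma controlled_step : (0 < K)%N \/ 0 <= sg * z -> exists V', [/\ controlled next_history V',
  (forall y, y \in s -> V' 0%N y = V 0%N y) &
  forall n, `|V' n 0 - V n 0| * 2 ^+ n / n`!%:R <= T * 2^-1 ^+ K.+1].
Proof.
move=> /next_side sz.
have us := controlled_uniq hV; have bs := controlled_bound hV.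
have zs := next_new; have z1 := next_bound.
have s0 := kernel0_gt0 a_gt0.
have v0 := post_var_gt0 a_gt0 us bs zs z1.
have tc0 := taylor_const_gt0 K.+1.
have [u eu [Eu Bu]] := post_cov_jet a_gt0 us bs zs z1.
set t := amplitude h z; have t2 := amplitude_sqr; rewrite -/t in t2.
pose V' := fun n x => 1 * V n x + t * u n x.
have perm := pts_next_history; have mem y : (y \in pts next_history) = (y \in z :: s) := perm_mem perm y.
have uz : uniq (z :: s) by rewrite /= zs.
have bz y : y \in z :: s -> `|y| <= 1 by rewrite inE => /orP[/eqP ->|/bs].
have tu n x : `|x| <= 1 -> `|t * u n x| * 2 ^+ n / n`!%:R <= T * 2^-1 ^+ K.+1.
  move=> x1; have F0 : 0 <= T * 2^-1 ^+ K.+1 by rewrite mulr_ge0 ?(ltW T0)// exprn_ge0.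
  rewrite -(@ler_pXn2r _ 2)// ?nnegrE ?mulr_ge0 ?exprn_ge0 ?invr_ge0//.
  rewrite normrM -!(mulrA `|t|) [leLHS]exprMn real_normK ?num_real// t2.
  apply: le_trans (ler_wpM2l _ (Bu n x x1)) _.
    by rewrite -t2 sqr_ge0.
  rewrite le_eqVlt; apply/orP; left; apply/eqP; field.
  by rewrite !gt_eqF.
have pos x : `|x| <= 1 -> sg * x < 0 -> 0 <= t * post_cov a h z x.
  move=> x1 sx; rewrite /t /amplitude mulrAC; apply: mulr_ge0; last first.
    by rewrite mulr_ge0 ?sqrtr_ge0// mulr_ge0 ?(ltW T0)// exprn_ge0.
  have sdn : `|- sg| <= 1.
    by rewrite normrN -(@ler_pXn2r _ 2)// ?nnegrE// real_normK ?num_real// expr2 sg2 expr1n.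
  have sds : sg * - sg < 0 by rewrite mulrN sg2 oppr_lt0.
  have sn : - sg \notin s by apply/negP => /(controlled_side hV); rewrite leNgt sds.
  have H := post_cov_sign a_gt0 us bs zs z1 (controlled_side hV) sdn x1 sds sx.
  have P := post_cov_ge a_gt0 us bs zs sn z1 sdn.
  have p0 : post_cov a h z (- sg) != 0.
    rewrite -normr_gt0; apply: lt_le_trans P.
    exact: mulr_gt0 (mulr_gt0 (cov_lower_gt0 a_gt0 _) (nodal_gt0 zs)) (nodal_gt0 sn).
  move: p0 H; case: (ltgtP (post_cov a h z (- sg)) 0) => //= p0 _ H.
    by rewrite mulN1r oppr_ge0 -(nmulr_rge0 _ p0).
  by rewrite mul1r -(pmulr_rge0 _ p0).
have jetV' n x : `|x| <= 1 -> `|V' n x| * 2 ^+ n / n`!%:R <= T * (1 - 2^-1 ^+ K.+1).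
  move=> x1; have := controlled_jet hV n x1; have := tu n x x1 => H1 H2.
  apply: le_trans (_ : (`|V n x| + `|t * u n x|) * 2 ^+ n / n`!%:R <= _).
    apply: ler_wpM2r; first by rewrite invr_ge0.
    apply: ler_wpM2r; first exact: exprn_ge0.
    by rewrite /V' mul1r; exact: ler_normD.
  rewrite 2!mulrDl; apply: le_trans (lerD H2 H1) _.
  by rewrite exprS; move: (2^-1 ^+ K) => e; nra.
have cov_u x : c0 * wt x * (t * u 0%N x) = t * post_cov a h z x by rewrite Eu; ring.
exists V'; split; last first.
- move=> n; rewrite /V' mul1r addrC addKr; apply: tu; by rewrite normr0.
- move=> y ys; have := post_cov_node a_gt0 us bs z ys; rewrite Eu /V' mul1r => /eqP.
  by rewrite !mulf_eq0 (gt_eqF s0) (gt_eqF (wt_gt0 a y))/= => /eqP ->; rewrite mulr0 addr0.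
have mean' x : post_mean G next_history x = post_mean G h x + t * post_cov a h z x.
  exact: post_mean_update.
have u0 y : y \in s -> post_cov a h z y = 0 by exact: post_cov_node.
split.
- by rewrite (perm_uniq perm).
- by move=> y; rewrite mem => /bz.
- by move=> y; rewrite mem inE => /orP[/eqP ->//|/(controlled_side hV)].
- have s_n0 : s != [::] by rewrite -size_eq0 size_pts.
  have g0 : 0 <= EI_target / (T * lip_const).
    by rewrite divr_ge0 ?(ltW EI_target_gt0)// mulr_ge0 ?(ltW T0)// ltW// lip_const_gt0.
  have := separated_cons uz s_n0 g0 (ltW (sep_bound_gt0 T K.+1)) (controlled_sep hV) next_gap.
  rewrite size_pts => S y; rewrite mem => yz.
  rewrite /punctured (perm_big _ perm) -/(punctured _ _ _) /=.
  exact: le_trans (sep_step K) (S y yz).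
- by apply: entire_lin => //; exact: controlled_entire hV.
- exact: jetV'.
- by move=> x; rewrite mean' (controlled_mean hV) -cov_u /mean_shape /V'; ring.
- move=> x x1 sx; rewrite /V' mul1r addr_ge0 ?(controlled_pos hV)//.
  by rewrite -(pmulr_rge0 _ (mulr_gt0 s0 (wt_gt0 a x))) cov_u pos.
- move=> _ x x1 sx.
  have xs : x \notin s by apply/negP => /(controlled_side hV); rewrite leNgt sx.
  have Vx := controlled_pos hV x1 sx.
  apply: le_trans (_ : t * post_cov a h z x <= _); last first.
    by rewrite /V' mul1r [leRHS]mulrDr cov_u lerDr !mulr_ge0 ?(ltW s0)// ltW// wt_gt0.
  have px := pos x x1 sx.
  have bs' y : y \in pts next_history -> `|y| <= 1 by rewrite mem => /bz.
  have us' : uniq (pts next_history) by rewrite (perm_uniq perm).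
  have v'0 := post_var_ge0 a_gt0 us' bs' x1.
  have v'le := post_var_le a_gt0 us' bs' x1.
  rewrite -(@ler_pXn2r _ 2)// ?nnegrE; last by rewrite !mulr_ge0 ?sqrtr_ge0// ltW.
  have -> : (T * Num.sqrt (margin a K.+1) * Num.sqrt (post_var G next_history x)) ^+ 2 =
      T ^+ 2 * margin a K.+1 * post_var G next_history x.
    by rewrite exprMn sqr_sqrtr// [(T * _) ^+ 2]exprMn sqr_sqrtr ?margin_ge0.
  rewrite [X in _ <= X]exprMn t2.
  set nx := nodal s x.
  have nx' : nodal (pts next_history) x ^+ 2 <= 4 * nx ^+ 2.
    rewrite /nodal (perm_big _ perm) /= big_cons -/(nodal _ _) -/nx exprMn.
    rewrite ler_wpM2r ?sqr_ge0//.
    have : `|x - z| <= 2 by apply: le_trans (ler_normB _ _) _; lra.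
    rewrite -[_ ^+ 2]real_normK ?num_real//; have := normr_ge0 (x - z); nra.
  have pc := post_cov_ge a_gt0 us bs zs xs z1 x1.
  have vz := post_var_le a_gt0 us bs z1.
  have cl0 := cov_lower_gt0 a_gt0 K.+1.
  have vu0 := var_upper_gt0 K.+1; have vu1 := var_upper_gt0 K.+2.
  set nz := nodal s z in vz pc.
  have pc2 : cov_lower a K.+1 ^+ 2 * nz ^+ 2 * nx ^+ 2 <= post_cov a h z x ^+ 2.
    rewrite -[leRHS]real_normK ?num_real//.
    rewrite -[nz ^+ 2]real_normK ?num_real// -[nx ^+ 2]real_normK ?num_real// -!exprMn.
    by rewrite ler_pXn2r ?nnegrE// mulr_ge0// mulr_ge0// ltW.
  have X0 : 0 <= T ^+ 2 * (2^-1 ^+ K.+1) ^+ 2 by rewrite mulr_ge0 ?sqr_ge0.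
  have e4 : 4^-1 ^+ K.+1 = (2^-1 ^+ K.+1) ^+ 2 :> R.
    by rewrite -exprM mulnC exprM; congr (_ ^+ _); field.
  rewrite /margin e4.
  set cl := cov_lower a K.+1 in cl0 pc2 *; set tc := taylor_const _ _ in tc0 *.
  set vu := var_upper a K.+1 in vu0 vz *; set vu' := var_upper a K.+2 in vu1 v'le *.
  set v := post_var G h z in v0 vz *; set v' := post_var G next_history x in v'0 v'le *.
  set p := post_cov a h z x in pc2 *.
  clearbody cl tc vu vu' v v' p nx nz.
  have v'4 : v' <= vu' * (4 * nx ^+ 2) by apply: le_trans v'le _; rewrite ler_wpM2l// ltW.
  (* the new variance is bounded with K + 2 nodes; the distance to z costs
     the factor 4 *)
  have goal1 : cl ^+ 2 * (v' / (4 * tc * vu * vu')) <= cl ^+ 2 * nx ^+ 2 / (tc * vu).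
    rewrite -(mulrA (cl ^+ 2) (nx ^+ 2)); apply: ler_wpM2l; first exact: sqr_ge0.
    rewrite ler_pdivrMr ?mulr_gt0//.
    apply: le_trans v'4 _; rewrite le_eqVlt; apply/orP; left; apply/eqP; field.
    by rewrite !gt_eqF.
  have goal2 : cl ^+ 2 * nx ^+ 2 / (tc * vu) <= p ^+ 2 / (v * tc).
    rewrite ler_pdivrMr ?mulr_gt0// [X in _ <= X]mulrAC ler_pdivlMr ?mulr_gt0//.
    apply: le_trans (_ : cl ^+ 2 * nx ^+ 2 * (vu * nz ^+ 2 * tc) <= _).
      apply: ler_wpM2l; first by apply: mulr_ge0; exact: sqr_ge0.
      by apply: ler_wpM2r; first exact: ltW.
    rewrite (_ : _ * (_ * tc) = (cl ^+ 2 * nz ^+ 2 * nx ^+ 2) * (tc * vu)); last by ring.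
    by apply: ler_wpM2r => //; apply: ltW; exact: mulr_gt0.
  set E := (2^-1 ^+ K.+1) ^+ 2 in X0 *.
  rewrite [leLHS](_ : _ = T ^+ 2 * E * c0 * (cl ^+ 2 * (v' / (4 * tc * vu * vu')))); last by ring.
  rewrite [leRHS](_ : _ = T ^+ 2 * E * c0 * (p ^+ 2 / (v * tc))); last by ring.
  by apply: ler_wpM2l (le_trans goal1 goal2); rewrite mulr_ge0// ltW.
- by rewrite mem inE (controlled_zero hV) orbT.
- by rewrite mean' u0 ?(controlled_zero hV)// mulr0 addr0 (controlled_zero_mean hV).
Qed.

End Step.

Lemma controlled_start : controlled (adversary 0) (fun _ _ => 0).
Proof.
have T0 : 0 < T by rewrite (lt_le_trans ltr01).
have ptsE : pts (adversary 0) = [:: 0] by [].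
have us : uniq (pts (adversary 0)) by rewrite ptsE.
have bs y : y \in pts (adversary 0) -> `|y| <= 1.
  by rewrite ptsE inE => /eqP ->; rewrite normr0.
have m0 : post_mean G (adversary 0) 0 = - M.
  exact: (post_mean_node a_gt0 us bs ord0).
split => //.
- by move=> y; rewrite ptsE inE => /eqP ->; rewrite mulr0.
- move=> y; rewrite ptsE inE => /eqP ->; rewrite /punctured big_cons eqxx/= big_nil.
  exact/sep_bound_le1/ltW.
- exact: entire0.
- by move=> n x _; rewrite normr0 !mul0r expr0 subrr mulr0.
- move=> x; have [b E] := post_mean_ksum a us.
  have H y : post_mean G (adversary 0) y = c0 * wt y * (b 0 * wt 0).
    rewrite E (ksumE a_gt0) ptsE /expsum big_cons big_nil expr0 mulr0 mul0r expR0.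
    by rewrite addr0 !mulr1.
  have w0 : wt 0 = 1.
    by rewrite (_ : wt 0 = expR (- (r * 0 ^+ 2 / 2)))// expr0n/= mulr0 mul0r oppr0 expR0.
  have := m0; rewrite !H w0 /mean_shape !mulr1 mulr0 sub0r => <-.
  by ring.
- by rewrite ptsE mem_head.
Qed.

End Adversary.

(** * Infinitely differentiable functions and power series *)

Section Smooth.
Context {R : realType}.
Implicit Types (U : set R) (f g : R -> R).

(** Differentiability of order n on U, with witnesses defined everywhere; in this
    form sums and products are immediate, and no derivative has to be identified
    outside of U. *)
Fixpoint ntimes_diff U n f : Prop :=
  if n is n'.+1 then
    exists2 g, (forall x, U x -> is_derive x 1 f (g x)) & ntimes_diff U n' g
  else True.

Lemma ntimes_diffW U n f : ntimes_diff U n.+1 f -> ntimes_diff U n f.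
Proof.
elim: n f => // n IH f [g dg Hg]; exists g => //; exact: IH.
Qed.

Lemma ntimes_diff_cst U n c : ntimes_diff U n (fun=> c).
Proof.
elim: n c => // n IH c; exists (fun=> 0) => // x _; exact: is_derive_cst.
Qed.

Lemma ntimes_diffD U n f g : ntimes_diff U n f -> ntimes_diff U n g ->
  ntimes_diff U n (fun x => f x + g x).
Proof.
elim: n f g => // n IH f g [df Hf nf] [dg Hg ng].
exists (fun x => df x + dg x); last exact: IH.
by move=> x Ux; have H1 := Hf x Ux; have H2 := Hg x Ux; exact: is_deriveD.
Qed.

Lemma ntimes_diffM U n f g : ntimes_diff U n f -> ntimes_diff U n g ->
  ntimes_diff U n (fun x => f x * g x).
Proof.
elim: n f g => // n IH f g F1 G1; have [df Hf nf] := F1; have [dg Hg ng] := G1.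
exists (fun x => f x * dg x + g x * df x).
  by move=> x Ux; have H1 := Hf x Ux; have H2 := Hg x Ux; exact: is_deriveM.
apply: ntimes_diffD; apply: IH => //; exact: ntimes_diffW.
Qed.

Lemma ntimes_diff_id U n : ntimes_diff U n id.
Proof.
case: n => // n; exists (fun=> 1); last exact: ntimes_diff_cst.
by move=> x _; exact: is_derive_id.
Qed.

Lemma ntimes_diff_jet U (u : nat -> R -> R) n k :
  (forall k x, U x -> is_derive x 1 (u k) (u k.+1 x)) -> ntimes_diff U n (u k).
Proof.
move=> H; elim: n k => // n IH k; exists (u k.+1) => // x; exact: H.
Qed.

Lemma ntimes_diff_gauss U c n : ntimes_diff U n (fun x => expR (- (c * x ^+ 2 / 2))).
Proof.
elim: n => // n IH; exists (fun x => (- c) * (x * expR (- (c * x ^+ 2 / 2)))).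
  move=> x _.
  have H : is_derive x 1 (fun x : R => - (c * x ^+ 2 / 2)) (- c * x).
    rewrite (_ : (fun x : R => _) = (fun x : R => (- c / 2) * x ^+ 2)); last first.
      by apply/funext => t; field.
    by apply: is_derive_eq; rewrite /GRing.scale/=; field.
  have := @is_derive1_comp _ expR (fun x : R => - (c * x ^+ 2 / 2)) x _ _
    (is_derive_expR _) H.
  by move=> D; apply: (is_derive_eq D); ring.
apply: ntimes_diffM; first exact: ntimes_diff_cst.
by apply: ntimes_diffM => //; exact: ntimes_diff_id.
Qed.

Lemma derivable_ntimes U n f g : open U -> ntimes_diff U n.+1 f ->
  (forall x, U x -> g x = f x) ->
  forall x, U x -> derivable (g^`(n))%classic x 1.
Proof.
move=> oU; elim: n f g => [|n IH] f g [df Hf nf] gf x Ux.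
  apply: (@near_eq_derivable _ _ _ f); last by have [] := Hf x Ux.
  by near=> y; apply/esym/gf; near: y; exact: open_nbhs_nbhs.
rewrite derive1Sn; apply: IH nf _ x Ux => y Uy.
rewrite derive1E; apply: derive_val.
apply: (@near_eq_is_derive _ _ _ f); last exact: Hf.
by near=> z; apply/esym/gf; near: z; exact: open_nbhs_nbhs.
Unshelve. all: by end_near.
Qed.

Lemma smooth_onP U (lo hi : R) f : open U -> (forall x, lo <= x <= hi -> U x) ->
  lo <= hi -> (forall n, ntimes_diff U n f) -> smooth_on lo hi f.
Proof.
move=> oU subU lohi sf.
have D n x : U x -> derivable (f^`(n))%classic x 1.
  by apply: (derivable_ntimes oU (sf n.+1)).
have Cn n x : U x -> {for x, continuous (f^`(n))%classic}.
  by move=> Ux; apply: differentiable_continuous; apply/derivable1_diffP/D.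
split.
  apply: continuous_in_subspaceT => x; rewrite inE/= in_itv/= => /subU Ux.
  exact: (Cn 0%N x Ux).
move=> n; split.
- by move=> x; rewrite in_itv/= => /andP[x1 x2]; apply/D/subU; rewrite !ltW.
- apply/cvg_ex; exists ((f^`(n))%classic lo); apply: cvg_at_right_filter.
  by apply: Cn; apply: subU; rewrite lexx.
- apply/cvg_ex; exists ((f^`(n))%classic hi); apply: cvg_at_left_filter.
  by apply: Cn; apply: subU; rewrite lexx lohi.
Qed.

(** The property that survives differentiation of the power series: the radius
    of convergence is at least 2. *)
Definition decays (c : nat -> R) := forall q, 2^-1 < q ->
  exists C, forall n, `|c n| <= C * q ^+ n.

Lemma natmul_geom_le (p : R) n : 0 <= p < 1 -> n.+1%:R * p ^+ n <= (1 - p)^-1.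
Proof.
move=> /andP[p0 p1]; rewrite -(ler_pM2r (_ : 0 < 1 - p)) ?subr_gt0//.
rewrite mulVf ?gt_eqF ?subr_gt0//.
have H : (1 - p) * \sum_(i < n.+1) p ^+ i = 1 - p ^+ n.+1.
  by rewrite -opprB mulNr -subrX1 opprB.
apply: le_trans (_ : (\sum_(i < n.+1) p ^+ i) * (1 - p) <= _).
  rewrite ler_wpM2r ?subr_ge0 ?(ltW p1)//.
  rewrite -[n.+1 in leLHS]card_ord mulr_natl -sumr_const; apply: ler_sum => i _.
  by apply: ler_wiXn2l; rewrite ?(ltW p1)// -ltnS.
by rewrite mulrC H gerBl exprn_ge0.
Qed.

(** The factor n + 1 is absorbed by a ratio between 1/2 and q. *)
Lemma decays_diffs c : decays c -> decays (pseries_diffs c).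
Proof.
move=> H q q2; have [q' q'2 q'q] : exists2 q', 2^-1 < q' & q' < q.
  by exists ((q + 2^-1) / 2); lra.
have q0 : 0 < q by lra.
have q'0 : 0 < q' by lra.
have [C HC] := H q' q'2.
have C0 : 0 <= C by have := HC 0%N; rewrite expr0 mulr1; apply: le_trans.
exists (C * q' * (1 - q' / q)^-1) => n; rewrite /pseries_diffs normrM ger0_norm//.
apply: le_trans (ler_wpM2l (ler0n _ _) (HC n.+1)) _.
rewrite [leLHS](_ : _ = C * q' * q ^+ n * (n.+1%:R * (q' / q) ^+ n)); last first.
  by rewrite exprS expr_div_n; field; rewrite expf_neq0// gt_eqF.
rewrite [leRHS]mulrAC; apply: ler_wpM2l.
  by rewrite !mulr_ge0 ?exprn_ge0 ?(ltW q0) ?(ltW q'0).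
apply: natmul_geom_le; rewrite divr_ge0 ?(ltW q0) ?(ltW q'0)//=.
by rewrite ltr_pdivrMr// mul1r.
Qed.

Lemma decays_cvg c x : decays c -> `|x| < 2 -> cvgn (pseries c x).
Proof.
move=> H x2; have [q [q1 q0 qx]] : exists q, [/\ 2^-1 < q, 0 < q & q * `|x| < 1].
  have := normr_ge0 x; move: `|x| x2 => y y2 y0.
  by exists (2^-1 + (2 - y) / 8); split; [lra|lra|nra].
have [C HC] := H q q1; apply: normed_cvg.
have G : `|q * `|x| | < 1 by rewrite ger0_norm// mulr_ge0// ltW.
apply: (@series_le_cvg _ _ (geometric C (q * `|x|))); last first.
- exact: is_cvg_geometric_series.
- by move=> n /=; rewrite exprMn mulrA normrM normrX ler_wpM2r ?exprn_ge0.
- by move=> n /=; rewrite exprMn mulrA mulr_ge0 ?exprn_ge0// (le_trans _ (HC n)).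
- by move=> n /=; exact: normr_ge0.
Qed.

Lemma ntimes_diff_pseries c n : decays c ->
  ntimes_diff (ball (0 : R) 2) n (fun x => limn (pseries c x)).
Proof.
move=> H; pose u k x := limn (pseries (iter k (@pseries_diffs R) c) x).
have dk k : decays (iter k (@pseries_diffs R) c).
  by elim: k => //= k; exact: decays_diffs.
apply: (@ntimes_diff_jet _ u n 0%N) => k x; rewrite /ball/= sub0r normrN => x2.
have [K K2 xK] : exists2 K : R, `|K| < 2 & `|x| < `|K|.
  have := normr_ge0 x; move: `|x| x2 => y y2 y0.
  by exists ((y + 2) / 2); rewrite ger0_norm; lra.
apply: (@pseries_snd_diffs _ _ K) => //.
- exact: decays_cvg K2.
- exact: (decays_cvg (dk k.+1)).
- exact: (decays_cvg (dk k.+2)).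
Qed.

End Smooth.

(** * A flat bump *)

Section Bump.
Context {R : realType}.
Implicit Types (p : {poly R}) (x : R).

(** All the derivatives of exp (1 / x), extended by 0 to x >= 0, have this form. *)
Definition flat p x : R := if x < 0 then p.[x^-1] * expR x^-1 else 0.

Lemma pow_expN_le n (y : R) : 0 < y -> y ^+ n * expR (- y) <= n.+2`!%:R / y ^+ 2.
Proof.
move=> y0; rewrite expRN ler_pdivrMr ?expR_gt0// mulrAC ler_pdivlMr ?exprn_gt0//.
rewrite -exprD addn2 -ler_pdivrMl ?ltr0n ?fact_gt0// mulrC.
exact: exp_coeff_le (ltW y0).
Qed.

Lemma flat_sqr_le p : exists C, forall x, `|flat p x| <= C * x ^+ 2.
Proof.
exists (\sum_(i < size p) `|p`_i| * i.+2`!%:R) => x; rewrite /flat.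
have S0 : 0 <= \sum_(i < size p) `|p`_i| * i.+2`!%:R.
  by apply: sumr_ge0 => i _; rewrite mulr_ge0.
case: ifP => x0; last by rewrite normr0 mulr_ge0 ?sqr_ge0.
have [y y0 ->] : exists2 y, 0 < y & x = - y^-1.
  by exists (- x^-1); rewrite ?oppr_gt0 ?invr_lt0// invrN invrK opprK.
rewrite invrN invrK sqrrN exprVn horner_coef.
rewrite normrM [`|expR _|]ger0_norm ?expR_ge0//.
apply: le_trans (ler_wpM2r (expR_ge0 _) (ler_norm_sum _ _ _)) _.
rewrite !mulr_suml; apply: ler_sum => i _.
rewrite normrM -!mulrA ler_wpM2l// normrX normrN (gtr0_norm y0).
exact: pow_expN_le.
Qed.

Lemma is_derive_sqr_flat (f : R -> R) C : (forall x, `|f x| <= C * x ^+ 2) ->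
  is_derive (0 : R) 1 f 0.
Proof.
move=> H; have f0 : f 0 = 0.
  by apply/eqP; rewrite -normr_le0; have := H 0; rewrite expr0n/= mulr0.
have C0 : 0 <= C by have := H 1; rewrite expr1n mulr1; apply: le_trans.
have cv : h^-1 *: (f (h *: (1 : R) + 0) - f 0) @[h --> (0 : R)^'] --> (0 : R).
  apply/cvgrPdist_le => e e0; near=> h.
  have h0 : h != 0 by near: h; exact: nbhs_dnbhs_neq.
  rewrite f0 subr0 addr0 sub0r normrN /GRing.scale/= mulr1 normrM normfV.
  rewrite mulrC ler_pdivrMr ?normr_gt0//; apply: le_trans (H h) _.
  rewrite -[h ^+ 2]real_normK ?num_real// expr2 mulrA ler_wpM2r//.
  have hd : `|h| <= e / (C + 1).
    near: h; apply: nbhs_dnbhs; apply/nbhs_ballP.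
    exists (e / (C + 1)); first by rewrite /= divr_gt0// ltr_wpDl.
    by move=> t; rewrite /ball/= sub0r normrN; exact: ltW.
  apply: le_trans (ler_wpM2l C0 hd) _.
  rewrite mulrCA ler_piMr ?(ltW e0)// ler_pdivrMr ?ltr_wpDl// mul1r.
  by rewrite lerDl.
apply: DeriveDef; first by apply/cvg_ex; exists 0.
exact: cvg_lim cv.
Unshelve. all: by end_near.
Qed.

(** The derivative of p(1/x) exp (1/x) is q(1/x) exp (1/x) with
    q = - X^2 (p' + p). *)
Definition flat_next p : {poly R} := - 'X^2 * (p^`() + p).

(** At 0 the function is bounded by a multiple of x^2 on both sides. *)
Lemma is_derive_flat p x : is_derive x 1 (flat p) (flat (flat_next p) x).
Proof.
have [x0|x0|->] := ltgtP x 0.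
- rewrite {2}/flat x0.
  have D : is_derive x 1 (fun t : R => p.[t^-1] * expR t^-1)
      ((flat_next p).[x^-1] * expR x^-1).
    have Hi : is_derive x 1 (fun t : R => t^-1) (- x ^- 2).
      have xn : x != 0 by rewrite lt_eqF.
      have := @is_deriveV _ id x 1 1 xn (is_derive_id _ _).
      by rewrite /GRing.scale/= mulr1.
    have H1 := @is_derive1_comp _ (horner p) (fun t : R => t^-1) x _ _
       (is_derive_poly p x^-1) Hi.
    have H2 := @is_derive1_comp _ expR (fun t : R => t^-1) x _ _
       (is_derive_expR x^-1) Hi.
    have H3 := is_deriveM H1 H2.
    apply: (is_derive_eq H3).
    rewrite /flat_next !hornerE /GRing.scale/= exprVn; ring.
  apply: near_eq_is_derive D; near=> t.
  have t0 : t < 0 by near: t; exact: lt_nbhsl.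
  by rewrite /flat t0.
- rewrite {2}/flat ltNge (ltW x0)/=.
  apply: (near_eq_is_derive _ (is_derive_cst (0 : R) x 1)).
  near=> t; have t0 : 0 < t by near: t; exact: lt_nbhsr.
  by rewrite /flat ltNge (ltW t0).
- rewrite {2}/flat ltxx; have [C HC] := flat_sqr_le p.
  exact: is_derive_sqr_flat HC.
Unshelve. all: by end_near.
Qed.

Definition bump (sg x : R) : R := flat 1 (sg * x).

Lemma bump_pos sg x : sg * x < 0 -> 0 < bump sg x.
Proof. by move=> sx; rewrite /bump /flat sx hornerE mul1r expR_gt0. Qed.

Lemma bump_zero sg x : 0 <= sg * x -> bump sg x = 0.
Proof. by move=> sx; rewrite /bump /flat ltNge sx. Qed.

Lemma ntimes_diff_bump U n sg : ntimes_diff U n (bump sg).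
Proof.
pose u k x := sg ^+ k * flat (iter k flat_next 1) (sg * x).
have -> : bump sg = u 0%N by apply/funext => x; rewrite /u mul1r.
apply: ntimes_diff_jet => k x _.
have H1 : is_derive x 1 (fun t : R => sg * t) sg.
  by apply: is_derive_eq; rewrite /GRing.scale/= mulr1.
have H := @is_derive1_comp _ (flat (iter k flat_next 1)) (fun t : R => sg * t) x _ _
  (is_derive_flat _ _) H1.
have H2 : is_derive x 1 (fun t => sg ^+ k *: (flat (iter k flat_next 1) \o (fun t : R => sg * t)) t)
   (sg ^+ k *: (flat (flat_next (iter k flat_next 1)) (sg * x) * sg)) by exact: is_deriveZ.
apply: (is_derive_eq H2); rewrite /u exprSr /GRing.scale/=; ring.
Qed.

End Bump.

(** * The limit objective and the theorem *)

Section Limits.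
Context {R : realType}.

(** The sequences c K - B 2^-K and c K + B 2^-K are monotone, and the limit is
    the supremum of the former. *)
Lemma geometric_limit (c : nat -> R) B :
  (forall K, `|c K.+1 - c K| <= B * 2^-1 ^+ K.+1) ->
  exists l, forall K, `|l - c K| <= B * 2^-1 ^+ K.
Proof.
move=> H; pose lo K := c K - B * 2^-1 ^+ K; pose hi K := c K + B * 2^-1 ^+ K.
have loS K : lo K <= lo K.+1.
  by have := H K; rewrite ler_norml /lo exprS => /andP[h1 h2]; lra.
have hiS K : hi K.+1 <= hi K.
  by have := H K; rewrite ler_norml /hi exprS => /andP[h1 h2]; lra.
have B0 : 0 <= B.
  by have := le_trans (normr_ge0 _) (H 0%N); rewrite expr1 pmulr_lge0// invr_gt0.
have lohi K : lo K <= hi K.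
  have : 0 <= B * 2^-1 ^+ K by rewrite mulr_ge0// exprn_ge0.
  by rewrite /lo /hi; lra.
have lom : {homo lo : i j / (i <= j)%N >-> i <= j} by exact/nondecreasing_seqP.
have him : {homo hi : i j / (i <= j)%N >-> j <= i} by exact/nonincreasing_seqP.
have cross i j : lo i <= hi j.
  apply: le_trans (lom _ _ (leq_maxl i j)) (le_trans (lohi _) _).
  exact: him (leq_maxr i j).
have ub i : ubound (range lo) (hi i) by move=> _ [j _ <-]; exact: cross.
have hs : has_sup (range lo).
  by split; [exists (lo 0%N); exists 0%N|exists (hi 0%N); exact: ub].
exists (sup (range lo)) => K.
have h1 : lo K <= sup (range lo) by apply: ub_le_sup; [exists (hi 0%N)|exists K].
have h2 : sup (range lo) <= hi K by apply: ge_sup; [exists (lo 0%N); exists 0%N|].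
by rewrite ler_norml; move: h1 h2; rewrite /lo /hi; lra.
Qed.

Lemma geometric_small_eq0 (x C : R) : (forall K, `|x| <= C * 2^-1 ^+ K) -> x = 0.
Proof.
move=> H; apply/eqP/negPn/negP => x0.
have n0 : 0 < `|x| by rewrite normr_gt0.
have C0 : 0 <= C by have := H 0%N; rewrite expr0 mulr1; apply: le_trans.
have := archi_boundP (divr_ge0 C0 (ltW n0)); set N := Num.bound _ => hN.
have := H N; rewrite exprVn ler_pdivlMr ?exprn_gt0// leNgt mulrC -ltr_pdivrMr//.
rewrite (lt_trans hN)//; rewrite -natrX ltr_nat ltn_expl//.
Qed.

End Limits.

Section Main.
Context {R : realType}.
Variable a : R.
Hypothesis a_gt0 : 0 < a.
Local Notation G := (gaussian_kernel a).
Local Notation c0 := (kernel0 a).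
Local Notation wt := (wt a).
Variable A : forall K : nat, K.+1.-tuple (R * R) -> R.
Variables T sg : R.
Hypothesis T1 : 1 <= T.
Hypothesis sg2 : sg * sg = 1.
Local Notation M := (depth a * T).
Local Notation H := (adversary a A T sg).
Variable V : nat -> nat -> R -> R.
Hypothesis gV : forall K, controlled a T sg (H K) (V K).
Hypothesis nodeV : forall K y, y \in pts (H K) -> V K.+1 0%N y = V K 0%N y.
Hypothesis stepV : forall K n,
  `|V K.+1 n 0 - V K n 0| * 2 ^+ n / n`!%:R <= T * 2^-1 ^+ K.+1.

Let T0 : 0 < T. Proof. by rewrite (lt_le_trans ltr01). Qed.

(** The Taylor coefficients converge, at a geometric rate which keeps the radius
    of convergence. *)
Lemma limit_coefs : exists al : nat -> R, forall n K,
  `|al n - V K n 0 / n`!%:R| <= T * 2^-1 ^+ n * 2^-1 ^+ K.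
Proof.
have L n : exists l, forall K, `|l - V K n 0 / n`!%:R| <= T * 2^-1 ^+ n * 2^-1 ^+ K.
  apply: geometric_limit => K; have F0 : 0 < n`!%:R :> R by rewrite ltr0n fact_gt0.
  rewrite -mulrBl normrM (ger0_norm (ltW (_ : 0 < n`!%:R^-1))) ?invr_gt0//.
  have P0 : 0 < 2 ^+ n :> R by rewrite exprn_gt0.
  rewrite -(ler_pM2r P0) mulrAC; apply: le_trans (stepV K n) _.
  have e : (2^-1 ^+ n * 2 ^+ n = 1 :> R) by rewrite -exprMn mulVf// expr1n.
  move: (2^-1 ^+ n) (2 ^+ n) e (2^-1 ^+ K.+1) => p q e w.
  have -> : T * p * w * q = T * w * (p * q) by ring.
  by rewrite e mulr1.
by exists (fun n => sval (cid (L n))) => n; case: (cid (L n)).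
Qed.

(** The limit takes the prescribed values because the later perturbations vanish
    at the earlier nodes. *)
Lemma limit_function : exists F : R -> R,
  [/\ forall n, ntimes_diff (ball (0 : R) 2) n F,
      (forall x, `|x| <= 1 -> `|F x| <= 2 * T) &
      forall K y, y \in pts (H K) -> F y = V K 0%N y].
Proof.
have [al alV] := limit_coefs.
have V0 n x : `|x| <= 1 -> V 0%N n x = 0.
  move=> x1; have := controlled_jet (gV 0%N) n x1; rewrite expr0 subrr mulr0.
  have F0 : 0 < n`!%:R :> R by rewrite ltr0n fact_gt0.
  rewrite ler_pdivrMr// mul0r pmulr_lle0 ?exprn_gt0// normr_le0.
  by move/eqP.
have al_le n : `|al n| <= T * 2^-1 ^+ n.
  by have := alV n 0%N; rewrite V0 ?normr0// mul0r subr0 expr0 mulr1.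
have dal : decays al.
  move=> q q2; exists T => n; apply: le_trans (al_le n) _.
  by rewrite ler_wpM2l ?(ltW T0)// lerXn2r ?nnegrE ?(ltW q2)// (le_trans _ (ltW q2)).
pose F x := limn (pseries al x).
have FV K x : `|x| <= 1 -> `|F x - V K 0%N x| <= 2 * T * 2^-1 ^+ K.
  move=> x1.
  have cF : pseries al x @ \oo --> F x.
    by apply: decays_cvg => //; rewrite (le_lt_trans x1)// ltr1n.
  have [_ cV] := controlled_entire (gV K).
  have cD := cvgB cF (cV x).
  apply: (norm_lim_le (cD _)) => N.
  rewrite (_ : _ N = \sum_(0 <= n < N) (al n * x ^+ n - V K n 0 / n`!%:R * x ^+ n)); last first.
    by rewrite sumrB.
  apply: le_trans (ler_norm_sum _ _ _) _.
  apply: le_trans (_ : \sum_(0 <= n < N) T * 2^-1 ^+ K * 2^-1 ^+ n <= _).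
    apply: ler_sum => n _; rewrite -mulrBl normrM normrX.
    apply: le_trans (ler_piMr (normr_ge0 _) (exprn_ile1 _ (normr_ge0 _) x1)) _.
    by rewrite mulrAC alV.
  rewrite -mulr_sumr (_ : 2 * T * _ = T * 2^-1 ^+ K * 2); last by ring.
  by rewrite ler_wpM2l ?half_sum_le// mulr_ge0 ?(ltW T0)// exprn_ge0.
exists F; split.
- by move=> n; exact: ntimes_diff_pseries.
- by move=> x x1; have := FV 0%N x x1; rewrite V0// subr0 expr0 mulr1.
- move=> K y yK; have y1 := controlled_bound (gV K) yK.
  have ptsJ J : y \in pts (H (K + J)).
    elim: J => [|J IH]; first by rewrite addn0.
    by rewrite addnS /= pts_rcons mem_rcons inE IH orbT.
  have VJ J : V (K + J)%N 0%N y = V K 0%N y.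
    elim: J => [|J IH]; first by rewrite addn0.
    by rewrite addnS nodeV.
  apply/eqP; rewrite -subr_eq0; apply/eqP; apply: (@geometric_small_eq0 _ _ (2 * T)) => J.
  rewrite -(VJ J); apply: le_trans (FV _ _ y1) _.
  rewrite exprD ler_wpM2l ?mulr_ge0 ?(ltW T0)// ler_piMl ?exprn_ge0//.
  exact: half_pow.
Qed.

(** The trajectory of f and the game of the adversary agree by induction: f
    takes at each query the value answered by the adversary. *)
Lemma adversarial_function : exists f : R -> R,
  [/\ smooth_on (-1) 1 f, (forall K, trajectory A f 0 K = H K) &
   exists B x, [/\ `|x| <= 1, (forall K, B <= best (H K)) & f x < B]].
Proof.
have [F [sF bF nF]] := limit_function.
have s0 := kernel0_gt0 a_gt0; have d0 := depth_gt0 a_gt0.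
pose f0 x := wt x * (c0 * F x - M).
pose B := c0 * (2 * T) + M.
have f0B x : `|x| <= 1 -> `|f0 x| <= B.
  move=> x1; rewrite normrM (gtr0_norm (wt_gt0 a x)).
  apply: le_trans (ler_piMl (normr_ge0 _) (wt_le1 a_gt0 x)) _.
  apply: le_trans (ler_normB _ _) _; apply: lerD.
    by rewrite normrM (gtr0_norm s0) ler_wpM2l ?bF// ltW.
  by rewrite ger0_norm// mulr_ge0 ?(ltW T0)// ltW.
have sds : sg * - sg < 0 by rewrite mulrN sg2 oppr_lt0.
have sd1 : `|- sg| <= 1.
  by rewrite normrN -(@ler_pXn2r _ 2)// ?nnegrE// real_normK ?num_real// expr2 sg2 expr1n.
have b0 : 0 < bump sg (- sg) by exact: bump_pos.
(* large enough for f (- sg) to be below - B, a lower bound of the observed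
   values *)
pose N := (2 * B + 2) / bump sg (- sg).
pose f x := f0 x + (- N) * bump sg x.
have fnode K k : f (pt (H K) k) = obs (H K) k.
  have ys := pt_in (H K) k; have g := gV K.
  rewrite /f bump_zero ?(controlled_side g)// mulr0 addr0 /f0 (nF _ _ ys).
  by rewrite -(post_mean_node a_gt0 (controlled_uniq g) (controlled_bound g)) (controlled_mean g).
have traj K : trajectory A f 0 K = H K.
  elim: K => [|K IH].
    by have := fnode 0%N ord0; rewrite /pt /obs/= => ->.
  have := fnode K.+1 ord_max; rewrite /= IH.
  have -> : pt (H K.+1) ord_max = A (H K).
    by rewrite /pt (tnth_nth (0, 0))/= nth_rcons size_tuple ltnn eqxx.
  have -> : obs (H K.+1) ord_max = answer a T sg (H K) (A (H K)).
    by rewrite /obs (tnth_nth (0, 0))/= nth_rcons size_tuple ltnn eqxx.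
  by move=> ->.
exists f; split => //.
- apply: (@smooth_onP _ (ball (0 : R) 2)) => [|x /andP[x1 x2]||n].
  + exact: ball_open.
  + rewrite /ball/= sub0r normrN ltr_norml; apply/andP; split; lra.
  + lra.
  + apply: ntimes_diffD; last first.
      by apply: ntimes_diffM; [exact: ntimes_diff_cst|exact: ntimes_diff_bump].
    apply: ntimes_diffM; first exact: ntimes_diff_gauss.
    apply: ntimes_diffD; last exact: ntimes_diff_cst.
    by apply: ntimes_diffM; first exact: ntimes_diff_cst.
- exists (- B), (- sg); split => //.
    move=> K; have g := gV K.
    have [y ys <-] := best_attained a_gt0 (controlled_uniq g) (controlled_bound g).
    have y1 := controlled_bound g ys.
    have -> : post_mean G (H K) y = f0 y by rewrite (controlled_mean g) /f0 (nF _ _ ys).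
    by have := f0B y y1; rewrite ler_norml => /andP[].
  have := f0B _ sd1; rewrite /f /N mulNr divfK ?gt_eqF// ler_norml => /andP[_ h].
  lra.
Qed.

End Main.

Theorem corollary1 (R : realType) (a : R) (a_gt0 : 0 < a)
    (A : forall K : nat, K.+1.-tuple (R * R) -> R)
    (A_EI : EI_rule (gaussian_kernel a) A) :
  exists f : R -> R,
    smooth_on (-1) 1 f /\
    exists fmin : R,
      (f @` `[-1, 1]) fmin /\ lbound (f @` `[-1, 1]) fmin /\
      ~ (best (trajectory A f 0 K) @[K --> \oo] --> fmin).
Proof.
have [T T1 [sep side]] := exists_scale a_gt0 (curv_const_gt0 a_gt0) (lip_const_gt0 a_gt0).
pose z0 := A 0%N [tuple (0, - (depth a * T))].
pose sg : R := if 0 <= z0 then 1 else -1.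
have sg2 : sg * sg = 1 by rewrite /sg; case: ifP => _; ring.
have sz0 : 0 <= sg * z0.
  rewrite /sg; case: ifP => [z|/negbT]; first by rewrite mul1r.
  by rewrite -ltNge mulN1r oppr_ge0 => /ltW.
pose H := adversary a A T sg.
have next K V (gV : controlled a T sg (H K) V) := controlled_step a_gt0 A_EI T1 sep side sg2 gV.
have first_side K : (0 < K)%N \/ 0 <= sg * A K (H K).
  by case: K => [|K]; [right|left].
(* the perturbations are selected step by step, as they must form a coherent
   sequence *)
pose S K := {V | controlled a T sg (H K) V}.
pose nxt K (V : S K) : S K.+1 :=
  let W := cid (next K (sval V) (svalP V) (first_side K)) in
  exist _ (sval W) (let: And3 g _ _ := svalP W in g).
pose V : forall K, S K := fix V K : S K :=
  match K with
  | 0 => exist _ (fun _ _ => 0) (controlled_start a_gt0 A sg T1)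
  | K'.+1 => nxt K' (V K')
  end.
have [f [sf tr [B [x [x1 bestB fx]]]]] := @adversarial_function R a a_gt0 A T sg T1 sg2
  (fun K => sval (V K)) (fun K => svalP (V K))
  (fun K => let: And3 _ p _ := svalP (cid (next K (sval (V K)) (svalP (V K)) (first_side K))) in p)
  (fun K => let: And3 _ _ p := svalP (cid (next K (sval (V K)) (svalP (V K)) (first_side K))) in p).
exists f; split => //.
have le11 : -1 <= 1 :> R by lra.
have [c cI cmin] := EVT_min le11 sf.1.
exists (f c); split; first by exists c.
split; first by move=> _ [t tI <-]; exact: cmin.
have fcB : f c < B.
  by apply: le_lt_trans fx; apply: cmin; rewrite in_itv/= -ler_norml.
move=> cv; have [n _ /(_ n (leqnn n))] := cvgr_lt _ cv _ fcB.
by rewrite /= tr ltNge bestB.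
Qed.
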